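(* Consider the distributed algorithm $$\boldsymbol\theta_n=(W_n\otimes I_d)\,P_{G^N}\left[\boldsymbol\theta_{n-1}+\gamma_n\boldsymbol Y_n\right],\qquad n\ge 1,$$ and suppose that Assumptions 1, 2 and 3 (written out in the context) hold. Let $f:=\frac1N\sum_{i=1}^Nf_i$, $\mu:=\sup_{\boldsymbol\theta\in G^N}\int|\boldsymbol y|\,d\mu_{\boldsymbol\theta}(\boldsymbol y)$, and define the set-valued map $$F(\theta):=\{-\nabla f(\theta)-z:\ z\in\mathcal N_G(\theta),\ |z|\le3\mu\},\qquad\theta\in\mathbb R^d.$$ Let $\tau_0=0$, $\tau_n:=\sum_{k=1}^n\gamma_k$, and let $\Theta:[0,+\infty)\to\mathbb R^d$ be the interpolated process $$\Theta(\tau_{n-1}+t):=\langle\boldsymbol\theta_{n-1}\rangle+t\,\frac{\langle\boldsymbol\theta_n\rangle-\langle\boldsymbol\theta_{n-1}\rangle}{\tau_n-\tau_{n-1}},\qquad t\in[0,\gamma_n),\ n\ge1.$$ Then, with probability one, $\Theta$ is a perturbed solution to the differential inclusion $\frac{dx}{dt}\in F(x)$.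
   Context: **Notation.** $N\ge1$, $d\ge1$ are integers; $|\cdot|$ is the Euclidean norm; $\mathbf 1\in\mathbb R^N$ is the all-ones vector; $I_k$ is the $k\times k$ identity; $\otimes$ is the Kronecker product. $P_C$ is the Euclidean projection onto a closed convex set $C$, and $G^N=G\times\cdots\times G\subset\mathbb R^{dN}$. For $\boldsymbol x=(x_1^T,\dots,x_N^T)^T\in\mathbb R^{dN}$ with $x_i\in\mathbb R^d$, $\langle\boldsymbol x\rangle:=(x_1+\cdots+x_N)/N$. For $\theta\in\mathbb R^d$, $\mathcal N_G(\theta):=\{v\in\mathbb R^d:\forall\theta'\in G,\ v^T(\theta-\theta')\ge0\}$. $\mathsf d(x,A):=\inf\{|x-a|:a\in A\}$. **Perturbed solution.** A function $y:[0,\infty)\to\mathbb R^d$ is a perturbed solution to $\frac{dx}{dt}\in F(x)$ if it is absolutely continuous (on every compact interval) and there exists a locally integrable function $U:[0,\infty)\to\mathbb R^d$ such that (i) for every $T>0$, $\lim_{t\to\infty}\sup_{0\le v\le T}\left|\int_t^{t+v}U(s)\,ds\right|=0$; and (ii) there is $\delta:[0,\infty)\to[0,\infty)$ with $\lim_{t\to\infty}\delta(t)=0$ and $\frac{dy(t)}{dt}-U(t)\in F^{\delta(t)}(y(t))$ for almost every $t>0$, where $F^\delta(\theta):=\{z\in\mathbb R^d:\exists\theta',\ |\theta-\theta'|<\delta,\ \mathsf d(z,F(\theta'))<\delta\}$. **Algorithm.** $f_1,\dots,f_N:\mathbb R^d\to\mathbb R$ are functions, $(\gamma_n)_{n\ge1}$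 is a deterministic sequence, $\boldsymbol\theta_0$ is a random vector in $\mathbb R^{dN}$, $(\boldsymbol Y_n)_{n\ge1}$ are random vectors in $\mathbb R^{dN}$ and $(W_n)_{n\ge1}$ are random $N\times N$ matrices, all on one probability space $(\Omega,\mathbb P)$ with expectation $\mathbb E$. Write $\boldsymbol\theta_n=(\theta_{n,1}^T,\dots,\theta_{n,N}^T)^T$ and $\mathcal F_n:=\sigma(\boldsymbol\theta_0,\boldsymbol Y_1,\dots,\boldsymbol Y_n,W_1,\dots,W_n)$, $n\ge1$. $(\mu_{\boldsymbol\theta})_{\boldsymbol\theta\in\mathbb R^{dN}}$ is a given family of probability measures on $\mathbb R^{dN}$. **Assumption 1.** (a) Each $W_n$ has non-negative entries, $W_n\mathbf 1=\mathbf 1$, and $\mathbf 1^T\mathbb E(W_n)=\mathbf 1^T$. (b) The spectral norm $\rho_n$ of $\mathbb E\left(W_n^T(I_N-\mathbf 1\mathbf 1^T/N)W_n\right)$ satisfies $\lim_{n\to\infty}n(1-\rho_n)=+\infty$. (c) For every $n\ge 1$: conditionally on $\mathcal F_n$, $W_{n+1}$ and $\boldsymbol Y_{n+1}$ are independent; $W_{n+1}$ is independent of $\mathcal F_n$ (so $(W_n)$ is an independent, not necessarily identically distributed, sequence); and $\mathbb P(\boldsymbol Y_{n+1}\in A\mid\mathcal F_n)=\mu_{\boldsymbol\theta_n}(A)$ for every measurable $A$. (d) Each $f_i$ is continuously differentiable. (e) For every $n\ge1$, $\mathbb E[\boldsymbol Y_{n+1}\mid\mathcal F_n]=-(\nabla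 f_1(\theta_{n,1})^T,\dots,\nabla f_N(\theta_{n,N})^T)^T$. (f) $\sup_{\boldsymbol\theta\in G^N}\int|\boldsymbol y|^2\,d\mu_{\boldsymbol\theta}(\boldsymbol y)<\infty$. **Assumption 2.** (a) $\gamma_n>0$ for all $n$ and $\sum_n\gamma_n=\infty$. (b) There is $\alpha>1/2$ with $\lim_{n\to\infty}n^\alpha\gamma_n=0$ and $\liminf_{n\to\infty}\frac{1-\rho_n}{n^\alpha\gamma_n}>0$. **Assumption 3.** $G=\{\theta\in\mathbb R^d:\ q_j(\theta)\le0,\ j=1,\dots,p\}$ with $1\le p<\infty$, where (a) $G$ is nonempty and compact; (b) each $q_j:\mathbb R^d\to\mathbb R$ is convex, and continuously differentiable in a neighborhood of the boundary $\partial G$; (c) for every $\theta\in\partial G$, the vectors $(\nabla q_j(\theta):j\in A(\theta))$ are linearly independent, where $A(\theta)=\{j:q_j(\theta)=0\}$ is the active set at $\theta\in G$. *)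

(* Defs.v *)
From HB Require Import structures.
From mathcomp Require Import all_boot all_order all_algebra.
From mathcomp Require Import all_classical all_reals all_analysis.
From mathcomp.real_closed Require Export mxtens.

Set Implicit Arguments.
Unset Strict Implicit.
Unset Printing Implicit Defensive.

Import Order.TTheory GRing.Theory Num.Theory.
Import numFieldNormedType.Exports.

Local Open Scope classical_set_scope.
Local Open Scope ring_scope.

(* The Borel sigma-algebra on spaces of matrices (hence on column vectors). *)
HB.instance Definition _ (R : realType) (m n : nat) :=
  @isMeasurable.Build (sigma_display (@open 'M[R]_(m, n))) 'M[R]_(m, n)
    <<s @open 'M[R]_(m, n) >>
    (@sigma_algebra0 _ setT (@open 'M[R]_(m, n)))
    (@sigma_algebraC 'M[R]_(m, n) (@open 'M[R]_(m, n)))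
    (@sigma_algebra_bigcup _ setT (@open 'M[R]_(m, n))).

Section Euclidean.
Context {R : realType}.

Definition dotv n (u v : 'cV[R]_n) : R := (u^T *m v) 0 0.

(* The library norm [`|x|] on matrices is the sup norm: it induces the same
   topology, but it is not the Euclidean norm. *)
Definition enorm n (x : 'cV[R]_n) : R := Num.sqrt (dotv x x).

Definition spectral_norm m n (A : 'M[R]_(m, n)) : R :=
  sup [set enorm (A *m x) | x in [set x : 'cV[R]_n | enorm x <= 1]].

(* Extended-real valued, so that the distance to the empty set is [+oo]. *)
Definition dist_to n (x : 'cV[R]_n) (A : set 'cV[R]_n) : \bar R :=
  ereal_inf [set (enorm (x - a))%:E | a in A].

(* Euclidean projection; meaningful for [C] nonempty, closed and convex. *)
Definition eproj n (C : set 'cV[R]_n) (x : 'cV[R]_n) : 'cV[R]_n :=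
  get [set y | C y /\ forall z, C z -> enorm (x - y) <= enorm (x - z)].

Definition normal_cone n (G : set 'cV[R]_n) (x : 'cV[R]_n) : set 'cV[R]_n :=
  [set v | forall x', G x' -> 0 <= dotv v (x - x')].

Definition grad n (f : 'cV[R]_n -> R) (x : 'cV[R]_n) : 'cV[R]_n :=
  \col_k 'D_(delta_mx k 0) (f : _ -> R^o) x.

(* Meaningful for [V] open: both conditions only involve neighborhoods of [x]. *)
Definition C1_on n (V : set 'cV[R]_n) (f : 'cV[R]_n -> R) : Prop :=
  forall x, V x ->
    differentiable (f : _ -> R^o) x /\ {for x, continuous (grad f)}.

Definition boundary n (G : set 'cV[R]_n) : set 'cV[R]_n :=
  closure G `\` interior G.

End Euclidean.

(* A vector of R^(dN) is a column of size [N * d]; the [k]-th coordinate of its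
   [i]-th block sits at the index used by the Kronecker product [_ *t _]. *)
Section Blocks.
Context {R : realType} {N d : nat}.

Definition block (x : 'cV[R]_(N * d)) (i : 'I_N) : 'cV[R]_d :=
  \col_k x (mxtens_index (i, k)) 0.

Definition stack (v : 'I_N -> 'cV[R]_d) : 'cV[R]_(N * d) :=
  \col_l v (mxtens_unindex l).1 (mxtens_unindex l).2 0.

Definition blockpow (G : set 'cV[R]_d) : set 'cV[R]_(N * d) :=
  [set x | forall i, G (block x i)].

Definition avg (x : 'cV[R]_(N * d)) : 'cV[R]_d :=
  N%:R^-1 *: \sum_i block x i.

End Blocks.

Section PerturbedSolutions.
Context {R : realType} {d : nat}.
Implicit Types (F : 'cV[R]_d -> set 'cV[R]_d) (y U : R -> 'cV[R]_d).

Definition abs_continuous_on (a b : R) y : Prop :=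
  forall e : R, 0 < e -> exists2 dl : R, 0 < dl &
    forall (n : nat) (l r : 'I_n -> R),
      (forall i, [/\ a <= l i, l i <= r i & r i <= b]) ->
      trivIset setT (fun i => `]l i, r i[%classic) ->
      \sum_i (r i - l i) < dl ->
      \sum_i enorm (y (r i) - y (l i)) < e.

Definition loc_integrable_ge0 U : Prop :=
  forall (T : R) (k : 'I_d), 0 < T ->
    (@lebesgue_measure R).-integrable `[0, T] (fun s => (U s k 0)%:E).

Definition vintegral (a b : R) U : 'cV[R]_d :=
  \col_k \int[@lebesgue_measure R]_(s in `[a, b]) (U s k 0).

Definition enlargement F (delta : R) (x : 'cV[R]_d) : set 'cV[R]_d :=
  [set z | exists x', enorm (x - x') < delta /\
                      (dist_to z (F x') < delta%:E)%E].

(* Only the values of [y], [U] and [delta] on [0, +oo) matter. *)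
Definition perturbed_solution F y : Prop :=
  (forall a b : R, 0 <= a -> a <= b -> abs_continuous_on a b y) /\
  exists U, [/\ loc_integrable_ge0 U,
    (forall T : R, 0 < T ->
       ereal_sup [set (enorm (vintegral t (t + v) U))%:E | v in `[0, T]]
         @[t --> +oo] --> 0%E)
  & exists delta : R -> R, [/\ (forall t, 0 <= t -> 0 <= delta t),
       delta t @[t --> +oo] --> (0 : R)
     & {ae @lebesgue_measure R, forall t, 0 < t ->
          derivable y t 1 /\
          enlargement F (delta t) (y t) (derive1 y t - U t)}]].

End PerturbedSolutions.

Section Probability.
Context {disp : measure_display} {Omega : measurableType disp} {R : realType}.
Variable P : probability Omega R.

(* [E[X | F] = V] almost surely, for a sub-sigma-algebra [F] of [Omega]:
   [V] is almost surely equal to an [F]-measurable version [Z]. *)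
Definition is_cond_exp (F : set (set Omega)) (X V : Omega -> R) : Prop :=
  P.-integrable setT (EFin \o X) /\
  exists Z : Omega -> R,
    [/\ preimage_set_system setT Z measurable `<=` F,
        P.-integrable setT (EFin \o Z),
        (forall A, F A ->
           (\int[P]_(w in A) (X w)%:E = \int[P]_(w in A) (Z w)%:E)%E)
      & {ae P, forall w, Z w = V w}].

Definition is_cond_prob (F : set (set Omega)) (E : set Omega)
    (V : Omega -> R) : Prop :=
  is_cond_exp F (\1_E) V.

Definition is_cond_exp_vec n (F : set (set Omega))
    (X V : Omega -> 'cV[R]_n) : Prop :=
  forall k, is_cond_exp F (fun w => X w k 0) (fun w => V w k 0).

Definition cond_indep d1 d2 (T1 : measurableType d1) (T2 : measurableType d2)
    (F : set (set Omega)) (X : Omega -> T1) (Y : Omega -> T2) : Prop :=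
  forall A B, measurable A -> measurable B ->
    exists p1 p2 : Omega -> R,
      [/\ is_cond_prob F (X @^-1` A) p1,
          is_cond_prob F (Y @^-1` B) p2
        & is_cond_prob F (X @^-1` A `&` Y @^-1` B) (fun w => p1 w * p2 w)].

Definition indep_of_sigma d1 (T1 : measurableType d1)
    (X : Omega -> T1) (F : set (set Omega)) : Prop :=
  forall A E, measurable A -> F E ->
    (P (X @^-1` A `&` E) = P (X @^-1` A) * P E)%E.

Definition Emx m n (M : Omega -> 'M[R]_(m, n)) : 'M[R]_(m, n) :=
  \matrix_(i, j) fine 'E_P[(fun w => M w i j)].

End Probability.

Section Algorithm.
Context {disp : measure_display} {Omega : measurableType disp} {R : realType}.
Context {N d : nat}.

(* sigma(theta_0, Y_1, ..., Y_n, W_1, ..., W_n) *)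
Definition history (theta0 : Omega -> 'cV[R]_(N * d))
    (Y : nat -> Omega -> 'cV[R]_(N * d)) (W : nat -> Omega -> 'M[R]_N)
    (n : nat) : set (set Omega) :=
  <<s preimage_set_system setT theta0 measurable `|`
      \bigcup_(k in [set k | (1 <= k <= n)%N])
        (preimage_set_system setT (Y k) measurable `|`
         preimage_set_system setT (W k) measurable) >>.

Definition ones : 'cV[R]_N := const_mx 1.

(* The spectral norm of E(W_n^T (I_N - 1 1^T / N) W_n). *)
Definition rho (P : probability Omega R) (W : nat -> Omega -> 'M[R]_N)
    (n : nat) : R :=
  spectral_norm (Emx P (fun w =>
    (W n w)^T *m (1%:M - N%:R^-1 *: (ones *m ones^T)) *m W n w)).

Definition tau (gamma : nat -> R) (n : nat) : R :=
  \sum_(1 <= k < n.+1) gamma k.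

(* { - grad f(x) - z : z in the normal cone of G at x, |z| <= r } *)
Definition projected_drift (f : 'cV[R]_d -> R) (G : set 'cV[R]_d) (r : \bar R)
    (x : 'cV[R]_d) : set 'cV[R]_d :=
  [set - grad f x - z |
     z in [set z | normal_cone G x z /\ ((enorm z)%:E <= r)%E]].

End Algorithm.

(* Main.v *)
(* Let [x_n] be the average of the iterates.  Since [W_(n+1)] is independent of
   the past and of [Y_(n+1)], the disagreement between the agents contracts in
   mean by the factor [rho], up to a term of order [gamma^2]; Assumption 2 makes
   its expectation [O(n^(-2 alpha))], hence summable, so the agents reach
   consensus almost surely and the fluctuations created by the [W_n] form a
   convergent martingale.

   Averaging the projected step gives
   [x_(n+1) - x_n = gamma_(n+1) h_n + noise_(n+1)], where
   [h_n = - (1/N) sum_i grad f_i(theta_(n,i)) - z_n] and [z_n] is the conditional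
   expectation of the part of the increment which is lost to the projection.  The
   convexity of [G] and the moment bound show that [|z_n| <= mu] and that [z_n]
   almost lies in the normal cone of [G] at [x_n]: projecting [x_n + z_n] on [G]
   produces a nearby point [p_n] with the exact normal vector [x_n + z_n - p_n].
   Hence [h_n] is asymptotically in [F(p_n)] with [p_n] close to [x_n], which is
   what a perturbed solution requires: [U] is the step function equal to
   [noise_(n+1) / gamma_(n+1)], and the distance from [h_n] to [F(p_n)] goes into
   [delta]. *)

(* The contraction factor is the norm of an expected matrix, so a single path need not contract:
   consensus has to come from summable second moments. The rate n^(-2 alpha) can be sustained
   because it loses only a fraction of order 2 alpha / n per step, small against 1 - rho_n.
   Normality is the delicate point. Each agent is projected at its own point, and the conditional
   expectation of the averaged defects need not be normal anywhere. What survives is an approximate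
   inequality against p - x_n for p in G. It is used at the single random point p = p_n, which is
   measurable with respect to the past, so no null set depends on p. Conditioning starts after the
   first step and theta_0 need not lie in G^N; the stochastic estimates therefore concern
   theta_(n+1), and index 0 receives separate values. Conditional expectations are handled in
   integrated form, through means against bounded measurable test functions. *)
Require Import Defs.
From HB Require Import structures.
From mathcomp Require Import all_boot all_order all_algebra.
From mathcomp Require Import all_classical all_reals all_analysis.
From mathcomp Require Import measurable_realfun.
From mathcomp Require Import ring lra.

Set Implicit Arguments.
Unset Strict Implicit.
Unset Printing Implicit Defensive.

Import Order.TTheory GRing.Theory Num.Theory.
Import numFieldNormedType.Exports.

Local Open Scope classical_set_scope.
Local Open Scope ring_scope.

(** * Euclidean geometry and projections *)

Section dot_product.
Context {R : realType} {n : nat}.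
Implicit Types (u v w : 'cV[R]_n).

Lemma coordD u v k : (u + v) k 0 = u k 0 + v k 0.
Proof. by rewrite mxE. Qed.

Lemma coordN u k : (- u) k 0 = - u k 0.
Proof. by rewrite mxE. Qed.

Lemma coordZ a u k : (a *: u) k 0 = a * u k 0.
Proof. by rewrite mxE. Qed.

Lemma coordB u v k : (u - v) k 0 = u k 0 - v k 0.
Proof. by rewrite coordD coordN. Qed.

Definition coordE := (coordD, coordN, coordZ).

Lemma dotvE u v : dotv u v = \sum_i u i 0 * v i 0.
Proof. by rewrite /dotv !mxE; apply: eq_bigr => i _; rewrite mxE. Qed.

Lemma dotvC u v : dotv u v = dotv v u.
Proof. by rewrite !dotvE; apply: eq_bigr => i _; rewrite mulrC. Qed.

Lemma dotvDl u v w : dotv (u + v) w = dotv u w + dotv v w.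
Proof. by rewrite /dotv linearD mulmxDl mxE. Qed.

Lemma dotvNl u w : dotv (- u) w = - dotv u w.
Proof. by rewrite /dotv linearN mulNmx mxE. Qed.

Lemma dotvZl a u w : dotv (a *: u) w = a * dotv u w.
Proof. by rewrite /dotv linearZ -scalemxAl mxE. Qed.

Lemma dotvDr u v w : dotv w (u + v) = dotv w u + dotv w v.
Proof. by rewrite !(dotvC w) dotvDl. Qed.

Lemma dotvNr u w : dotv w (- u) = - dotv w u.
Proof. by rewrite !(dotvC w) dotvNl. Qed.

Lemma dotvZr a u w : dotv w (a *: u) = a * dotv w u.
Proof. by rewrite !(dotvC w) dotvZl. Qed.

Lemma dotv_suml (I : Type) (r : seq I) (F : I -> 'cV[R]_n) w :
  dotv (\sum_(i <- r) F i) w = \sum_(i <- r) dotv (F i) w.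
Proof.
elim/big_rec2 : _ => [|i x y _ <-]; last by rewrite dotvDl.
by rewrite dotvE big1 // => i _; rewrite mxE mul0r.
Qed.

Definition dotv_lin := (dotvDl, dotvDr, dotvNl, dotvNr, dotvZl, dotvZr).

Lemma dotvv_ge0 u : 0 <= dotv u u.
Proof. by rewrite dotvE sumr_ge0 // => i _; rewrite -expr2 sqr_ge0. Qed.

Lemma enorm_ge0 u : 0 <= enorm u.
Proof. exact: sqrtr_ge0. Qed.

Lemma sqr_enorm u : enorm u ^+ 2 = dotv u u.
Proof. by rewrite sqr_sqrtr // dotvv_ge0. Qed.

Lemma sqr_enormE u : enorm u ^+ 2 = \sum_i u i 0 ^+ 2.
Proof. by rewrite sqr_enorm dotvE. Qed.

Lemma dotv0l u : dotv 0 u = 0.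
Proof. by rewrite dotvE big1 // => i _; rewrite mxE mul0r. Qed.

Lemma enorm0 : enorm (0 : 'cV[R]_n) = 0.
Proof. by rewrite /enorm dotv0l sqrtr0. Qed.

Lemma enormN u : enorm (- u) = enorm u.
Proof. by rewrite /enorm dotvNl dotvNr opprK. Qed.

Lemma enormZ a u : enorm (a *: u) = `|a| * enorm u.
Proof. by rewrite /enorm dotvZl dotvZr mulrA -expr2 sqrtrM ?sqr_ge0// sqrtr_sqr. Qed.

Lemma enormB u v : enorm (u - v) = enorm (v - u).
Proof. by rewrite -enormN opprB. Qed.

Lemma sqr_enormD u v :
  enorm (u + v) ^+ 2 = enorm u ^+ 2 + 2 * dotv u v + enorm v ^+ 2.
Proof. rewrite !sqr_enorm !dotv_lin (dotvC v u); ring. Qed.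

Lemma enorm_eq0 u : enorm u = 0 -> u = 0.
Proof.
move=> u0; apply/matrixP => i j; rewrite ord1 mxE.
have /psumr_eq0P H : \sum_i u i 0 ^+ 2 = 0 by rewrite -sqr_enormE u0 expr0n.
by apply/eqP; rewrite -sqrf_eq0 H// => k _; exact: sqr_ge0.
Qed.

Lemma dotv_le u v : dotv u v <= enorm u * enorm v.
Proof.
have [v0|v0] := eqVneq (enorm v) 0.
  by rewrite v0 (enorm_eq0 v0) dotvC dotv0l mulr0.
(* Cauchy-Schwarz from the squared norm of |v|^2 u - <u,v> v, the component of [u] orthogonal to [v]
   scaled so that no division occurs. *)
have H := dotvv_ge0 ((enorm v ^+ 2) *: u - dotv u v *: v).
have {}H : 0 <= enorm v ^+ 2 * ((enorm u * enorm v) ^+ 2 - dotv u v ^+ 2).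
  rewrite exprMn 2!sqr_enorm.
  by move: H; rewrite !dotv_lin (dotvC v u) sqr_enorm; congr (_ <= _); ring.
rewrite pmulr_rge0 ?exprn_gt0 ?lt_neqAle 1?eq_sym ?v0 ?enorm_ge0// in H.
rewrite subr_ge0 in H.
by rewrite (le_trans (ler_norm _))// -ler_sqr ?nnegrE ?mulr_ge0 ?enorm_ge0//
  real_normK ?num_real.
Qed.

Lemma normr_dotv_le u v : `|dotv u v| <= enorm u * enorm v.
Proof. by rewrite ler_norml dotv_le andbT lerNl -dotvNl -(enormN u) dotv_le. Qed.

Lemma enormD u v : enorm (u + v) <= enorm u + enorm v.
Proof.
rewrite -ler_sqr ?nnegrE ?addr_ge0 ?enorm_ge0// sqr_enormD sqrrD.
have := dotv_le u v; lra.
Qed.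

Lemma enorm_triangle w u v : enorm (u - v) <= enorm (u - w) + enorm (w - v).
Proof. by rewrite (le_trans _ (enormD _ _))// addrA subrK. Qed.

Lemma enorm_sum (I : Type) (r : seq I) (F : I -> 'cV[R]_n) :
  enorm (\sum_(i <- r) F i) <= \sum_(i <- r) enorm (F i).
Proof.
elim/big_rec2 : _ => [|i x y _ H]; first by rewrite enorm0.
by rewrite (le_trans (enormD _ _))// lerD2l.
Qed.

Lemma coord_le_enorm u i : `|u i 0| <= enorm u.
Proof.
rewrite -ler_sqr ?nnegrE ?enorm_ge0// sqr_enormE real_normK ?num_real//.
by rewrite (bigD1 i)//= lerDl sumr_ge0// => *; exact: sqr_ge0.
Qed.

Lemma enorm_le_sum u : enorm u <= \sum_i `|u i 0|.
Proof.
have -> : u = \sum_i (u i 0 *: delta_mx i 0).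
  apply/matrixP => i j; rewrite ord1 summxE (bigD1 i)//= big1 ?addr0.
    by rewrite !mxE !eqxx mulr1.
  by move=> k ki; rewrite !mxE eq_sym (negbTE ki) mulr0.
rewrite (le_trans (enorm_sum _ _))// ler_sum// => i _.
rewrite enormZ (_ : enorm _ = 1) ?mulr1; last first.
  rewrite /enorm dotvE (bigD1 i)//= big1 ?addr0 => [|k ki].
    by rewrite !mxE !eqxx mulr1 sqrtr1.
  by rewrite !mxE (negbTE ki) mulr0.
rewrite summxE (bigD1 i)//= big1 ?addr0; first by rewrite !mxE !eqxx mulr1.
by move=> k ki; rewrite !mxE eq_sym (negbTE ki) mulr0.
Qed.

Lemma enorm_le_coord u (c : R) : (forall i, `|u i 0| <= c) -> enorm u <= n%:R * c.
Proof.
move=> uc; rewrite (le_trans (enorm_le_sum _))//.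
by rewrite (le_trans (ler_sum _ (fun i _ => uc i)))// sumr_const card_ord mulr_natl.
Qed.

Lemma coord_le_norm u i : `|u i 0| <= `|u|.
Proof.
rewrite [leRHS]mx_normrE (bigmax_sup (i, 0))//.
Qed.

Lemma enorm_le_norm u : enorm u <= n%:R * `|u|.
Proof. by apply: enorm_le_coord => i; exact: coord_le_norm. Qed.

Lemma norm_le_enorm u : `|u| <= enorm u.
Proof.
rewrite [leLHS]mx_normrE; apply/bigmax_leP; split; first exact: enorm_ge0.
by move=> [i j] _ /=; rewrite ord1; exact: coord_le_enorm.
Qed.

Lemma enorm_dist u v : `|enorm u - enorm v| <= enorm (u - v).
Proof.
have H1 := enormD (u - v) v; have H2 := enormD (v - u) u.
rewrite subrK in H1; rewrite subrK (enormB v) in H2.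
by rewrite ler_norml; apply/andP; split; lra.
Qed.

Lemma enorm_lip_continuous (g : 'cV[R]_n -> R) :
  (forall u v, `|g u - g v| <= enorm (u - v)) -> continuous g.
Proof.
move=> lip x; apply: (@cvgrPdist_lt _ R^o _ (nbhs x) _ g (g x)).2 => e e0.
(* The factor compares the Euclidean norm with the sup norm that defines neighborhoods; the
   successor keeps the divisor positive in dimension 0. *)
have en : 0 < e / n.+1%:R by rewrite divr_gt0.
apply: filterS (nbhsx_ballx x _ en) => y; rewrite -ball_normE/= => xy.
rewrite (le_lt_trans (lip _ _))// (le_lt_trans (enorm_le_norm _))//.
rewrite (@le_lt_trans _ _ (n.+1%:R * `|x - y|))//.
  by rewrite ler_wpM2r// ler_nat.
by rewrite mulrC -ltr_pdivlMr ?ltr0n.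
Qed.

Lemma enorm_continuous : continuous (@enorm R n : 'cV[R]_n -> R).
Proof. exact/enorm_lip_continuous/enorm_dist. Qed.

End dot_product.

Section projection.
Context {R : realType} {n : nat}.
Implicit Types (C : set 'cV[R]_n) (x y z : 'cV[R]_n).

Definition cvx C := forall x y (t : R), C x -> C y -> 0 <= t <= 1 ->
  C (t *: x + (1 - t) *: y).

(** The obtuse-angle characterization of the projection. It adds up over blocks and directly
    produces normal vectors, which the minimality used in [eproj] does not. *)
Definition is_proj C x y := C y /\ forall z, C z -> dotv (x - y) (z - y) <= 0.

(** The angle condition gives |x - y|^2 + |z - y|^2 <= |x - z|^2 for z in C, so [y] is the only
    minimizer and the choice made by [get] can only be [y]. *)
Lemma is_proj_eproj C x y : is_proj C x y -> eproj C x = y.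
Proof.
move=> [Cy yP]; rewrite /eproj.
have Hy z : C z -> enorm (x - y) ^+ 2 + enorm (z - y) ^+ 2 <= enorm (x - z) ^+ 2.
  move=> Cz; have -> : x - z = (x - y) + (y - z) by rewrite addrA subrK.
  rewrite -(opprB z y) [leRHS]sqr_enormD enormN dotvNr.
  by have := yP _ Cz; lra.
apply: get_unique => [|y' [Cy' y'P]].
  split => // z Cz; rewrite -ler_sqr ?nnegrE ?enorm_ge0//.
  by rewrite (le_trans _ (Hy _ Cz))// lerDl sqr_ge0.
apply/esym/eqP; rewrite -subr_eq0; apply/eqP; apply: enorm_eq0; apply/eqP.
have := y'P _ Cy; rewrite -ler_sqr ?nnegrE ?enorm_ge0// => H.
have H' := Hy _ Cy'.
rewrite enormB -sqrf_eq0 eq_le sqr_ge0 andbT.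
by move: H H'; lra.
Qed.

Lemma proj_exists C x : cvx C -> C !=set0 -> compact C -> exists y, is_proj C x y.
Proof.
move=> cC C0 kC.
have cf : {within C, continuous (fun y => enorm (x - y))}.
  apply: continuous_subspaceT => y.
  apply: continuous_comp; last exact: enorm_continuous.
  by apply: continuousB; [exact: cst_continuous|exact: cvg_id].
have [y yC ymin] := compact_EVT_min C0 kC cf.
exists y; split=> [|z Cz]; first exact: set_mem.
rewrite leNgt; apply/negP => dpos.
set D := dotv _ _ in dpos.
pose q := enorm (z - y) ^+ 2.
have q0 : 0 <= q by exact: sqr_ge0.
(* Moving from [y] towards [z] by [t] changes the squared distance by t (t q - 2 D). This [t] lies
   in (0, 1] and satisfies t q <= D even when q = 0, which contradicts minimality. *)
pose t := D / (D + q).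
have t01 : 0 < t <= 1.
  by rewrite divr_gt0 ?ltr_wpDr//= ler_pdivrMr ?mul1r ?lerDl ?ltr_wpDr.
have /andP[t0 t1] := t01.
have Cw : C (t *: z + (1 - t) *: y) by apply: cC => //; [exact: set_mem|rewrite ltW].
have := ymin _ (mem_set Cw).
rewrite -ler_sqr ?nnegrE ?enorm_ge0//.
have -> : x - (t *: z + (1 - t) *: y) = (x - y) + (- t) *: (z - y).
  by apply/matrixP => i j; rewrite !mxE; ring.
rewrite [leRHS]sqr_enormD dotvZr -/D enormZ normrN ger0_norm ?(ltW t0)// exprMn -/q.
have : t * (D + q) = D by rewrite divfK// gt_eqF// ltr_wpDr.
move: t0 t1 dpos q0; clear => t0 t1 D0 q0 tD; apply/negP; rewrite -ltNge.
suff : t * (t * q - 2 * D) < 0 by lra.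
rewrite pmulr_rlt0//; nra.
Qed.

Lemma eproj_is_proj C x : cvx C -> C !=set0 -> compact C -> is_proj C x (eproj C x).
Proof.
by move=> cC C0 kC; have [y yP] := proj_exists x cC C0 kC; rewrite (is_proj_eproj yP).
Qed.

Lemma is_proj_in C x : C x -> is_proj C x x.
Proof. by move=> Cx; split=> // z _; rewrite subrr dotv0l. Qed.

(** Adding the two angle conditions, each tested at the other projection, gives |y - y'|^2 <= <x -
    x', y - y'>; Cauchy-Schwarz concludes. Both the shortness of projected steps and the
    measurability of the projection rest on this. *)
Lemma is_proj_lip C x x' y y' : is_proj C x y -> is_proj C x' y' ->
  enorm (y - y') <= enorm (x - x').
Proof.
move=> [Cy yP] [Cy' y'P]; have := yP _ Cy'; have := y'P _ Cy.
rewrite -(opprB y y') dotvNr => H1 H2.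
have H : dotv (y - y') (y - y') <= dotv (x - x') (y - y').
  by move: H1 H2; rewrite !dotv_lin; lra.
have [->|d0] := eqVneq (enorm (y - y')) 0; first exact: enorm_ge0.
have dp : 0 < enorm (y - y') by rewrite lt_neqAle eq_sym d0 enorm_ge0.
rewrite -(ler_pM2r dp) (le_trans _ (dotv_le _ _))//.
by rewrite (le_trans _ H)// -sqr_enorm expr2.
Qed.

Lemma cvx_sum C (m : nat) (a : 'I_m -> R) (x : 'I_m -> 'cV[R]_n) : cvx C ->
  (forall i, 0 <= a i) -> \sum_i a i = 1 -> (forall i, C (x i)) ->
  C (\sum_i a i *: x i).
Proof.
move=> cC; elim: m a x => [|m IH] a x a0 a1 Cx.
  by move: a1; rewrite big_ord0 => /esym/eqP; rewrite oner_eq0.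
rewrite big_ord_recl.
pose s := \sum_(i < m) a (lift ord0 i).
have s1 : 1 - a ord0 = s by move: a1; rewrite big_ord_recl => <-; rewrite addrAC subrr add0r.
have s0 : 0 <= s by rewrite sumr_ge0.
(* When the remaining weights sum to zero they cannot be renormalized, but each of them then
   vanishes. *)
have [sz|snz] := eqVneq s 0.
  rewrite big1 => [|i _].
    by rewrite addr0 (_ : a ord0 = 1) ?scale1r//; move: s1; rewrite sz; lra.
  by rewrite (psumr_eq0P (fun j _ => a0 (lift ord0 j)) sz (i := i) isT) scale0r.
have -> : \sum_(i < m) a (lift ord0 i) *: x (lift ord0 i) =
  s *: \sum_(i < m) (a (lift ord0 i) / s) *: x (lift ord0 i).
  by rewrite scaler_sumr; apply: eq_bigr => i _; rewrite scalerA mulrCA divff ?mulr1.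
have Cs : C (\sum_(i < m) (a (lift ord0 i) / s) *: x (lift ord0 i)).
  by apply: IH => // [i|]; rewrite ?divr_ge0// -mulr_suml divff.
have := cC _ _ (a ord0) (Cx ord0) Cs; rewrite s1; apply.
by rewrite a0 -subr_ge0 s1.
Qed.

End projection.

Section blocks.
Context {R : realType} {N d : nat}.
Implicit Types (x y : 'cV[R]_(N * d)) (G : set 'cV[R]_d).

Lemma blockE x i k : block x i k 0 = x (mxtens_index (i, k)) 0.
Proof. by rewrite mxE. Qed.

Lemma stackK v i : block (@stack R N d v) i = v i.
Proof. by apply/matrixP => k j; rewrite ord1 !mxE mxtens_indexK. Qed.

Lemma stackE v i k : @stack R N d v (mxtens_index (i, k)) 0 = v i k 0.
Proof. by rewrite -blockE stackK. Qed.

Lemma blockD x y i : block (x + y) i = block x i + block y i.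
Proof. by apply/matrixP => k j; rewrite !mxE. Qed.

Lemma blockN x i : block (- x) i = - block x i.
Proof. by apply/matrixP => k j; rewrite !mxE. Qed.

Lemma blockZ a x i : block (a *: x) i = a *: block x i.
Proof. by apply/matrixP => k j; rewrite !mxE. Qed.

Lemma sum_mxtens (F : 'I_(N * d) -> R) :
  \sum_l F l = \sum_i \sum_k F (mxtens_index (i, k)).
Proof.
rewrite pair_big/= (reindex (@mxtens_index N d))/=.
  by apply: eq_bigr => -[].
by exists (@mxtens_unindex N d) => l _; [exact: mxtens_indexK|exact: mxtens_unindexK].
Qed.

Lemma dotv_block x y : dotv x y = \sum_i dotv (block x i) (block y i).
Proof.
rewrite dotvE sum_mxtens; apply: eq_bigr => i _; rewrite dotvE.
by apply: eq_bigr => k _; rewrite !blockE.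
Qed.

Lemma sqr_enorm_block x : enorm x ^+ 2 = \sum_i enorm (block x i) ^+ 2.
Proof. by rewrite sqr_enorm dotv_block; apply: eq_bigr => i _; rewrite sqr_enorm. Qed.

Lemma enorm_block_le x i : enorm (block x i) <= enorm x.
Proof.
rewrite -ler_sqr ?nnegrE ?enorm_ge0// sqr_enorm_block (bigD1 i)//= lerDl.
by rewrite sumr_ge0// => j _; exact: sqr_ge0.
Qed.

Lemma block_tens (W : 'M[R]_N) x i :
  block ((W *t 1%:M) *m x) i = \sum_j W i j *: block x j.
Proof.
apply/matrixP => k j; rewrite ord1 blockE mxE summxE sum_mxtens.
apply: eq_bigr => i' _; rewrite (bigD1 k)//= big1 => [|k' kk'].
  by rewrite !mxE !mxtens_indexK/= eqxx mulr1 addr0.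
by rewrite tensmxE !mxE eq_sym (negbTE kk') mulr0 mul0r.
Qed.

(** The inner product and the set both split over blocks, so the stacked block projections satisfy
    the angle condition. *)
Lemma eproj_blockpow G x i : cvx G -> G !=set0 -> compact G ->
  block (eproj (blockpow G) x) i = eproj G (block x i).
Proof.
move=> cG G0 kG.
have P j : is_proj G (block x j) (eproj G (block x j)) by exact: eproj_is_proj.
suff H : is_proj (blockpow G) x (stack (fun j => eproj G (block x j))).
  by rewrite (is_proj_eproj H) stackK.
split=> [j|z Gz]; first by rewrite stackK; have [] := P j.
rewrite dotv_block -oppr_ge0 -sumrN sumr_ge0// => j _.
by rewrite oppr_ge0 !blockD !blockN !stackK; have [_] := P j; exact.
Qed.

Lemma avgE x k : avg x k 0 = N%:R^-1 * \sum_i block x i k 0.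
Proof. by rewrite /avg mxE summxE. Qed.

Lemma avgD x y : avg (x + y) = avg x + avg y.
Proof.
by rewrite /avg -scalerDr -big_split/=; congr (_ *: _); apply: eq_bigr => i _; rewrite blockD.
Qed.

Lemma avgN x : avg (- x) = - avg x.
Proof.
by rewrite /avg -scalerN -sumrN; congr (_ *: _); apply: eq_bigr => i _; rewrite blockN.
Qed.

Lemma avgZ a x : avg (a *: x) = a *: avg x.
Proof.
rewrite /avg scalerA (mulrC a) -scalerA [X in _ = _ *: X]scaler_sumr.
by congr (_ *: _); apply: eq_bigr => i _; rewrite blockZ.
Qed.

End blocks.

Lemma sublevel_cvx {R : realType} (n p : nat) (q : 'I_p -> 'cV[R]_n -> R) :
  (forall j, convex_function setT (q j)) -> cvx [set x | forall j, q j x <= 0].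
Proof.
move=> cq x y t qx qy /andP[t0 t1] j /=.
have := cq j (Itv01 t0 t1) x y (mem_setT x) (mem_setT y).
rewrite convRE /= => /le_trans; apply.
have := qx j; have := qy j => h1 h2.
have : 0 <= t * (- q j x) by rewrite mulr_ge0// oppr_ge0.
have : 0 <= (1 - t) * (- q j y) by rewrite mulr_ge0// ?oppr_ge0// subr_ge0.
by rewrite /unstable.onem; lra.
Qed.

Section centering.
Context {R : realType} {N : nat}.
Hypothesis N_gt0 : (0 < N)%N.
Implicit Types (a b : 'cV[R]_N) (W : 'M[R]_N).

(** The orthogonal projector onto the complement of [ones], written exactly as the middle factor in
    [rho] so that the two agree by unfolding. *)
Definition centering : 'M[R]_N := 1%:M - N%:R^-1 *: (ones *m ones^T).

Lemma centeringE a i : (centering *m a) i 0 = a i 0 - N%:R^-1 * \sum_j a j 0.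
Proof.
rewrite /centering mulmxBl mul1mx -scalemxAl !mxE; congr (_ - _ * _).
by apply: eq_bigr => j _; rewrite !mxE big_ord1 !mxE mulr1 mul1r.
Qed.

Lemma tr_centering : centering^T = centering.
Proof. by rewrite /centering linearB linearZ/= trmx1 trmx_mul trmxK. Qed.

Lemma centering_ones : centering *m ones = 0.
Proof.
apply/matrixP => i j; rewrite ord1 centeringE !mxE.
under eq_bigr do rewrite mxE.
by rewrite sumr_const card_ord -mulr_natl mulr1 mulVf ?subrr// pnatr_eq0 -lt0n.
Qed.

Lemma centeringK : centering *m centering = centering.
Proof.
rewrite {2}/centering mulmxBr mulmx1 -scalemxAr mulmxA centering_ones mul0mx.
by rewrite scaler0 subr0.
Qed.

Lemma centering_decomp a : a = centering *m a + (N%:R^-1 * \sum_j a j 0) *: ones.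
Proof.
by apply/matrixP => i j; rewrite !ord1 mxE centeringE !mxE mulr1 subrK.
Qed.

Lemma sqr_enorm_centering a :
  enorm (centering *m a) ^+ 2 = dotv a (centering *m a).
Proof.
by rewrite sqr_enorm /dotv trmx_mul tr_centering -!mulmxA (mulmxA centering centering) centeringK.
Qed.

Lemma enorm_centering_le a : enorm (centering *m a) <= enorm a.
Proof.
have [->|n0] := eqVneq (enorm (centering *m a)) 0; first exact: enorm_ge0.
have np : 0 < enorm (centering *m a) by rewrite lt_neqAle eq_sym n0 enorm_ge0.
by rewrite -(ler_pM2r np) -expr2 sqr_enorm_centering dotv_le.
Qed.

(** [W] fixes [ones] and the centering kills it, so only the centered part of [a] survives mixing.
    With that part on both sides of the quadratic form, the matrix inside [rho] can act as a
    contraction. *)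
Lemma sqr_enorm_centering_mul W a : W *m ones = ones ->
  enorm (centering *m (W *m a)) ^+ 2 =
  dotv (centering *m a) ((W^T *m centering *m W) *m (centering *m a)).
Proof.
move=> W1.
have -> : centering *m (W *m a) = centering *m (W *m (centering *m a)).
  rewrite {1}(centering_decomp a) !mulmxDr -!scalemxAr W1.
  by rewrite centering_ones scaler0 addr0.
rewrite sqr_enorm_centering /dotv trmx_mul; congr (fun_of_matrix _ _ _).
by rewrite -!mulmxA.
Qed.

End centering.

(** * Rates of convergence *)

Section sequences_of_reals.
Context {R : realType}.

(** Stands in for the integral comparison of the series of n^(-1-s): with y = x + 1, the bound (x /
    y)^(-s) >= 1 + s / y follows from exp t >= 1 + t and ln (1 - 1/y) <= - 1/y. The right-hand side
    telescopes. *)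
Lemma powRN_step (s : R) (m : nat) : 0 < s ->
  s * (m.+2%:R `^ (- (1 + s))) <= m.+1%:R `^ (- s) - m.+2%:R `^ (- s).
Proof.
move=> s0; set x : R := m.+1%:R; set y : R := m.+2%:R.
have x0 : 0 < x by rewrite ltr0n.
have y0 : 0 < y by rewrite ltr0n.
have yx : y = x + 1 by rewrite /x /y -natr1.
clearbody x y.
have -> : x `^ (- s) = y `^ (- s) * (x / y) `^ (- s).
  by rewrite -powRM ?divr_ge0 1?ltW// mulrC divfK ?gt_eqF.
have : 1 + s / y <= (x / y) `^ (- s).
  rewrite /powR gt_eqF ?divr_gt0// (le_trans (expR_ge1Dx _))// ler_expR.
  have : ln (x / y) <= - y^-1.
    rewrite (_ : x / y = 1 + (- y^-1)); last by rewrite yx; field; lra.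
    by rewrite le_ln1Dx// ltrN2 invf_lt1// yx ltrDr.
  by move=> /(ler_wpM2l (ltW s0)); rewrite mulrN mulNr lerNr.
have -> : y `^ (- (1 + s)) = y `^ (- s) / y.
  by rewrite opprD addrC powRD ?powR_inv1 ?(gt_eqF y0) ?implybT// ltW.
have : 0 < y `^ (- s) by exact: powR_gt0.
set p := y `^ (- s); set z := (_ `^ _) => p0 H.
have : p * (1 + s / y) <= p * z by rewrite ler_wpM2l// ltW.
rewrite mulrA (mulrC s p) -mulrA; lra.
Qed.

Lemma powRN_summable (k : R) : 1 < k ->
  exists M, forall n, \sum_(i < n) i.+1%:R `^ (- k) <= M :> R.
Proof.
move=> k1; have s0 : 0 < k - 1 by lra.
exists (1 + (k - 1)^-1) => -[|n]; first by rewrite big_ord0 addr_ge0// invr_ge0 ltW.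
rewrite big_ord_recl powR1 lerD2l.
suff : \sum_(i < n) (bump 0 i).+1%:R `^ (- k) <= (k - 1)^-1 * (1 - n.+1%:R `^ (- (k - 1))).
  move=> /le_trans; apply; rewrite ler_piMr ?invr_ge0 ?(ltW s0)// lerBlDr lerDl powR_ge0.
elim: n => [|n IH]; first by rewrite big_ord0 powR1 subrr mulr0.
rewrite big_ord_recr/= (le_trans (lerD IH (lexx _)))//.
have := powRN_step n s0; rewrite /bump/= add1n addrCA subrr addr0 => H.
rewrite -(ler_pM2l s0) mulrDr !mulrA divff ?gt_eqF// !mul1r; lra.
Qed.

(** The rate n^(-k) loses at most the fraction k / n per step; a contraction stronger than this can
    sustain it. *)
Lemma powRN_ratio (k : R) (m : nat) : 0 <= k ->
  m.+1%:R `^ (- k) * (1 - k / m.+1%:R) <= m.+2%:R `^ (- k).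
Proof.
move=> k0; set x : R := m.+1%:R; set y : R := m.+2%:R.
have x0 : 0 < x by rewrite ltr0n.
have y0 : 0 < y by rewrite ltr0n.
have yx : y = x + 1 by rewrite /x /y -natr1.
clearbody x y.
have -> : y `^ (- k) = x `^ (- k) * (y / x) `^ (- k).
  by rewrite -powRM ?divr_ge0 1?ltW// mulrC divfK ?gt_eqF.
rewrite ler_wpM2l ?powR_ge0// /powR gt_eqF ?divr_gt0//.
rewrite (le_trans (expR_ge1Dx _))// ler_expR.
have : ln (y / x) <= x^-1.
  rewrite (_ : y / x = 1 + x^-1); last by rewrite yx; field; lra.
  by rewrite le_ln1Dx// (lt_trans (ltrN10 _))// invr_gt0.
by move=> /(ler_wpM2l k0) H; lra.
Qed.

Lemma limn_einf_gt0 (u : nat -> R) : (0 < limn_einf (fun n => (u n)%:E))%E ->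
  exists2 c, 0 < c & \forall n \near \oo, c <= u n.
Proof.
rewrite limn_einf_lim => h.
have : (0 < ereal_sup (range (einfs (fun n => (u n)%:E))))%E.
  have H : einfs (fun n => (u n)%:E) @ \oo --> ereal_sup (range (einfs (fun n => (u n)%:E))) by exact: cvg_einfs_sup.
  by rewrite -(cvg_lim _ H).
move=> /ereal_sup_gt[_ [m _ <-]] hm.
have [c c0 cm] : exists2 c : R, 0 < c & (c%:E <= einfs (fun n => (u n)%:E) m)%E.
  move: hm; case: (einfs _ m) => [r| |]//; rewrite ?lte_fin => r0.
    by exists r.
  by exists 1; rewrite ?leey.
exists c => //; exists m => // n /= mn.
rewrite -lee_fin (le_trans cm)//; apply: ereal_inf_lbound.
by exists n.
Qed.

Lemma summable_tail (U r : nat -> R) (n0 : nat) (L : R) : 0 <= L ->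
  (forall n, 0 <= U n) -> (forall n, 0 <= r n) ->
  (forall n, (n0 <= n)%N -> U n.+1 <= L * r n.+1) ->
  (exists M, forall n, \sum_(i < n) r i.+1 <= M) ->
  exists M, forall n, \sum_(i < n) U i <= M.
Proof.
move=> L0 U0 r0 Ur [M rM].
exists (\sum_(i < n0.+1) U i + L * M) => n.
have H k : \sum_(i < n0.+1 + k) U i <= \sum_(i < n0.+1) U i + L * M.
  rewrite big_split_ord/= lerD2l.
  rewrite (@le_trans _ _ (L * \sum_(i < k) r (n0 + i).+1))//.
    rewrite mulr_sumr ler_sum// => i _.
    by rewrite addSn; apply: Ur; rewrite leq_addr.
  rewrite ler_wpM2l// (le_trans _ (rM (n0 + k)%N))// big_split_ord/=.
  by rewrite lerDr sumr_ge0.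
rewrite (le_trans _ (H n))// addnC big_split_ord/= lerDl sumr_ge0//.
Qed.

(* [U n = O(n `^ (- (2 * al)))] by induction. *)
Lemma contraction_summable (U b g : nat -> R) (al C : R) :
  2^-1 < al -> 0 <= C -> (forall n, 0 <= U n) ->
  (forall n, (1 <= n)%N -> 0 < g n) -> (forall n, (1 <= n)%N -> b n <= 1) ->
  n%:R * b n @[n --> \oo] --> +oo ->
  n%:R `^ al * g n @[n --> \oo] --> (0 : R) ->
  (0 < limn_einf (fun n => (b n / (n%:R `^ al * g n))%:E))%E ->
  (forall n e, (1 <= n)%N -> 0 < e ->
    U n.+1 <= (1 - b n.+1) * ((1 + e) * U n + (1 + e^-1) * (g n.+1 ^+ 2 * C))) ->
  exists M, forall n, \sum_(i < n) U i <= M.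
Proof.
move=> al2 C0 U0 g0 b1 nb ng /limn_einf_gt0[c c0 cb] rec.
pose k := 2 * al; have k1 : 1 < k by rewrite /k; lra.
pose r n : R := n%:R `^ (- k).
have r0 n : 0 <= r n by exact: powR_ge0.
(* The factor 8 yields [kb] below: n + 1 <= 2 n halves it, and the remaining 4 makes the loss k / n
   at most a quarter of [b n.+1]. *)
have nb8 : \forall n \near \oo, 8 * k <= n%:R * b n by move/cvgryPge : nb; exact.
have [n0 _ Hn] : \forall n \near \oo, 8 * k <= n%:R * b n /\ c <= b n / (n%:R `^ al * g n).
  by near=> n; split; near: n.
pose m := n0.+1.
pose K := 2 * C / c ^+ 2.
have K0 : 0 <= K by apply: divr_ge0; [apply: mulr_ge0|exact: sqr_ge0].
(* The first entry starts the induction at [m]. The second leaves room for the noise, whose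
   contribution K b n^(-k) must fit in a quarter of b L n^(-k). *)
pose L := Num.max (U m / r m) (4 * K).
have rm0 n : 0 < r n.+1 by rewrite powR_gt0// ltr0n.
have L0 : 0 <= L by rewrite /L le_max; apply/orP; right; apply: mulr_ge0.
have main n : (m <= n)%N -> U n <= L * r n.
  elim: n => [//|n IH]; rewrite leq_eqVlt => /predU1P[<-|].
    by rewrite -ler_pdivrMr ?rm0// /L le_max lexx.
  rewrite ltnS => mn; have {}IH := IH mn.
  have n1 : (1 <= n)%N by rewrite (leq_trans _ mn).
  have [|nb' cb'] := Hn n.+1; first by rewrite /= (leq_trans (leq_trans (leqnSn _) mn)).
  have nR : 0 < n%:R :> R by rewrite ltr0n.
  have nS : n.+1%:R <= 2 * n%:R :> R by rewrite -natrM ler_nat mul2n -addnn -addn1 leq_add2l.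
  have b0 : 0 < b n.+1.
    by rewrite -(@pmulr_rgt0 _ n.+1%:R) ?ltr0n// (lt_le_trans _ nb')// mulr_gt0//; lra.
  have kb : k / n%:R <= b n.+1 / 4.
    rewrite ler_pdivrMr//; move: nb' (ler_wpM2r (ltW b0) nS).
    set x := _ * b n.+1; lra.
  have rr : r n * (1 - k / n%:R) <= r n.+1.
    by rewrite /r; case: (n) n1 => // j _; apply: powRN_ratio; lra.
  (* The positive lower limit bounds g^2 by b^2 n^(-k) / c^2, so the noise is still of order b
     n^(-k) after division by b. *)
  have gr : g n.+1 ^+ 2 <= b n.+1 ^+ 2 * r n.+1 / c ^+ 2.
    have na : 0 < n.+1%:R `^ al :> R by rewrite powR_gt0// ltr0n.
    have ga : 0 < g n.+1 by exact: g0.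
    move: cb'; rewrite ler_pdivlMr ?mulr_gt0// => cb'.
    rewrite ler_pdivlMr ?exprn_gt0//.
    have -> : r n.+1 = (n.+1%:R `^ al)^-1 ^+ 2.
      rewrite /r /k powRN exprVn -powR_mulrn ?powR_ge0//.
      by rewrite -powRrM mulrC.
    rewrite exprVn ler_pdivlMr ?exprn_gt0// -!exprMn.
    apply: lerXn2r; rewrite ?nnegrE ?(ltW b0)//.
      by rewrite !mulr_ge0// ltW.
    by apply: le_trans cb'; rewrite le_eqVlt; apply/orP; left; apply/eqP; ring.
  (* With e = b / 2, half of the contraction remains, at the price of a noise coefficient 2 / b. The
     two quarters of this half pay for the decay of the rate ([h4]) and for the noise ([h5]). *)
  have := rec n (b n.+1 / 2) n1; rewrite divr_gt0// => /(_ isT) H.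
  apply: (le_trans H).
  have b1' := b1 n.+1 isT.
  set B := b n.+1 in b0 kb gr b1' *; set g2 := g n.+1 ^+ 2 in gr *.
  have g20 : 0 <= g2 by exact: sqr_ge0.
  have h1 : (1 - B) * (1 + B / 2) <= 1 - B / 2 by nra.
  have h2 : (1 - B) * (1 + (B / 2)^-1) <= 2 / B.
    by rewrite ler_pdivlMr// (_ : _ * B = (1 - B) * (B + 2)); [nra|field; lra].
  have h3 : (2 / B) * (g2 * C) <= K * B * r n.+1.
    rewrite (@le_trans _ _ ((2 / B) * (B ^+ 2 * r n.+1 / c ^+ 2 * C)))//.
      by rewrite ler_wpM2l ?divr_ge0 ?(ltW b0)// ler_wpM2r.
    rewrite le_eqVlt; apply/orP; left; apply/eqP; rewrite /K; field.
    by rewrite !gt_eqF.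
  have h4 : (1 - B / 2) * U n <= (1 - B / 4) * (L * r n.+1).
    have : (1 - B / 2) * U n <= (1 - B / 2) * (L * r n) by rewrite ler_wpM2l//; lra.
    move=> /le_trans; apply.
    rewrite (@le_trans _ _ ((1 - B / 4) * (L * (r n * (1 - k / n%:R)))))//; last first.
      by rewrite ler_wpM2l ?ler_wpM2l//; lra.
    have := r0 n; set rn := r n; set z := k / _ in kb *; clearbody rn z B L => rn0.
    have : (1 - B / 2) <= (1 - B / 4) * (1 - z) by nra.
    move=> /(ler_wpM2r (mulr_ge0 L0 rn0)) h.
    by rewrite (le_trans h)// le_eqVlt; apply/orP; left; apply/eqP; ring.
  have h5 : K * B * r n.+1 <= (B / 4) * (L * r n.+1).
    have : 4 * K <= L by rewrite /L le_max lexx orbT.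
    have := r0 n.+1; move: K0 b0; clear; clearbody K L B; move: (r n.+1) => rn K0 B0 rn0 KL.
    have := ler_wpM2r (mulr_ge0 (ltW B0) rn0) KL; lra.
  rewrite mulrDr !(mulrA (1 - B)).
  have h6 := ler_wpM2r (U0 n) h1.
  have h7 := ler_wpM2r (mulr_ge0 g20 C0) h2.
  apply: (le_trans (lerD h6 h7)); apply: (le_trans (lerD h4 (le_trans h3 h5))).
  by rewrite -mulrDl -addrA (_ : _ + _ = 1) ?mul1r//; ring.
have [M rM] := powRN_summable k1.
apply: (@summable_tail U r m L) => //; last by exists M.
by move=> n mn; apply: main; rewrite (leq_trans mn).
Unshelve. all: by end_near. Qed.

Lemma step_sq_summable (g : nat -> R) (al : R) : 2^-1 < al ->
  n%:R `^ al * g n @[n --> \oo] --> (0 : R) ->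
  exists M, forall n, \sum_(i < n) g i ^+ 2 <= M.
Proof.
move=> al2 ng.
have [n0 _ Hn] : \forall n \near \oo, `|n%:R `^ al * g n| <= 1.
  by move/cvgrPdist_le : ng => /(_ 1 ltr01); apply: filterS => n; rewrite sub0r normrN.
pose r n : R := n%:R `^ (- (2 * al)).
have [M rM] : exists M, forall n, \sum_(i < n) r i.+1 <= M by apply: powRN_summable; lra.
apply: (@summable_tail (fun n => g n ^+ 2) r n0 1) => // [n|n|n n0n|].
- exact: sqr_ge0.
- exact: powR_ge0.
2: by exists M.
have := Hn n.+1 (leq_trans n0n (leqnSn _)).
have na : 0 < n.+1%:R `^ al :> R by rewrite powR_gt0// ltr0n.
have -> : r n.+1 = (n.+1%:R `^ al)^-1 ^+ 2.
  by rewrite /r powRN exprVn -powR_mulrn ?powR_ge0// -powRrM mulrC.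
rewrite normrM gtr0_norm// mulrC -ler_pdivlMr// mul1r => H.
rewrite div1r in H; rewrite -(real_normK (num_real (g _))).
by apply: lerXn2r => //; rewrite nnegrE invr_ge0 ltW.
Qed.

End sequences_of_reals.

(** * Expectations and conditioning *)

Section matrix_measurability.
Context {R : realType}.

Lemma continuous_mx_measurable (m n : nat) (g : 'M[R]_(m, n) -> R) :
  continuous g -> measurable_fun setT g.
Proof.
move=> /continuousP cg; apply: (measurability _ (measurable_realfun.RGenOpens.measurableE R)).
move=> _ [_ [a [b ->] <-]]; rewrite setTI; apply: sub_sigma_algebra.
exact/cg/interval_open.
Qed.

Lemma measurable_coord (m n : nat) (i : 'I_m) (j : 'I_n) :
  measurable_fun setT (fun A : 'M[R]_(m, n) => A i j).
Proof. by apply: continuous_mx_measurable => A; exact: coord_continuous. Qed.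

Lemma measurable_fun_coord d (T : measurableType d) (m n : nat)
    (f : T -> 'M[R]_(m, n)) i j :
  measurable_fun setT f -> measurable_fun setT (fun t => f t i j).
Proof. by move=> mf; exact: (measurableT_comp (measurable_coord i j) mf). Qed.

(** Open sets are countable unions of boxes with rational center and radius, since the topology of
    matrices is that of the sup norm; this reduces measurability to the entries. *)
Lemma measurable_mx d (T : measurableType d) (m n : nat)
    (f : T -> 'M[R]_(m, n)) :
  (forall i j, measurable_fun setT (fun t => f t i j)) -> measurable_fun setT f.
Proof.
move=> mf; apply: (@measurability _ _ _ _ _ _ (@open 'M[R]_(m, n))) => //.
move=> _ [U oU <-]; rewrite setTI.
pose B (c : 'M[rat]_(m, n) * rat) : set 'M[R]_(m, n) :=
  [set A | forall i j, `|ratr (c.1 i j) - A i j| < ratr c.2].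
have -> : f @^-1` U = \bigcup_(c in [set c | B c `<=` U]) f @^-1` B c.
  apply/seteqP; split => [t Ut|t [c /= cU]]; last exact: cU.
  have /nbhs_ballP[e /= e0 eU] : nbhs (f t) U by exact: open_nbhs_nbhs.
  (* With a radius below e / 2 and a center within that radius of [f t], the box contains [f t] and
     stays in the ball of radius e. *)
  have [r re] := rat_in_itvoo (divr_gt0 e0 (ltr0n R 2)).
  have rp : 0 < ratr r :> R by move: re; rewrite in_itv => /andP[].
  have r2 : ratr r < e / 2 by move: re; rewrite in_itv => /andP[].
  have /choice[c cP] : forall ij : 'I_m * 'I_n, exists q : rat,
      `|ratr q - f t ij.1 ij.2| < ratr r.
    move=> [i j] /=; have [q] := @rat_in_itvoo R (f t i j) (f t i j + ratr r) ltac:(by rewrite ltrDl).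
    rewrite in_itv /= => /andP[q1 q2]; exists q.
    by rewrite gtr0_norm ?subr_gt0// ltrBlDl.
  exists (\matrix_(i, j) c (i, j), r) => /=; last first.
    by move=> i j /=; rewrite mxE; exact: (cP (i, j)).
  move=> A /= HA; apply: eU; split=> // i j.
  have := HA i j; rewrite mxE => h1; have := cP (i, j) => /= h2.
  rewrite /ball/= (le_lt_trans (ler_distD (ratr (c (i, j))) _ _))//.
  by rewrite distrC in h2; move: (ltrD h2 h1) r2; set x := _ + _; lra.
rewrite bigcup_mkcond; apply: countable_bigcupT_measurable => [|c]; first exact: countableP.
case: ifPn => // _.
have -> : f @^-1` B c = \bigcap_(i in [set: 'I_m]) \bigcap_(j in [set: 'I_n])
    ((fun t => `|ratr (c.1 i j) - f t i j|) @^-1` `]-oo, (ratr c.2)[).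
  apply/seteqP; split => [t Bt i _ j _|t H i j]; first by rewrite /= in_itv/=; exact: Bt.
  by have := H i I j I; rewrite /= in_itv.
apply: fin_bigcap_measurable => // i _; apply: fin_bigcap_measurable => // j _.
rewrite -[X in measurable X]setTI.
have mr : measurable_fun setT (fun t => `|ratr (c.1 i j) - f t i j|).
  by apply: measurableT_comp => //; apply: measurable_funB => //; exact: mf.
by apply: mr.
Qed.

End matrix_measurability.

Section mean.
Context {disp : measure_display} {Omega : measurableType disp} {R : realType}.
Variable P : probability Omega R.
Implicit Types (X Y : Omega -> R) (c : R).

Definition mean X : R := \int[P]_w X w.

Local Notation intg X := (P.-integrable setT (EFin \o X)).

Lemma intg_bdd c X : measurable_fun setT X -> (forall w, `|X w| <= c) -> intg X.
Proof.
move=> mX Xc; apply: measurable_bounded_integrable => //.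
  by rewrite [X in (X < _)%E]probability_setT ltry.
by exists c; split; [exact: num_real|move=> y cy w _; exact: le_trans (Xc w) (ltW cy)].
Qed.

Lemma intg_measurable X : intg X -> measurable_fun setT X.
Proof. by move=> /measurable_int/measurable_EFinP. Qed.

Lemma intg_cst c : intg (fun=> c).
Proof. by apply: (@intg_bdd `|c|). Qed.

Lemma intgD X Y : intg X -> intg Y -> intg (fun w => X w + Y w).
Proof. by move=> iX iY; exact: (integrableD measurableT iX iY). Qed.


Lemma intgZ c X : intg X -> intg (fun w => c * X w).
Proof. by move=> iX; exact: (integrableZl measurableT c iX). Qed.

Lemma intgN X : intg X -> intg (fun w => - X w).
Proof. by move=> /(intgZ (-1)); under eq_fun do rewrite mulN1r. Qed.

Lemma intgB X Y : intg X -> intg Y -> intg (fun w => X w - Y w).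
Proof. by move=> iX iY; exact: intgD iX (intgN iY). Qed.

Lemma intg_mulb c X Y : measurable_fun setT Y -> (forall w, `|Y w| <= c) ->
  intg X -> intg (fun w => Y w * X w).
Proof.
move=> mY Yc iX; apply: (integrableMr measurableT mY _ iX).
by exists c; split; [exact: num_real|move=> y cy w _; exact: le_trans (Yc w) (ltW cy)].
Qed.

Lemma intg_indic A X : measurable A -> intg X -> intg (fun w => \1_A w * X w).
Proof.
move=> mA; apply: (@intg_mulb 1) => // w.
by rewrite indicE; case: (_ \in _); rewrite ?normr1 ?normr0.
Qed.

Lemma intg_sum (I : Type) (r : seq I) (F : I -> Omega -> R) :
  (forall i, intg (F i)) -> intg (fun w => \sum_(i <- r) F i w).
Proof.
move=> iF; elim: r => [|i r IH].
  by under eq_fun do rewrite big_nil; exact: intg_cst.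
by under eq_fun do rewrite big_cons; exact: intgD.
Qed.

Lemma le_intg X Y : measurable_fun setT X -> intg Y ->
  (forall w, `|X w| <= Y w) -> intg X.
Proof.
move=> mX iY XY; apply: (le_integrable measurableT _ _ iY).
  exact/measurable_EFinP.
by move=> w _; rewrite /= lee_fin (le_trans (XY w))// ler_norm.
Qed.

Lemma meanD X Y : intg X -> intg Y -> mean (fun w => X w + Y w) = mean X + mean Y.
Proof. by move=> iX iY; rewrite /mean RintegralD. Qed.

Lemma meanB X Y : intg X -> intg Y -> mean (fun w => X w - Y w) = mean X - mean Y.
Proof. by move=> iX iY; rewrite /mean RintegralB. Qed.

Lemma meanZ c X : intg X -> mean (fun w => c * X w) = c * mean X.
Proof. by move=> iX; rewrite /mean RintegralZl. Qed.

Lemma mean_cst c : mean (fun=> c) = c.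
Proof. by rewrite /mean Rintegral_cst// [X in fine X]probability_setT mulr1. Qed.

Lemma mean_sum (I : Type) (r : seq I) (F : I -> Omega -> R) :
  (forall i, intg (F i)) ->
  mean (fun w => \sum_(i <- r) F i w) = \sum_(i <- r) mean (F i).
Proof.
move=> iF; elim: r => [|i r IH].
  by under eq_fun do rewrite big_nil; rewrite mean_cst big_nil.
under eq_fun do rewrite big_cons.
by rewrite meanD ?IH ?big_cons//; exact: intg_sum.
Qed.

Lemma mean_le X Y : intg X -> intg Y -> (forall w, X w <= Y w) -> mean X <= mean Y.
Proof. by move=> iX iY XY; apply: le_Rintegral. Qed.

Lemma mean_ge0 X : (forall w, 0 <= X w) -> 0 <= mean X.
Proof. by move=> X0; apply: Rintegral_ge0. Qed.

Lemma mean_EFin X : intg X -> (\int[P]_w (X w)%:E)%E = (mean X)%:E.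
Proof. by move=> iX; rewrite /mean /Rintegral fineK//; exact: integrable_fin_num. Qed.

Lemma mean_ae X Y : measurable_fun setT X -> measurable_fun setT Y ->
  {ae P, forall w, X w = Y w} -> mean X = mean Y.
Proof.
move=> mX mY XY; rewrite /mean /Rintegral; congr fine.
apply: ae_eq_integral => //; [exact/measurable_EFinP..|].
by apply: filterS XY => w -> _.
Qed.

Lemma setint_mean A X : measurable A -> intg X ->
  (\int[P]_(w in A) (X w)%:E)%E = (mean (fun w => \1_A w * X w))%:E.
Proof.
move=> mA iX; rewrite -mean_EFin; last exact: intg_indic.
rewrite integral_mkcond; apply: eq_integral => w _.
by rewrite /patch indicE; case: (w \in A); rewrite ?mul1r ?mul0r.
Qed.

Lemma mean_indic A : measurable A -> mean (\1_A) = fine (P A).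
Proof. by move=> mA; rewrite /mean /Rintegral integral_indic// setIT. Qed.

Lemma mean_cvg (F : nat -> Omega -> R) X Y :
  (forall n, measurable_fun setT (F n)) -> measurable_fun setT X ->
  (forall w, F n w @[n --> \oo] --> X w) -> intg Y ->
  (forall n w, `|F n w| <= Y w) -> mean (F n) @[n --> \oo] --> mean X.
Proof.
move=> mF mX FX iY FY.
have iF n : intg (F n) by exact: le_intg (FY n).
have iX : intg X.
  apply: le_intg iY _ => // w.
  have : `|F n w| @[n --> \oo] --> `|X w| by exact: cvg_norm.
  move=> H; rewrite -(cvg_lim (@Rhausdorff R) H).
  apply: limr_le; first by apply/cvg_ex; exists `|X w|.
  by apply: nearW => n; exact: FY.
have := @dominated_convergence _ _ R P setT measurableT (fun n => EFin \o F n)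
  (EFin \o X) (EFin \o Y).
case => //.
- by move=> n; exact/measurable_EFinP.
- exact/measurable_EFinP.
- by apply: aeW => w _ /=; apply: cvg_EFin; [exact: nearW|exact: FX].
- by apply: aeW => w n _ /=; rewrite lee_fin.
move=> _ _; have -> : (\int[P]_w (EFin \o X) w)%E = (mean X)%:E by exact: mean_EFin.
by move=> H; apply: cvg_trans (fine_cvg H).
Qed.

Lemma mean_le0_ae X : measurable_fun setT X -> (forall w, 0 <= X w) -> intg X ->
  mean X <= 0 -> {ae P, forall w, X w = 0}.
Proof.
move=> mX X0 iX mX0.
have : (\int[P]_w (X w)%:E)%E = 0%E.
  by rewrite mean_EFin//; congr EFin; apply/eqP; rewrite eq_le mX0 mean_ge0.
move=> H; have H' : ae_eq P setT (EFin \o X) (cst 0%E).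
  apply/(ae_eq_integral_abs _ measurableT) => //; first exact/measurable_EFinP.
  by rewrite -[RHS]H; apply: eq_integral => w _; rewrite gee0_abs// lee_fin.
by apply: filterS H' => w /(_ I)[].
Qed.

End mean.

(** Packs a bare set function as a [probability]; with [charge_of] it re-types restrictions to a
    sub-sigma-algebra so that Radon-Nikodym applies there. *)
Lemma probability_of d (T : measurableType d) (R : realType) (m : set T -> \bar R) :
  m set0 = 0%E -> (forall A, 0 <= m A)%E -> semi_sigma_additive m -> m setT = 1%E ->
  exists Q : probability T R, forall A, Q A = m A.
Proof.
move=> m0 mge msa mT.
pose H1 := isMeasure.Build _ T R m m0 mge msa.
pose M : {measure set T -> \bar R} := HB.pack m H1.
pose H2 := Measure_isProbability.Build _ T R (Measure.sort M) mT.
pose Q : probability T R := HB.pack (Measure.sort M) H2.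
by exists Q.
Qed.

Lemma charge_of d (T : measurableType d) (R : realType) (m : set T -> \bar R) :
  m set0 = 0%E -> (forall A, measurable A -> m A \is a fin_num) ->
  semi_sigma_additive m -> exists nu : {charge set T -> \bar R}, forall A, nu A = m A.
Proof.
move=> m0 mfin msa.
pose H1 := isCharge.Build _ T R m m0 mfin msa.
pose M : {charge set T -> \bar R} := HB.pack m H1.
by exists M.
Qed.

(** * Conditioning on a sub-sigma-algebra, tested by bounded functions *)

Section sub_sigma_algebra.
Import HBNNSimple.
Context {disp : measure_display} {Omega : measurableType disp} {R : realType}.
Variable P : probability Omega R.
Implicit Types (X Y phi xi : Omega -> R) (c : R) (G : set (set Omega)).

Local Notation intg X := (P.-integrable setT (EFin \o X)).

(** The sub-sigma-algebra is given by a generating class and becomes the sigma-algebra of the domain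
    type, so the usual measurability lemmas apply verbatim. *)
Definition gmeas d (T : measurableType d) G (X : Omega -> T) :=
  measurable_fun setT (X : g_sigma_algebraType G -> T).

Lemma gmeas_sub G1 G2 d (T : measurableType d) (X : Omega -> T) :
  <<s G1 >> `<=` <<s G2 >> -> gmeas G1 X -> gmeas G2 X.
Proof. by move=> G12 mX _ B mB; apply: G12; exact: mX. Qed.

Lemma gmeas_measurable G d (T : measurableType d) (X : Omega -> T) :
  <<s G >> `<=` measurable -> gmeas G X -> measurable_fun setT X.
Proof. by move=> sG mX _ B mB; apply: sG; exact: mX. Qed.

Lemma gmeas_preimage G d (T : measurableType d) (X : Omega -> T) A :
  gmeas G X -> measurable A -> <<s G >> (X @^-1` A).
Proof. by move=> mX mA; rewrite -[_ @^-1` _]setTI; exact: mX. Qed.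

(** Passage from indicators to bounded non-negative tests: simple functions increase to [phi], their
    level sets belong to the sub-sigma-algebra, and c |xi| dominates the products. *)
Lemma mean_test_le0 G xi phi c : <<s G >> `<=` measurable -> intg xi ->
  (forall A, <<s G >> A -> mean P (fun w => \1_A w * xi w) <= 0) ->
  gmeas G phi -> (forall w, 0 <= phi w <= c) ->
  mean P (fun w => phi w * xi w) <= 0.
Proof.
move=> sG ixi Hxi mphi phi0.
pose f : g_sigma_algebraType G -> \bar R := EFin \o phi.
have mf : measurable_fun setT f by exact/measurable_EFinP.
have f0 : forall w, setT w -> (0 <= f w)%E by move=> w _; rewrite lee_fin; case/andP: (phi0 w).
pose F n : Omega -> R := (nnsfun_approx measurableT mf n : g_sigma_algebraType G -> R).
have mF n : gmeas G (F n) by rewrite /gmeas /F; exact: measurable_funPT.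
have F0 n w : 0 <= F n w by rewrite /F.
have Fle n w : F n w <= phi w.
  by rewrite /F -lee_fin nnsfun_approxE; exact: le_approx.
have Fcvg w : F n w @[n --> \oo] --> phi w.
  have := @cvg_nnsfun_approx _ _ _ _ measurableT f mf f0 w I.
  by move=> /fine_cvg; apply: cvg_trans.
have Fmean n : mean P (fun w => F n w * xi w) <= 0.
  have finF : finite_set (range (F n)) by exact: (@fimfunP _ _ (nnsfun_approx measurableT mf n)).
  pose s : seq R := finmap.enum_fset (fset_set (range (F n))).
  have FE w : F n w = \sum_(y <- s) y * \1_(F n @^-1` [set y]) w.
    by rewrite {1}/F fimfunE fsbig_finite.
  have mFy y : <<s G >> (F n @^-1` [set y]) by exact: gmeas_preimage.
  under eq_fun do rewrite FE mulr_suml.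
  rewrite mean_sum => [|y]; last first.
    under eq_fun do rewrite -mulrA.
    by apply: intgZ; apply: intg_indic => //; exact: sG.
  rewrite big_seq sumr_le0// => y; rewrite in_fset_set// inE => -[w _ <-].
  under eq_fun do rewrite -mulrA.
  rewrite meanZ; last by apply: intg_indic => //; exact: sG.
  by rewrite mulr_ge0_le0// Hxi.
have mF' n := gmeas_measurable sG (mF n).
have mxi := intg_measurable ixi.
have : mean P (fun w => F n w * xi w) @[n --> \oo] --> mean P (fun w => phi w * xi w).
  apply: (@mean_cvg _ _ _ P (fun n w => F n w * xi w) _ (fun w => c * `|xi w|)).
  - by move=> n; exact: measurable_funM.
  - by apply: measurable_funM => //; exact: gmeas_measurable mphi.
  - by move=> w; apply: cvgMl; exact: Fcvg.
  - by apply: intgZ; exact: integrable_norm.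
  - move=> n w; rewrite normrM ler_wpM2r// ger0_norm//.
    by case/andP: (phi0 w) => _; exact: le_trans.
move=> H; rewrite -(cvg_lim (@Rhausdorff R) H); apply: limr_le.
  by apply/cvg_ex; eexists; exact: H.
exact: nearW.
Qed.

Lemma mean_test_le G xi eta phi c : <<s G >> `<=` measurable -> intg xi -> intg eta ->
  (forall A, <<s G >> A ->
    mean P (fun w => \1_A w * xi w) <= mean P (fun w => \1_A w * eta w)) ->
  gmeas G phi -> (forall w, 0 <= phi w <= c) ->
  mean P (fun w => phi w * xi w) <= mean P (fun w => phi w * eta w).
Proof.
move=> sG ixi ieta H mphi phi0.
have phic w : `|phi w| <= c by case/andP: (phi0 w) => p0 pc; rewrite ger0_norm.
have mphi' := gmeas_measurable sG mphi.
rewrite -subr_le0 -meanB; [|exact: intg_mulb phic _..].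
under eq_fun do rewrite -mulrBr.
apply: (@mean_test_le0 G (fun w => xi w - eta w) phi c) => //; first exact: intgB.
move=> A GA; under eq_fun do rewrite mulrBr.
by rewrite meanB ?subr_le0 ?H//; apply: intg_indic => //; exact: sG.
Qed.

Lemma mean_test_eq G xi eta phi c : <<s G >> `<=` measurable -> intg xi -> intg eta ->
  (forall A, <<s G >> A ->
    mean P (fun w => \1_A w * xi w) = mean P (fun w => \1_A w * eta w)) ->
  gmeas G phi -> (forall w, `|phi w| <= c) ->
  mean P (fun w => phi w * xi w) = mean P (fun w => phi w * eta w).
Proof.
move=> sG ixi ieta H mphi phic.
have mphi' := gmeas_measurable sG mphi.
(* Shifting by [c] makes the test non-negative; the shift contributes [c] times the mean, which is
   the same for [xi] and [eta] by testing on [setT]. *)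
have mphi2 : gmeas G (fun w => phi w + c) by exact: measurable_funD.
have phi2 w : 0 <= phi w + c <= c + c.
  by have := phic w; rewrite ler_norml => /andP[h1 h2]; apply/andP; split; lra.
have E (X : Omega -> R) : intg X ->
    mean P (fun w => (phi w + c) * X w) = mean P (fun w => phi w * X w) + c * mean P X.
  move=> iX; under eq_fun do rewrite mulrDl.
  rewrite meanD ?meanZ//; [exact: intg_mulb phic _|exact: intgZ].
have HT : mean P xi = mean P eta.
  have := H setT; rewrite indicT; under eq_fun do rewrite mul1r.
  under [in RHS]eq_fun do rewrite mul1r.
  by apply; exact: (@measurableT _ (g_sigma_algebraType G)).
apply: (addIr (c * mean P xi)); rewrite -E// HT -E//.
apply/eqP; rewrite eq_le; apply/andP; split.
  by apply: (mean_test_le sG _ _ _ mphi2 phi2) => // A GA; rewrite H.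
by apply: (mean_test_le sG _ _ _ mphi2 phi2) => // A GA; rewrite H.
Qed.

(** [Z] is the density, on the sub-sigma-algebra, of the charge given by integrating X over events,
    with respect to the restriction of [P]. *)
Lemma condexp_exists G X : <<s G >> `<=` measurable -> intg X ->
  exists Z : Omega -> R, [/\ gmeas G Z, intg Z &
    forall A, <<s G >> A ->
      mean P (fun w => \1_A w * X w) = mean P (fun w => \1_A w * Z w)].
Proof.
move=> sG iX.
pose T := g_sigma_algebraType G.
have mid : measurable_fun setT (idfun : Omega -> T).
  by move=> _ B mB; rewrite setTI; exact: sG.
have [Q QP] := @probability_of _ T R P (measure0 P) (measure_ge0 P)
  (fun F mF tF mUF => @measure_semi_sigma_additive _ _ _ P F (fun i => sG _ (mF i)) tF (sG _ mUF))
  (@probability_setT _ _ _ P).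
have [nu nuX] := @charge_of _ T R (induced_charge iX)
  (@charge0 _ _ _ (induced_charge iX))
  (fun A mA => @fin_num_measure _ _ _ (induced_charge iX) A (sG _ mA))
  (fun F mF tF mUF => @charge_semi_sigma_additive _ _ _ (induced_charge iX) F
     (fun i => sG _ (mF i)) tF (sG _ mUF)).
have nuQ : nu `<< Q.
  apply/null_content_dominatesP => A mA PA0.
  rewrite nuX; apply: null_set_integral; [exact: sG|apply/measurable_EFinP/measurable_funTS; exact: intg_measurable iX|].
  by rewrite -[LHS]QP.
have := @Radon_Nikodym_integrable _ T R nu Q nuQ.
have := @Radon_Nikodym_integral _ T R nu Q.
set h := Radon_Nikodym _ _ => hnu ih.
have hfin w : h w \is a fin_num by exact: Radon_Nikodym_fin_num.
pose Z : Omega -> R := fine \o h.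
have mh : measurable_fun setT h by exact: (measurable_int Q).
have mZ : gmeas G Z by exact: measurableT_comp mh.
(* The restricted probability is the image of [P] under the identity, so integrals transfer by
   change of variables. The transfer is made for non-negative functions, hence the split into
   positive and negative parts below. *)
have transfer A (g : T -> \bar R) : measurable A -> measurable_fun setT g ->
   (forall w, 0 <= g w)%E ->
  (\int[Q]_(w in A) g w = \int[P]_(w in A) (g : Omega -> \bar R) w)%E.
  move=> mA mg g0.
  rewrite -(@ge0_integral_pushforward _ _ Omega T R idfun mid P A g)//; last exact: measurable_funTS.
  by apply: eq_measure_integral => B mB _; rewrite [LHS]QP.
have iZ : intg Z.
  apply/integrableP; split; first by apply/measurable_EFinP; exact: gmeas_measurable mZ.
  have /integrableP[_] := ih; congr (_ < _)%E.
  rewrite transfer//; first by apply: eq_integral => w _ /=; rewrite -{1}(fineK (hfin w)).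
  exact: measurableT_comp.
exists Z; split => // A GA.
have mA := sG _ GA.
apply: EFin_inj; rewrite -!setint_mean//.
transitivity (nu A); first by rewrite nuX.
rewrite hnu// integralE [RHS]integralE.
have pos0 w : (0 <= (h^\+)%E w)%E by exact: funepos_ge0.
have neg0 w : (0 <= (h^\-)%E w)%E by exact: funeneg_ge0.
rewrite (transfer A _ GA (measurable_funepos mh) pos0).
rewrite (transfer A _ GA (measurable_funeneg mh) neg0).
have -> : (fun w : Omega => (Z w)%:E) = h by apply/funext => w; exact: fineK.
by [].
Qed.

End sub_sigma_algebra.

(** * Independence and martingale increments *)

Section independence.
Context {disp : measure_display} {Omega : measurableType disp} {R : realType}.
Variable P : probability Omega R.
Implicit Types (X xi phi : Omega -> R) (c : R) (G : set (set Omega)).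

Local Notation intg X := (P.-integrable setT (EFin \o X)).

Lemma meanZr c X : intg X -> mean P (fun w => X w * c) = mean P X * c.
Proof.
move=> iX; rewrite mulrC -meanZ//.
by congr mean; apply/funext => w; rewrite mulrC.
Qed.

(** The events with zero integral form a Dynkin system: complements use that [xi] has mean zero,
    disjoint unions the countable additivity of [induced_charge]. *)
Lemma mean_pi_system (Pi : set (set Omega)) xi : Pi `<=` measurable ->
  setI_closed Pi -> intg xi -> mean P xi = 0 ->
  (forall A, Pi A -> mean P (fun w => \1_A w * xi w) = 0) ->
  forall E, <<s Pi >> E -> mean P (fun w => \1_E w * xi w) = 0.
Proof.
move=> mPi PiI ixi xi0 H.
have sPi : <<s Pi >> `<=` measurable.
  by apply: smallest_sub => //; exact: sigma_algebra_measurable.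
have intT : mean P (fun w => \1_[set: Omega] w * xi w) = 0.
  by rewrite indicT; under eq_fun do rewrite mul1r.
apply: (@dynkin_induction _ (g_sigma_algebraType Pi) Pi
  (fun E => mean P (fun w => \1_E w * xi w) = 0)) => //.
- move=> E mE HE; have mE' := sPi _ mE.
  have -> : (fun w => \1_(~` E) w * xi w) = (fun w => xi w - \1_E w * xi w).
    by apply/funext => w; rewrite !indicE in_setC; case: (w \in E); rewrite ?mul1r ?mul0r ?subr0 ?subrr.
  by rewrite meanB ?xi0 ?HE ?subrr//; exact: intg_indic.
- move=> F mF tF HF; have mF' i := sPi _ (mF i).
  have mU : (@measurable _ Omega) (\bigcup_k F k) by exact: (@bigcup_measurable _ Omega).
  have H0 n : induced_charge ixi (F n) = 0%E.
    by rewrite /induced_charge (@setint_mean _ _ _ P _ xi)// HF.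
  have := @charge_semi_sigma_additive _ _ _ (induced_charge ixi) F mF' tF mU.
  rewrite (_ : (fun n => _) = fun=> 0%E); last first.
    by apply/funext => n; rewrite big1// => i _; exact: H0.
  move=> cv; have := cvg_unique (@ereal_hausdorff R) cv (cvg_cst _).
  by rewrite /= /induced_charge (@setint_mean _ _ _ P _ xi)// => /(_ _ _)[].
Qed.

(** Generates what is known just before the next mixing matrix is drawn: the past [G] and the new
    sample [Y]. *)
Definition joint_gen G d2 (T2 : measurableType d2) (Y : Omega -> T2) :=
  <<s G >> `|` preimage_set_system setT Y measurable.

Lemma joint_gen_measurable G d2 (T2 : measurableType d2) (Y : Omega -> T2) :
  <<s G >> `<=` measurable -> measurable_fun setT Y ->
  <<s joint_gen G Y >> `<=` measurable.
Proof.
move=> sG mY; apply: smallest_sub; first exact: sigma_algebra_measurable.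
by move=> A [/sG//|[B mB <-]]; exact: mY.
Qed.

(** Intersections of an event of the past with an event on [Y] form a pi-system that generates the
    joint sigma-algebra. *)
Lemma mean_joint G d2 (T2 : measurableType d2) (Y : Omega -> T2) xi :
  <<s G >> `<=` measurable -> measurable_fun setT Y -> intg xi ->
  (forall A B, <<s G >> A -> measurable B ->
     mean P (fun w => \1_(A `&` Y @^-1` B) w * xi w) = 0) ->
  forall E, <<s joint_gen G Y >> E -> mean P (fun w => \1_E w * xi w) = 0.
Proof.
move=> sG mY ixi H.
pose Pi := [set E | exists A B, [/\ <<s G >> A, measurable B & E = A `&` Y @^-1` B]].
have GT : <<s G >> setT by exact: (@measurableT _ (g_sigma_algebraType G)).
have YT : measurable (setT : set T2) by [].
have sub : <<s joint_gen G Y >> `<=` <<s Pi >>.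
  apply: smallest_sub; first exact: smallest_sigma_algebra.
  move=> A [GA|[B mB <-]]; apply: sub_sigma_algebra.
    by exists A, setT; split => //; rewrite preimage_setT setIT.
  by exists setT, B.
have mPi : Pi `<=` measurable.
  move=> _ [A [B [GA mB ->]]]; apply: measurableI; first exact: sG.
  by rewrite -[X in measurable X]setTI; exact: mY.
move=> E /sub; apply: mean_pi_system => //.
- move=> _ _ [A [B [GA mB ->]]] [A' [B' [GA' mB' ->]]].
  exists (A `&` A'), (B `&` B'); split.
  + exact: (@measurableI _ (g_sigma_algebraType G)).
  + exact: measurableI.
  + by rewrite preimage_setI setIACA.
- have := H setT setT GT YT; rewrite preimage_setT setIT indicT.
  by under eq_fun do rewrite mul1r.
- by move=> _ [A [B [GA mB ->]]]; exact: H.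
Qed.

(** Indicators are replaced by bounded functions one factor at a time. Each replacement compares
    means against a random variable and against its constant mean, so [mean_test_eq] applies
    twice. *)
Lemma mean_indep G d1 (T1 : measurableType d1) (W : Omega -> T1) (g : T1 -> R) X c c' :
  <<s G >> `<=` measurable -> measurable_fun setT W ->
  (forall C E, measurable C -> <<s G >> E ->
    mean P (fun w => \1_(W @^-1` C) w * \1_E w) =
    mean P (\1_(W @^-1` C)) * mean P (\1_E)) ->
  measurable_fun setT g -> (forall w, `|g (W w)| <= c) ->
  gmeas G X -> (forall w, `|X w| <= c') ->
  mean P (fun w => g (W w) * X w) = mean P (g \o W) * mean P X.
Proof.
move=> sG mW H mg gc mX Xc.
pose S := preimage_set_system setT W (@measurable _ T1).
have sS : sigma_algebra setT S.
  by apply: sigma_algebra_preimage; exact: sigma_algebra_measurable.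
have SE : <<s S >> = S by exact: sigma_algebra_id.
have Sm : <<s S >> `<=` measurable by rewrite SE => _ [B mB <-]; exact: mW.
have mgW : gmeas S (g \o W).
  move=> _ B mB; apply: sub_sigma_algebra; exists (g @^-1` B) => //.
  by rewrite -[X in measurable X]setTI; exact: mg.
have bgW w : `|(g \o W) w| <= c by exact: gc.
have mgW' := gmeas_measurable Sm mgW.
have igW : intg (g \o W) by exact: intg_bdd bgW.
have E1 E : <<s G >> E ->
    mean P (fun w => (g \o W) w * \1_E w) = mean P (g \o W) * mean P (\1_E).
  move=> GE; have mE := sG _ GE.
  have iE : intg (\1_E) by exact: integrable_indic.
  rewrite (@mean_test_eq _ _ _ P S _ (fun=> mean P (\1_E)) _ c) //.
  - by rewrite meanZr.
  - exact: intg_cst.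
  - rewrite SE => A [C mC <-]; rewrite setTI H//.
    rewrite meanZr//; apply: integrable_indic.
    by rewrite -[X in measurable X]setTI; exact: mW.
have mX' := gmeas_measurable sG mX.
have iX : intg X by exact: intg_bdd Xc.
transitivity (mean P (fun w => X w * (g \o W) w)).
  by congr mean; apply/funext => w; rewrite mulrC.
rewrite (@mean_test_eq _ _ _ P G _ (fun=> mean P (g \o W)) _ c') //.
- by rewrite meanZr// mulrC.
- exact: intg_cst.
- move=> A GA; transitivity (mean P (fun w => (g \o W) w * \1_A w)).
    by congr mean; apply/funext => w; rewrite mulrC.
  rewrite E1// meanZr 1?mulrC//; apply: integrable_indic; exact: sG.
Qed.

End independence.

(** * Almost sure convergence from summable moments *)

Section martingale.
Context {disp : measure_display} {Omega : measurableType disp} {R : realType}.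
Variable P : probability Omega R.
Implicit Types (X xi phi : Omega -> R) (c : R) (G : set (set Omega)).

Local Notation intg X := (P.-integrable setT (EFin \o X)).

Lemma mean_markov X (l : R) : intg X -> (forall w, 0 <= X w) -> 0 < l ->
  (P [set w | (l <= X w)%R] <= (mean P X / l)%:E)%E.
Proof.
move=> iX X0 l0; have mX := intg_measurable iX.
have := @le_integral_abse _ _ _ P setT measurableT (EFin \o X) l.
move=> /(_ (measurable_int _ iX) l0).
have -> : setT `&` [set x | (l%:E <= `|(EFin \o X) x|)%E] = [set w | (l <= X w)%R].
  rewrite setTI; apply/seteqP; split => w /=; rewrite lee_fin ger0_norm//.
have -> : (\int[P]_x `|(EFin \o X) x| = (mean P X)%:E)%E.
  by rewrite -mean_EFin//; apply: eq_integral => w _; rewrite /= ger0_norm.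
by rewrite EFinM lee_pdivlMr// muleC.
Qed.

(** Because the events increase with [k], a bound uniform in [k] passes to their union, and the
    exceptional set lies in every such union. Monotonicity replaces a maximal inequality. *)
Lemma ae_tail (A : nat -> nat -> set Omega) :
  (forall m k, measurable (A m k)) ->
  (forall m, {homo A m : k k' / (k <= k')%N >-> k `<=` k'}) ->
  (forall e : R, 0 < e -> exists m, forall k, (P (A m k) <= e%:E)%E) ->
  {ae P, forall w, exists m, forall k, ~ A m k w}.
Proof.
move=> mA hA tA; pose B m := \bigcup_k A m k.
have mB m : measurable (B m) by exact: bigcup_measurable.
exists (\bigcap_m B m); split.
- by apply: bigcapT_measurable.
- apply/eqP; rewrite eq_le measure_ge0 andbT; apply/lee_addgt0Pr => e e0.
  rewrite add0e; have [m Am] := tA _ e0.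
  rewrite (@le_trans _ _ (P (B m)))//.
    by rewrite le_measure ?inE//; [exact: bigcapT_measurable|exact: bigcap_inf].
  have hm : {homo A m : n k / (n <= k)%N >-> (n <= k)%O}.
    by move=> n k nk; apply/subsetPset; exact: hA.
  have H : (P \o A m) @ \oo --> P (B m) by exact: nondecreasing_cvg_mu (mA m) (mB m) hm.
  rewrite -(cvg_lim (@ereal_hausdorff R) H); apply: lime_le; first by apply/cvg_ex; eexists; exact: H.
  exact: nearW.
- move=> w /= /forallNP nA m _; have /existsNP[k /contrapT Ak] := nA m.
  by exists k.
Qed.

Lemma bounded_sum_tail (v : nat -> R) (M : R) : (forall n, 0 <= v n) ->
  (forall n, \sum_(i < n) v i <= M) ->
  forall e, 0 < e -> exists m, forall k, \sum_(i < k) v (m + i)%N <= e.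
Proof.
move=> v0 vM e e0.
have nd : nondecreasing_seq (fun n => \sum_(i < n) v i).
  by apply/nondecreasing_seqP => n; rewrite big_ord_recr/= lerDl.
have ub : has_ubound (range (fun n => \sum_(i < n) v i)) by exists M => _ [n _ <-].
have cv := nondecreasing_is_cvgn nd ub.
set l := limn _ in cv.
have le_l n : \sum_(i < n) v i <= l by apply: nondecreasing_cvgn_le => //; apply/cvg_ex; exists l.
have [m _ Hm] : \forall n \near \oo, `|l - \sum_(i < n) v i| < e.
  by move/cvgrPdist_lt : cv; exact.
exists m => k; have := le_l (m + k)%N; have := Hm m (leqnn m).
rewrite big_split_ord/= ltr_norml => /andP[_ h1] h2; lra.
Qed.

(** The tail sums starting at [m] dominate each of their terms and have small mean, so Markov's
    inequality and [ae_tail] apply; non-negativity makes the events increasing. *)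
Lemma ae_cvg0_summable (X : nat -> Omega -> R) (c : nat -> R) (M : R) :
  (forall n, measurable_fun setT (X n)) -> (forall n w, 0 <= X n w <= c n) ->
  (forall n, \sum_(i < n) mean P (X i) <= M) ->
  {ae P, forall w, X n w @[n --> \oo] --> (0 : R)}.
Proof.
move=> mX X0 XM.
have iX n : intg (X n).
  by apply: (@intg_bdd _ _ _ P (c n)) => // w; have /andP[h1 h2] := X0 n w; rewrite ger0_norm.
have X0' n w : 0 <= X n w by case/andP: (X0 n w).
pose S m k w := \sum_(i < k) X (m + i)%N w.
pose A l m k := [set w | (l.+1%:R^-1 <= S m k w :> R)].
have tail l : {ae P, forall w, exists m, forall k, ~ A l m k w}.
  apply: ae_tail.
  - move=> m k; rewrite /A (_ : [set w | _] = (S m k) @^-1` `[l.+1%:R^-1, +oo[).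
      rewrite -[X in measurable X]setTI.
      have mS : measurable_fun setT (S m k) by exact: measurable_sum.
      exact: mS.
    by apply/seteqP; split => w /=; rewrite in_itv/= andbT.
  - move=> m k k' kk' w /le_trans; apply.
    rewrite /S -(subnKC kk') big_split_ord/= lerDl sumr_ge0//.
  - move=> e e0.
    have [m Hm] := @bounded_sum_tail (fun i => mean P (X i)) M
      (fun n => mean_ge0 P (X0' n)) XM (e / l.+1%:R) ltac:(by rewrite divr_gt0).
    exists m => k; apply: (@le_trans _ _ (mean P (S m k) / l.+1%:R^-1)%:E).
      apply: mean_markov; [exact: intg_sum|by move=> w; exact: sumr_ge0|by rewrite invr_gt0].
    rewrite lee_fin invrK /S mean_sum//.
    by have := Hm k; rewrite -ler_pdivlMr// invrK => H.
have := ae_foralln tail; apply: filterS => w Hw.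
apply/cvgrPdist_lt => e e0.
have [l le] : exists l, l.+1%:R^-1 < e.
  exists (Num.truncn e^-1); rewrite invf_plt ?posrE//.
  exact: truncnS_gt.
have [m Hm] := Hw l; exists m => // n /= mn.
rewrite sub0r normrN ger0_norm//; apply: lt_trans le.
have := Hm (n - m).+1 => /negP; rewrite -ltNge; apply: le_lt_trans.
by rewrite /S big_ord_recr/= subnKC// lerDr sumr_ge0.
Qed.

Lemma mean_test_eq0 G xi phi c : <<s G >> `<=` measurable -> intg xi ->
  (forall A, <<s G >> A -> mean P (fun w => \1_A w * xi w) = 0) ->
  gmeas G phi -> (forall w, `|phi w| <= c) ->
  mean P (fun w => phi w * xi w) = 0.
Proof.
move=> sG ixi H mphi phic.
rewrite (@mean_test_eq _ _ _ P G xi (fun=> 0) phi c)//.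
- by under eq_fun do rewrite mulr0; exact: mean_cst.
- exact: intg_cst.
- by move=> A GA; rewrite H//; under eq_fun do rewrite mulr0; rewrite mean_cst.
Qed.

Lemma measurable_lt_cst d (T : measurableType d) (X : T -> R) (l : R) :
  measurable_fun setT X -> measurable [set w | `|X w| < l].
Proof.
move=> mX; have mN : measurable_fun setT (fun w => `|X w|) by exact: measurableT_comp.
rewrite (_ : [set w | _] = (fun w => `|X w|) @^-1` `]-oo, l[).
  by rewrite -[X in measurable X]setTI; exact: mN.
by apply/seteqP; split => w /=; rewrite in_itv.
Qed.

Lemma measurable_ge_cst d (T : measurableType d) (X : T -> R) (l : R) :
  measurable_fun setT X -> measurable [set w | l <= X w].
Proof.
move=> mX; rewrite (_ : [set w | _] = X @^-1` `[l, +oo[).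
  by rewrite -[X in measurable X]setTI; exact: mX.
by apply/seteqP; split => w /=; rewrite in_itv/= andbT.
Qed.

Section convergence.
Variables (Gs : nat -> set (set Omega)) (xi : nat -> Omega -> R) (c : nat -> R) (M : R).
Hypothesis sG : forall n, <<s Gs n >> `<=` measurable.
Hypothesis GS : forall n, <<s Gs n >> `<=` <<s Gs n.+1 >>.
Hypothesis mxi : forall n, gmeas (Gs n.+1) (xi n).
Hypothesis xic : forall n w, `|xi n w| <= c n.
Hypothesis xi0 : forall n A, <<s Gs n >> A -> mean P (fun w => \1_A w * xi n w) = 0.
Hypothesis xiM : forall n, \sum_(i < n) mean P (fun w => xi i w ^+ 2) <= M.

(* Stopping keeps the partial sums bounded, hence usable as test functions against
   the next increment. *)
Fixpoint stopped (l : R) (m k : nat) (w : Omega) : R :=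
  if k is k'.+1 then
    stopped l m k' w + \1_[set u | `|stopped l m k' u| < l] w * xi (m + k')%N w
  else 0.

Lemma stopped_meas l m k : gmeas (Gs (m + k)%N) (stopped l m k).
Proof.
elim: k => [|k IH]; first exact: measurable_cst.
have mIH : gmeas (Gs (m + k.+1)%N) (stopped l m k).
  by apply: gmeas_sub IH; rewrite addnS; exact: GS.
rewrite /gmeas/=; apply: measurable_funD => //; apply: measurable_funM.
  by apply: measurable_indic; exact: measurable_lt_cst.
by rewrite addnS; exact: mxi.
Qed.

Lemma indic01 A (w : Omega) : 0 <= (\1_A w : R) <= 1.
Proof. by rewrite indicE; case: (_ \in _); rewrite /= ?lexx ?ler01. Qed.

Lemma stopped_bounded l m k w : `|stopped l m k w| <= \sum_(i < k) c (m + i)%N.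
Proof.
elim: k => [|k IH]; first by rewrite /= normr0 big_ord0.
rewrite /= big_ord_recr/= (le_trans (ler_normD _ _))// lerD//.
have /andP[h0 h1] := indic01 [set u | `|stopped l m k u| < l] w.
rewrite normrM (ger0_norm h0) (le_trans _ (xic (m + k)%N w))//.
by rewrite ler_piMl.
Qed.

Lemma stopped_intg l m k (n : nat) : intg (fun w => stopped l m k w ^+ n).
Proof.
have mT := gmeas_measurable (@sG _) (@stopped_meas l m k).
apply: (@intg_bdd _ _ _ P ((\sum_(i < k) c (m + i)%N) ^+ n)).
  exact: measurable_funX.
by move=> w; rewrite normrX lerXn2r ?nnegrE ?stopped_bounded// (le_trans _ (stopped_bounded l m k w)).
Qed.

(** Increments are orthogonal: the stopped sum times the indicator of not being stopped is
    measurable with respect to the past and bounded by |l|, so its product with the next increment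
    has mean zero. *)
Lemma mean_sqr_stopped l m k :
  mean P (fun w => stopped l m k w ^+ 2) <=
  \sum_(i < k) mean P (fun w => xi (m + i)%N w ^+ 2).
Proof.
elim: k => [|k IH]; first by rewrite big_ord0 /= expr0n /= mean_cst.
rewrite big_ord_recr/=; apply: le_trans (lerD IH (lexx _)).
set T := stopped l m k; set x := xi _; set A := [set u | _].
have mT : gmeas (Gs (m + k)%N) T by exact: stopped_meas.
have GA : <<s Gs (m + k)%N >> A.
  exact: (@measurable_lt_cst _ (g_sigma_algebraType (Gs (m + k)%N))).
have mA : measurable A by exact: sG GA.
have mx : measurable_fun setT x.
  by apply: (gmeas_measurable (@sG _)); rewrite /x; exact: mxi.
have xc w : `|x w| <= c (m + k)%N by exact: xic.
have ix : intg x by exact: intg_bdd xc.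
have ix2 : intg (fun w => x w ^+ 2).
  apply: (@intg_bdd _ _ _ P (c (m + k)%N ^+ 2)); first exact: measurable_funX.
  by move=> w; rewrite normrX lerXn2r ?nnegrE// (le_trans _ (xc w)).
have iAx2 : intg (fun w => \1_A w * x w ^+ 2) by exact: intg_indic.
have mTA : gmeas (Gs (m + k)%N) (fun w => T w * \1_A w).
  by apply: measurable_funM => //; exact: measurable_indic.
have TAl w : `|T w * \1_A w| <= `|l|.
  rewrite indicE; case: (boolP (w \in A)) => [|_]; last by rewrite mulr0 normr0.
  by rewrite inE /A/= mulr1 => /ltW/le_trans; apply; exact: ler_norm.
have iTAx : intg (fun w => (T w * \1_A w) * x w).
  by apply: intg_mulb TAl ix; exact: gmeas_measurable mTA.
have TAx0 : mean P (fun w => (T w * \1_A w) * x w) = 0.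
  by apply: mean_test_eq0 (@sG _) ix _ mTA TAl => B GB; exact: xi0.
have -> : (fun w => (T w + \1_A w * x w) ^+ 2) =
    (fun w => T w ^+ 2 + (2 * ((T w * \1_A w) * x w) + \1_A w * x w ^+ 2)).
  apply/funext => w; rewrite indicE; case: (w \in A) => /=; ring.
rewrite meanD ?meanD ?meanZ ?TAx0 ?mulr0 ?add0r//; [|exact: intgZ|exact: stopped_intg|].
  rewrite lerD2l mean_le// => w; have /andP[h0 h1] := indic01 A w.
  by rewrite ler_piMl// sqr_ge0.
by apply: intgD => //; exact: intgZ.
Qed.

(** Once the level is reached the process no longer moves, so the events of having reached it
    increase in time, as [ae_tail] requires. A second-moment bound at fixed times thus controls the
    whole path. *)
Lemma stopped_frozen l m k w : l <= `|stopped l m k w| ->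
  forall k', (k <= k')%N -> stopped l m k' w = stopped l m k w.
Proof.
move=> Tl k' /subnKC <-; elim: (k' - k)%N => [|j IH]; first by rewrite addn0.
rewrite addnS /= IH indicE memNset ?mul0r ?addr0//=.
by rewrite IH; apply/negP; rewrite -leNgt.
Qed.

Lemma stopped_sum l m k w : (forall k', `|stopped l m k' w| < l) ->
  stopped l m k w = \sum_(i < k) xi (m + i)%N w.
Proof.
move=> Tl; elim: k => [|k IH]; first by rewrite big_ord0.
by rewrite big_ord_recr/= -IH indicE mem_set ?mul1r//=.
Qed.

(** For each threshold there is almost surely a starting index after which the stopped sums never
    reach it. They are then the true sums, so the partial sums are Cauchy. *)
Lemma ae_cvg_martingale :
  {ae P, forall w, cvgn (fun n => \sum_(i < n) xi i w)}.
Proof.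
(* The crossing event is written with squares so that Markov's inequality applies to the second
   moment. *)
pose A j m k := [set w | j.+1%:R^-1 ^+ 2 <= stopped j.+1%:R^-1 m k w ^+ 2].
have j0 j : 0 < j.+1%:R^-1 :> R by rewrite invr_gt0.
have AE j m k w : A j m k w <-> j.+1%:R^-1 <= `|stopped j.+1%:R^-1 m k w|.
  by rewrite /A/= -(real_normK (num_real (stopped _ _ _ _))) ler_sqr ?nnegrE// ltW.
have tail j : {ae P, forall w, exists m, forall k, ~ A j m k w}.
  apply: ae_tail.
  - move=> m k; apply: measurable_ge_cst; apply: measurable_funX.
    exact: gmeas_measurable (@sG _) (@stopped_meas _ m k).
  - by move=> m k k' kk' w /AE H; apply/AE; rewrite (stopped_frozen H).
  - move=> e e0.
    have e0' : 0 < e * j.+1%:R^-1 ^+ 2 by rewrite mulr_gt0// exprn_gt0.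
    have v0 n : 0 <= mean P (fun w => xi n w ^+ 2) by apply: mean_ge0 => w; exact: sqr_ge0.
    have [m Hm] := bounded_sum_tail v0 xiM e0'.
    exists m => k; apply: le_trans (mean_markov _ _ _) _.
    + exact: stopped_intg.
    + by move=> w; exact: sqr_ge0.
    + by rewrite exprn_gt0.
    + by rewrite lee_fin ler_pdivrMr ?exprn_gt0// (le_trans (mean_sqr_stopped _ _ _))// Hm.
have := ae_foralln tail; apply: filterS => w Hw.
apply: cauchy_cvg; apply/cauchy_exP => e e0.
have [j je] : exists j, j.+1%:R^-1 < e.
  exists (Num.truncn e^-1); rewrite invf_plt ?posrE//.
  exact: truncnS_gt.
have [m Hm] := Hw j.
have {}Hm k : `|stopped j.+1%:R^-1 m k w| < j.+1%:R^-1.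
  by rewrite ltNge; apply/negP => /AE; exact: Hm.
exists (\sum_(i < m) xi i w); exists m => // n /= mn.
rewrite /ball/= -(subnKC mn) big_split_ord/= opprD addNKr normrN.
by rewrite -(stopped_sum _ Hm); exact: lt_trans (Hm _) je.
Qed.

End convergence.

End martingale.

(** * Interpolation of a perturbed Euler scheme *)

Lemma integrable_setU d (T : measurableType d) (R : realType)
    (mu : {measure set T -> \bar R}) (A B : set T) (f : T -> R) :
  measurable A -> measurable B -> [disjoint A & B] ->
  mu.-integrable A (EFin \o f) -> mu.-integrable B (EFin \o f) ->
  mu.-integrable (A `|` B) (EFin \o f).
Proof.
move=> mA mB AB /integrableP[mfA fA] /integrableP[mfB fB].
have mf : measurable_fun (A `|` B) (EFin \o f) by apply/measurable_funU.
apply/integrableP; split => //.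
rewrite ge0_integral_setU//; first exact: lte_add_pinfty.
by apply: measurableT_comp.
Qed.

Section step_functions.
Context {R : realType}.
Variable gamma : nat -> R.
Hypothesis gamma_gt0 : forall n, 0 < gamma n.+1.
Hypothesis tau_div : tau gamma n @[n --> \oo] --> +oo.

Local Notation tau := (tau gamma).
Local Notation leb := (@lebesgue_measure R).

Lemma tau0 : tau 0 = 0.
Proof. by rewrite /Defs.tau big_geq. Qed.

Lemma tauS n : tau n.+1 = tau n + gamma n.+1.
Proof. by rewrite /Defs.tau big_nat_recr. Qed.

Lemma tau_lt n : tau n < tau n.+1.
Proof. by rewrite tauS ltrDl. Qed.

Lemma tau_le m n : (m <= n)%N -> tau m <= tau n.
Proof.
move=> /subnKC <-; elim: (n - m)%N => [|k IH]; first by rewrite addn0.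
by rewrite addnS (le_trans IH)// ltW// tau_lt.
Qed.

Lemma tau_ge0 n : 0 <= tau n.
Proof. by rewrite -tau0 tau_le. Qed.

Lemma tau_index t : 0 <= t -> exists n, tau n <= t < tau n.+1.
Proof.
move=> t0; have [n _ /(_ n (leqnn n)) tn] : \forall n \near \oo, t < tau n.
  by move/cvgryPgt : tau_div; exact.
elim: n tn => [|n IH] tn; first by rewrite tau0 ltNge t0 in tn.
by have [/IH//|nt] := ltP t (tau n); exists n; rewrite nt.
Qed.

Definition step_index t : nat := get [set n | tau n <= t < tau n.+1].

Lemma indexP t : 0 <= t -> tau (step_index t) <= t < tau (step_index t).+1.
Proof. by move=> /tau_index H; exact: (@getPex _ [set n | tau n <= t < tau n.+1] H). Qed.

Lemma index_eq n t : tau n <= t < tau n.+1 -> step_index t = n.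
Proof.
move=> /andP[nt tn]; have /andP[it ti] := indexP (le_trans (tau_ge0 n) nt).
apply/eqP; rewrite eqn_leq; apply/andP; split; rewrite leqNgt; apply/negP => /tau_le H.
  by have := le_lt_trans it tn; rewrite ltNge H.
by have := le_lt_trans nt ti; rewrite ltNge H.
Qed.

Lemma index_ge n t : tau n <= t -> (n <= step_index t)%N.
Proof.
move=> nt; have /andP[it ti] := indexP (le_trans (tau_ge0 n) nt).
by rewrite leqNgt; apply/negP => /tau_le H; have := le_lt_trans nt ti; rewrite ltNge H.
Qed.

Section integral.
Variable a : nat -> R.

(** Closed form of the integral from 0 to [t] of the step function [a \o step_index]. *)
Definition primitive t : R :=
  \sum_(i < step_index t) gamma i.+1 * a i + (t - tau (step_index t)) * a (step_index t).

Lemma const_on_itv (I : interval R) (n : nat) (c : R) :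
  (forall s, s \in I -> a (step_index s) = c) -> (leb [set` I] < +oo)%E ->
  leb.-integrable [set` I] (EFin \o (a \o step_index)) /\
  \int[leb]_(s in [set` I]) a (step_index s) = c * fine (leb [set` I]).
Proof.
move=> Ic Ifin; split; last first.
  by rewrite -Rintegral_cst//; apply: eq_Rintegral => s; rewrite inE; exact: Ic.
apply: (@eq_integrable _ _ _ _ _ _ (EFin \o cst c)) => // [s|].
  by rewrite inE /= => sI; rewrite Ic.
apply: measurable_bounded_integrable => //.
by exists `|c|; split; [exact: num_real|move=> y /ltW ? ? _].
Qed.

Lemma step_integral_tau n :
  leb.-integrable `[0, tau n[ (EFin \o (a \o step_index)) /\
  \int[leb]_(s in `[0, tau n[) a (step_index s) = \sum_(i < n) gamma i.+1 * a i.
Proof.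
elim: n => [|n [IH1 IH2]].
  rewrite tau0 set_itvco0 big_ord0; split; last exact: Rintegral_set0.
  exact: integrable_set0.
have U : `[0, tau n.+1[%classic = `[0, tau n[ `|` `[tau n, tau n.+1[ :> set R.
  by apply: itv_bndbnd_setU; rewrite bnd_simp ?tau_ge0// ltW// tau_lt.
have D : [disjoint `[0, tau n[%classic & `[tau n, tau n.+1[%classic : set R].
  apply/disj_setPS => s [/=]; rewrite !in_itv/= => /andP[_ h] /andP[].
  by rewrite leNgt h.
have [|//|K1 K2] := @const_on_itv `[tau n, tau n.+1[ n (a n).
- by move=> s; rewrite in_itv/= => /index_eq ->.
- by rewrite /= lebesgue_measure_itv/=; case: ifP => // _; rewrite ltry.
rewrite U; split; first exact: integrable_setU.
rewrite Rintegral_setU//; last exact: integrable_setU.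
rewrite big_ord_recr/= -IH2 K2; congr (_ + _).
by rewrite lebesgue_measure_itv/= lte_fin tau_lt/= tauS addrAC subrr add0r mulrC.
Qed.

Lemma step_integral t : 0 <= t ->
  leb.-integrable `[0, t] (EFin \o (a \o step_index)) /\
  \int[leb]_(s in `[0, t]) a (step_index s) = primitive t.
Proof.
move=> t0; have /andP[it ti] := indexP t0; set n := step_index t in it ti *.
have [IH1 IH2] := step_integral_tau n.
have U : `[0, t]%classic = `[0, tau n[ `|` `[tau n, t] :> set R.
  by apply: itv_bndbnd_setU; rewrite bnd_simp ?tau_ge0.
have D : [disjoint `[0, tau n[%classic & `[tau n, t]%classic : set R].
  apply/disj_setPS => s [/=]; rewrite !in_itv/= => /andP[_ h] /andP[].
  by rewrite leNgt h.
have [|//|K1 K2] := @const_on_itv `[tau n, t] n (a n).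
- by move=> s; rewrite in_itv/= => /andP[h1 h2]; rewrite (@index_eq n)// h1 (le_lt_trans h2).
- by rewrite /= lebesgue_measure_itv/=; case: ifP => // _; rewrite ltry.
rewrite U; split; first exact: integrable_setU.
rewrite Rintegral_setU//; last exact: integrable_setU.
rewrite /primitive -/n -IH2 K2; congr (_ + _); rewrite lebesgue_measure_itv/= lte_fin mulrC.
by case: ltP => //= ti'; rewrite (_ : t = tau n) ?subrr ?mul0r//; apply/eqP; rewrite eq_le ti' it.
Qed.

Lemma step_integral_itv t v : 0 <= t -> 0 <= v ->
  \int[leb]_(s in `[t, t + v]) a (step_index s) = primitive (t + v) - primitive t.
Proof.
move=> t0 v0; have tv0 : 0 <= t + v by exact: addr_ge0.
have [i1 <-] := step_integral tv0; have [i2 <-] := step_integral t0.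
rewrite Rintegral_itvB ?bnd_simp// ?lerDl// -Rintegral_itv_obnd_cbnd//.
by apply: integrableS i1 => //; apply: subset_itvr; rewrite bnd_simp.
Qed.

(** Within a step the primitive is a convex combination of two consecutive partial sums, so
    convergence of the series gives convergence in continuous time. *)
Lemma primitive_cvg (e : nat -> R) : (forall n, gamma n.+1 * a n = e n) ->
  cvgn (fun n => \sum_(i < n) e i) ->
  exists L, forall eps, 0 < eps -> exists T0, forall t, T0 <= t -> 0 <= t -> `|primitive t - L| <= eps.
Proof.
move=> ae /cvg_ex[/= L HL]; exists L => eps eps0.
have [n0 _ Hn] : \forall n \near \oo, `|L - \sum_(i < n) e i| <= eps.
  by move/cvgrPdist_le : HL; exact.
exists (tau n0) => t nt t0; have /index_ge := nt => ni.
have /andP[it ti] := indexP t0; rewrite /primitive.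
under eq_bigr do rewrite ae.
set n := step_index t in it ti ni *.
have h1 := Hn n ni; have := Hn n.+1 (leq_trans ni (leqnSn _)).
rewrite big_ord_recr/=; set E := \sum_(i < n) e i in h1 *.
pose l := (t - tau n) / gamma n.+1.
have g0 := gamma_gt0 n.
have l0 : 0 <= l by rewrite divr_ge0 ?subr_ge0// ltW.
have l1 : l <= 1 by rewrite ler_pdivrMr// mul1r lerBlDl -tauS ltW.
have -> : (t - tau n) * a n = l * e n.
  by rewrite -ae /l mulrA divfK// gt_eqF.
clearbody l E; move: (e n) h1 l0 l1 => x; clear => h1 l0 l1 h2.
have -> : E + l * x - L = - ((1 - l) * (L - E) + l * (L - (E + x))) by ring.
rewrite normrN (le_trans (ler_normD _ _))// !normrM (ger0_norm l0) ger0_norm ?subr_ge0//.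
have l1' : 0 <= 1 - l by rewrite subr_ge0.
have := lerD (ler_wpM2l l1' h1) (ler_wpM2l l0 h2); rewrite -mulrDl subrK mul1r; apply.
Qed.

End integral.
End step_functions.

Section interpolation.
Context {R : realType} {d : nat}.
Variables (gamma : nat -> R) (x : nat -> 'cV[R]_d) (y : R -> 'cV[R]_d).
Hypothesis gamma_gt0 : forall n, 0 < gamma n.+1.
Hypothesis tau_div : tau gamma n @[n --> \oo] --> +oo.
Hypothesis yE : forall n t, 0 <= t < gamma n.+1 ->
  y (tau gamma n + t) = x n +
    t *: ((tau gamma n.+1 - tau gamma n)^-1 *: (x n.+1 - x n)).

Local Notation tau := (tau gamma).
Local Notation step_index := (step_index gamma).

Definition slope n := (gamma n.+1)^-1 *: (x n.+1 - x n).

Lemma interpE n t : tau n <= t < tau n.+1 -> y t = x n + (t - tau n) *: slope n.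
Proof.
move=> /andP[nt tn]; rewrite /slope -(subrKC (tau n) t) yE ?subr_ge0 ?nt/=.
  by rewrite [tau n + _]addrC subrK tauS [tau n + _]addrC addrK.
by rewrite ltrBlDl -tauS.
Qed.

Lemma interp_tau n : y (tau n) = x n.
Proof. by rewrite (@interpE n) ?lexx ?tau_lt// subrr scale0r addr0. Qed.

Lemma interp_closed n t : tau n <= t <= tau n.+1 -> y t = x n + (t - tau n) *: slope n.
Proof.
move=> /andP[nt]; rewrite le_eqVlt => /predU1P[->|tn]; last by apply: interpE; rewrite nt.
rewrite interp_tau tauS [tau n + _]addrC addrK /slope scalerA divff ?gt_eqF// scale1r.
by rewrite addrC subrK.
Qed.

(** On a compact interval there are finitely many affine pieces; two times separated by a breakpoint
    are compared through it. Absolute continuity follows. *)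
Lemma interp_lip n : exists2 L, 0 <= L & forall s t, 0 <= s -> s <= t -> t <= tau n ->
  enorm (y t - y s) <= L * (t - s).
Proof.
elim: n => [|n [L L0 IH]].
  exists 0 => // s t s0 st; rewrite tau0 => t0.
  by rewrite (_ : t = s) ?subrr ?enorm0 ?mulr0//; apply/eqP; rewrite eq_le st andbT (le_trans t0).
exists (Num.max L (enorm (slope n))); first by rewrite le_max L0.
have seg s t : tau n <= s -> s <= t -> t <= tau n.+1 ->
    enorm (y t - y s) <= enorm (slope n) * (t - s).
  move=> ns st tn; rewrite !(@interp_closed n) ?ns ?(le_trans ns st) ?tn ?(le_trans st tn)//.
  rewrite opprD addrACA subrr add0r -scalerBl enormZ mulrC ler_wpM2l ?enorm_ge0//.
  by rewrite opprB addrA subrK ger0_norm// subr_ge0.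
move=> s t s0 st tn.
have mL : L <= Num.max L (enorm (slope n)) by rewrite le_max lexx.
have mS : enorm (slope n) <= Num.max L (enorm (slope n)) by rewrite le_max lexx orbT.
set M := Num.max _ _ in mL mS *; clearbody M.
have [nt|nt] := leP (tau n) t; last first.
  rewrite (le_trans (IH s t s0 st (ltW nt)))// ler_wpM2r// subr_ge0//.
have [ns|ns] := leP (tau n) s.
  by rewrite (le_trans (seg _ _ ns st tn))// ler_wpM2r// subr_ge0.
rewrite (le_trans (enorm_triangle (y (tau n)) _ _))//.
have h1 := seg _ _ (lexx _) nt tn; have h2 := IH _ _ s0 (ltW ns) (lexx _).
have h3 : 0 <= t - tau n by rewrite subr_ge0.
have h4 : 0 <= tau n - s by rewrite subr_ge0 ltW.
have := ler_wpM2r h3 mS; have := ler_wpM2r h4 mL => h5 h6.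
rewrite (_ : M * (t - s) = M * (t - tau n) + M * (tau n - s)); last by ring.
by rewrite lerD// ?(le_trans h1)// (le_trans h2).
Qed.

Lemma interp_abs_continuous a b : 0 <= a -> a <= b -> abs_continuous_on a b y.
Proof.
move=> a0 ab e e0.
have [n bn] : exists n, b <= tau n.
  have [n /andP[_ /ltW bn]] := tau_index tau_div (le_trans a0 ab).
  by exists n.+1.
have [L L0 HL] := interp_lip n.
have L1 : 0 < L + 1 by rewrite ltr_wpDl.
exists (e / (L + 1)) => [|m l r lr _ sum_lr]; first by rewrite divr_gt0.
apply: (@le_lt_trans _ _ (L * \sum_i (r i - l i))).
  rewrite mulr_sumr ler_sum// => i _; have [al lri rb] := lr i.
  by apply: HL => //; [exact: le_trans al|exact: le_trans bn].
move: sum_lr; rewrite ltr_pdivlMr// => H.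
have s0 : 0 <= \sum_i (r i - l i).
  by rewrite sumr_ge0// => i _; have [_ lri _] := lr i; rewrite subr_ge0.
by apply: le_lt_trans H; rewrite mulrC ler_wpM2l// lerDl.
Qed.

Lemma interp_derive n t : tau n < t < tau n.+1 ->
  derivable y t 1 /\ derive1 y t = slope n.
Proof.
move=> /andP[nt tn].
pose g (s : R) := x n + (s - tau n) *: slope n.
have cv : h^-1 *: (g (h *: 1 + t) - g t) @[h --> 0^'] --> slope n.
  apply: cvg_near_cst.
  near=> h; rewrite /g opprD addrACA subrr add0r -scalerBl opprB addrA subrK addrK scalerA.
  by rewrite [_ *: 1]mulr1 mulVf ?scale1r//; near: h; exact: nbhs_dnbhs_neq.
have dg : derivable g t 1 by exact: (cvgP _ cv).
have gy : \forall s \near t, g s = y s.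
  near=> s; apply/esym/interpE.
  by apply/andP; split; [apply/ltW|]; near: s; [exact: lt_nbhsr|exact: lt_nbhsl].
split; first exact: near_eq_derivable gy dg.
by rewrite derive1E -(near_eq_derive _ gy); exact: cvg_lim cv.
Unshelve. all: by end_near. Qed.

(** Deterministic form of the conclusion: [h] is the drift of the scheme and [v n] an exact value of
    [F] at the nearby point [z n]. The errors are asked to form a convergent series, not to be small
    relative to [gamma]. *)
Lemma interp_perturbed (F : 'cV[R]_d -> set 'cV[R]_d) (h v z : nat -> 'cV[R]_d) :
  (forall n, F (z n) (v n)) ->
  enorm (h n - v n) @[n --> \oo] --> (0 : R) ->
  enorm (x n - z n) @[n --> \oo] --> (0 : R) ->
  enorm (x n.+1 - x n) @[n --> \oo] --> (0 : R) ->
  (forall k, cvgn (fun n => \sum_(i < n) (x i.+1 - x i - gamma i.+1 *: h i) k 0)) ->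
  perturbed_solution F y.
Proof.
move=> Fzv hv xz xx cve; split; first exact: interp_abs_continuous.
pose u n := slope n - h n.
have uE n k : gamma n.+1 * u n k 0 = (x n.+1 - x n - gamma n.+1 *: h n) k 0.
  by rewrite /u /slope !mxE mulrBr mulrA divff ?gt_eqF// mul1r.
exists (fun t => u (step_index t)); split.
- move=> T k T0; have [i _] := step_integral gamma_gt0 tau_div (fun n => u n k 0) (ltW T0).
  exact: i.
- move=> T T0.
  have [L HL] := choice (fun k => primitive_cvg gamma_gt0 tau_div (fun n => uE n k) (cve k)).
  (* Convergence of the primitives bounds the integrals for every length at once, so the same [T1]
     serves all [w]. *)
  have key e : 0 < e -> exists T1, forall t, T1 <= t -> 0 <= t ->
      forall w, 0 <= w -> enorm (vintegral t (t + w) (fun t => u (step_index t))) <= e.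
    (* Each coordinate of the integral is a difference of two primitives, each within [e'] of the
       common limit; [d.+1] avoids a division by zero when d = 0. *)
    move=> e0; pose e' := e / (2 * d.+1%:R).
    have e'0 : 0 < e' by rewrite divr_gt0// mulr_gt0.
    have [T1 HT1] := choice (fun k => HL k e' e'0).
    exists (\big[Num.max/0]_k T1 k) => t T1t t0 w w0.
    apply: (@le_trans _ _ (d%:R * (2 * e'))); last first.
      apply: (@le_trans _ _ (d.+1%:R * (2 * e'))).
        by rewrite ler_wpM2r ?ler_nat// mulr_ge0// ltW.
      have : d.+1%:R != 0 :> R by rewrite pnatr_eq0.
      rewrite /e'; move: (d.+1%:R : R) => D D0.
      by rewrite (_ : D * _ = e)//; field.
    apply: enorm_le_coord => k; rewrite mxE.
    rewrite (step_integral_itv gamma_gt0 tau_div (fun n => u n k 0) t0 w0).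
    have kt : T1 k <= t by rewrite (le_trans _ T1t)// le_bigmax.
    have h1 := HT1 k t kt t0.
    have tw : t <= t + w by rewrite lerDl.
    have h2 := HT1 k (t + w) (le_trans kt tw) (addr_ge0 t0 w0).
    rewrite mulr_natl mulr2n (le_trans _ (lerD h2 h1))//.
    by rewrite [X in _ <= _ + X]distrC ler_distD.
  apply/fine_cvgP => /=.
  have bnd e : 0 < e -> \forall t \near +oo,
      (0 <= ereal_sup [set (enorm (vintegral t (t + v)(fun t => u (step_index t))))%:E | v in `[0%R, T]%classic]
       <= e%:E)%E.
    move=> e0; have [T1 H] := key _ e0.
    near=> t; apply/andP; split.
      apply: le_ereal_sup_tmp; exists (enorm (vintegral t (t + 0) (fun t => u (step_index t))))%:E.
        by exists 0 => //=; rewrite in_itv/= lexx ltW.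
      by rewrite lee_fin enorm_ge0.
    apply: ge_ereal_sup => r [w /=]; rewrite in_itv/= => /andP[w0 _] <-.
    rewrite lee_fin; apply: H => //; near: t; exact: nbhs_pinfty_ge.
  split.
    have := bnd 1 ltr01; apply: filterS => t /andP[h1 h2].
    by rewrite ge0_fin_numE// (le_lt_trans h2)// ltry.
  apply/cvgrPdist_le => e e0; have := bnd e e0; apply: filterS => t /= /andP[h1 h2].
  rewrite sub0r normrN ger0_norm ?fine_ge0//.
  by rewrite -lee_fin fineK// ge0_fin_numE// (le_lt_trans h2)// ltry.
(* The three norms account for the distance from [x n] to [z n], the position inside the step and
   the drift error; the last term makes the inequalities of [enlargement] strict. *)
pose dl n := enorm (x n - z n) + enorm (x n.+1 - x n) + enorm (h n - v n) + n.+1%:R^-1.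
have dl0 : dl n @[n --> \oo] --> (0 : R).
  rewrite [X in _ --> X](_ : 0 = 0 + 0 + 0 + 0 :> R); last by rewrite !addr0.
  by apply: cvgD; [do 2 (apply: cvgD => //)|exact: cvg_harmonic].
exists (fun t => dl (step_index t)); split.
- by move=> t t0; rewrite !addr_ge0// ?enorm_ge0// invr_ge0.
- apply/cvgrPdist_le => e e0.
  have [n0 _ Hn] : \forall n \near \oo, `|0 - dl n| <= e by move/cvgrPdist_le : dl0; exact.
  near=> t; apply: Hn => /=; apply: index_ge => //.
have ctau : countable (range tau) by apply: sub_countable (card_image_le _ _) _.
(* The interpolation may have corners at the breakpoints, which form a countable, hence negligible,
   set. *)
exists (range tau); split.
- by apply: countable_measurable.
- exact: countable_lebesgue_measure0.
move=> t /= /not_implyP[t0]; apply: contra_notP => ntau.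
have /andP[it ti] := indexP tau_div (ltW t0).
have it' : tau (step_index t) < t.
  by rewrite lt_neqAle it andbT; apply/eqP => H; apply: ntau; exists (step_index t).
have itt : tau (step_index t) < t < tau (step_index t).+1 by rewrite it'.
have [dy ->] := interp_derive itt.
split => //; set n := step_index t in it ti it' *.
have n0 : 0 < n.+1%:R^-1 :> R by rewrite invr_gt0.
exists (z n); split.
  rewrite (@interpE n) ?it// (_ : _ - z n = (x n - z n) + (t - tau n) *: slope n); last first.
    by rewrite addrAC.
  rewrite (le_lt_trans (enormD _ _))// /dl -2!addrA ler_ltD//.
  rewrite (@le_lt_trans _ _ (enorm (x n.+1 - x n)))//; last by rewrite ltrDl ltr_wpDl// enorm_ge0.
  rewrite /slope scalerA enormZ ler_piMl ?enorm_ge0//.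
  have g0 := gamma_gt0 n.
  rewrite ger0_norm ?divr_ge0 ?subr_ge0// ?(ltW g0)//.
  by rewrite ler_pdivrMr// mul1r lerBlDl -tauS ltW.
rewrite /u subKr; apply: (@le_lt_trans _ _ (enorm (h n - v n))%:E).
  by apply: ereal_inf_lbound; exists (v n).
rewrite lte_fin /dl -addrA ltr_wpDl ?addr_ge0 ?enorm_ge0//.
by rewrite ltrDl.
Unshelve. all: by end_near. Qed.

End interpolation.

(** * One step of the projected algorithm *)

Section gradients.
Context {R : realType} {d : nat}.

Lemma grad_mean (N : nat) (f : 'I_N -> 'cV[R]_d -> R) x :
  (forall i, C1_on setT (f i)) ->
  grad (fun x => N%:R^-1 * \sum_(i < N) f i x) x =
  N%:R^-1 *: \sum_(i < N) grad (f i) x.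
Proof.
move=> fC1; apply/matrixP => k j; rewrite !mxE summxE.
have df i : derivable (f i : _ -> R^o) x (delta_mx k 0).
  by apply: diff_derivable; have [] := fC1 i x I.
have H i : is_derive x (delta_mx k 0) (f i : _ -> R^o) ('D_(delta_mx k 0) (f i : _ -> R^o) x).
  exact: derivableP.
have : is_derive x (delta_mx k 0) (N%:R^-1 *: (\sum_(i < N) (f i : 'cV[R]_d -> R^o)))
   (N%:R^-1 *: \sum_(i < N) 'D_(delta_mx k 0) (f i : _ -> R^o) x).
  by apply: is_deriveZ; apply: is_derive_sum.
move=> /@derive_val; rewrite (_ : N%:R^-1 *: _ = fun x => N%:R^-1 * \sum_(i < N) f i x).
  by move=> ->; congr (_ * _); apply: eq_bigr => i _; rewrite mxE.
by apply/funext => y; rewrite fctE /= fct_sumE.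
Qed.

Lemma continuous_enorm_bounded (g : 'cV[R]_d -> 'cV[R]_d) (G : set 'cV[R]_d) :
  compact G -> G !=set0 -> continuous g ->
  exists2 K, 0 <= K & forall x, G x -> enorm (g x) <= K.
Proof.
move=> kG G0 cg.
have cf : {within G, continuous (fun y => enorm (g y))}.
  apply: continuous_subspaceT => y.
  by apply: continuous_comp; [exact: cg|exact: enorm_continuous].
have [c _ cmax] := compact_EVT_max G0 kG cf.
by exists (enorm (g c)) => [|x Gx]; [exact: enorm_ge0|exact/cmax/mem_set].
Qed.

Lemma compact_enorm_bounded (G : set 'cV[R]_d) : compact G -> G !=set0 ->
  exists2 K, 0 <= K & forall x, G x -> enorm x <= K.
Proof. by move=> kG G0; apply: (@continuous_enorm_bounded id) => // x; exact: cvg_id. Qed.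

(** Heine's theorem for the Euclidean distance, from the covering form of compactness with a radius
    tending to zero as parameter. *)
Lemma compact_unif_continuous (g : 'cV[R]_d -> 'cV[R]_d) (G : set 'cV[R]_d) (e : R) :
  compact G -> continuous g -> 0 < e ->
  exists2 dl, 0 < dl & forall x y, G x -> G y -> enorm (x - y) < dl ->
    enorm (g x - g y) <= e.
Proof.
move=> /compact_near_coveringP kG cg e0.
pose Q (dl : R) x := forall y, enorm (x - y) < dl -> enorm (g x - g y) <= e.
have H x0 : G x0 -> \forall x \near x0 & dl \near (0 : R)^'+, Q dl x.
  move=> _.
  have cgx : enorm (g x0 - g y) @[y --> x0] --> enorm (g x0 - g x0).
    apply: continuous_comp; last exact: enorm_continuous.
    by apply: continuousB; [exact: cst_continuous|exact: cg].
  have e2 : 0 < e / 2 by rewrite divr_gt0.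
  have /nbhs_ballP[r /= r0 Hr] : \forall y \near x0, enorm (g x0 - g y) < e / 2.
    move: cgx; rewrite subrr enorm0 => /cvgrPdist_lt/(_ _ e2).
    by apply: filterS => y; rewrite sub0r normrN ger0_norm ?enorm_ge0.
  have r2 : 0 < r / 2 by rewrite divr_gt0.
  exists (ball x0 (r / 2), [set dl | dl < r / 2]) => /=.
    by split; [exact: nbhsx_ballx|exact: nbhs_right_lt].
  move=> [x dl] /= [x0x dlr] y xy.
  have Hx : ball x0 r x by apply: le_ball x0x; rewrite ler_pdivrMr// ler_pMr// ler1n.
  have Hy : ball x0 r y.
    rewrite (splitr r); apply: ball_triangle x0x _.
    by rewrite -ball_normE /=; apply: le_lt_trans (norm_le_enorm _) (lt_trans xy dlr).
  rewrite (le_trans (enorm_triangle (g x0) _ _))// (splitr e) lerD//.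
    by rewrite enormB ltW//; exact: Hr.
  by rewrite ltW//; exact: Hr.
have /= [dl0 dl00 Hdl] := kG R (0 : R)^'+ Q _ H.
exists (dl0 / 2); first by rewrite divr_gt0.
move=> x y Gx Gy xy; apply: (Hdl (dl0 / 2)) xy => //=.
  by rewrite sub0r normrN gtr0_norm ?divr_gt0// ltr_pdivrMr// ltr_pMr// ltr1n.
by rewrite divr_gt0.
Qed.

End gradients.

Section projection_step.
Context {R : realType} {N d : nat}.
Hypothesis N_gt0 : (0 < N)%N.
Variable G : set 'cV[R]_d.
Hypotheses (cG : cvx G) (G0 : G !=set0) (kG : compact G).
Implicit Types (x y z : 'cV[R]_d) (th Y : 'cV[R]_(N * d)) (g : R).

Lemma eprojG x : is_proj G x (eproj G x).
Proof. exact: eproj_is_proj. Qed.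

Lemma is_proj_min x y z : is_proj G x y -> G z -> enorm (x - y) <= enorm (x - z).
Proof.
move=> [Gy yP] Gz; rewrite -ler_sqr ?nnegrE ?enorm_ge0//.
have -> : x - z = (x - y) - (z - y) by rewrite opprB addrA subrK.
rewrite [leRHS]sqr_enormD dotvNr enormN.
have := yP _ Gz; have := sqr_ge0 (enorm (z - y)); lra.
Qed.

Definition proj_step th Y g := eproj (blockpow G) (th + g *: Y).

Lemma block_proj_step th Y g i :
  block (proj_step th Y g) i = eproj G (block th i + g *: block Y i).
Proof. by rewrite /proj_step eproj_blockpow// blockD blockZ. Qed.

Lemma proj_step_in th Y g : blockpow G (proj_step th Y g).
Proof. by move=> i; rewrite block_proj_step; have [] := eprojG (block th i + g *: block Y i). Qed.

Lemma avg_in th : blockpow G th -> G (avg th).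
Proof.
move=> Gth; rewrite /avg scaler_sumr; apply: cvx_sum => //.
by rewrite sumr_const card_ord -(mulr_natl N%:R^-1) divff// pnatr_eq0 -lt0n.
Qed.

Lemma proj_step_dist th Y g i : 0 <= g -> blockpow G th ->
  enorm (block (proj_step th Y g) i - block th i) <= g * enorm (block Y i).
Proof.
move=> g0 Gth; rewrite block_proj_step.
rewrite (le_trans (is_proj_lip (eprojG _) (is_proj_in (Gth i))))//.
by rewrite addrAC subrr add0r enormZ ger0_norm.
Qed.

(* The part of the averaged increment lost to the projection: a small perturbation
   of a normal vector of [G] at [avg th], by [dotv_proj_defect]. *)
Definition proj_defect th Y g : 'cV[R]_d :=
  avg Y - g^-1 *: (avg (proj_step th Y g) - avg th).

Lemma proj_defectE th Y g : 0 < g ->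
  proj_defect th Y g = \sum_i (g^-1 * N%:R^-1) *:
    ((block th i + g *: block Y i) - block (proj_step th Y g) i).
Proof.
move=> g0; rewrite -scaler_sumr -scalerA /proj_defect.
have -> : \sum_i (block th i + g *: block Y i - block (proj_step th Y g) i) =
    \sum_i block (th + g *: Y - proj_step th Y g) i.
  by apply: eq_bigr => i _; rewrite !blockD blockN blockZ.
rewrite -[X in _ = _ *: X]/(avg _) !avgD avgN avgZ.
move: (avg _) (avg _) (avg _) => u v w.
by apply/matrixP => a b; rewrite !mxE; field; rewrite gt_eqF.
Qed.

Lemma enorm_block_mean Y : N%:R^-1 * (\sum_i enorm (block Y i)) <= enorm Y.
Proof.
rewrite mulrC ler_pdivrMr ?ltr0n//.
rewrite (le_trans (ler_sum _ (fun i _ => enorm_block_le Y i)))//.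
by rewrite sumr_const card_ord -(mulr_natr (enorm Y)).
Qed.

(** Each block of [th] competes in the projection, so block i loses at most g |Y_i|; the factor g^-1
    cancels and the average of the |Y_i| is at most |Y|. The bound mu on the normal part originates
    here. *)
Lemma enorm_proj_defect th Y g : 0 < g -> blockpow G th ->
  enorm (proj_defect th Y g) <= enorm Y.
Proof.
move=> g0 Gth; rewrite proj_defectE// (le_trans (enorm_sum _ _))//.
apply: le_trans (enorm_block_mean Y); rewrite mulr_sumr ler_sum// => i _.
have gN : 0 <= g^-1 * N%:R^-1 by rewrite mulr_ge0// invr_ge0 ltW.
rewrite enormZ ger0_norm// block_proj_step.
have := is_proj_min (eprojG (block th i + g *: block Y i)) (Gth i).
rewrite [X in _ <= enorm X -> _]addrAC subrr add0r enormZ gtr0_norm//.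
move=> /(ler_wpM2l gN) /le_trans; apply.
rewrite le_eqVlt; apply/orP; left; apply/eqP; field.
by rewrite (gt_eqF g0) pnatr_eq0 -lt0n N_gt0.
Qed.

Definition deviation th : R := \sum_i enorm (block th i - avg th).

(** In block i the residual is exactly normal to [G] at the projected point b, so it pairs
    non-positively with z - b. The remainder pairs this residual, of size at most g |Y_i|, with b -
    avg th, of size at most the deviation plus g |Y|. *)
Lemma dotv_proj_defect th Y g z : 0 < g -> blockpow G th -> G z ->
  dotv (proj_defect th Y g) (z - avg th) <=
  deviation th * enorm Y + g * enorm Y ^+ 2.
Proof.
move=> g0 Gth Gz; rewrite proj_defectE// dotv_suml.
have gN : 0 <= g^-1 * N%:R^-1 by rewrite mulr_ge0// invr_ge0 ltW.
have bound i : dotv ((g^-1 * N%:R^-1) *: (block th i + g *: block Y i -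
     block (proj_step th Y g) i)) (z - avg th) <=
   N%:R^-1 * enorm (block Y i) * (deviation th + g * enorm Y).
  set b := block (proj_step th Y g) i; set r := block th i + g *: block Y i.
  have bP : is_proj G r b by rewrite /b block_proj_step; exact: eprojG.
  have -> : z - avg th = (z - b) + (b - avg th) by rewrite addrA subrK.
  rewrite dotvZl dotvDr.
  have h1 : dotv (r - b) (z - b) <= 0 by have [_] := bP; exact.
  have h2 : enorm (r - b) <= g * enorm (block Y i).
    have := is_proj_min bP (Gth i).
    by rewrite /r [X in _ <= enorm X -> _]addrAC subrr add0r enormZ gtr0_norm.
  have h3 : enorm (b - avg th) <= deviation th + g * enorm Y.
    rewrite (le_trans (enorm_triangle (block th i) _ _))// addrC lerD//.
      by rewrite /deviation (bigD1 i)//= lerDl sumr_ge0// => j _; exact: enorm_ge0.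
    rewrite (le_trans (proj_step_dist _ _ (ltW g0) Gth))//.
    by rewrite (ler_wpM2l (ltW g0))// enorm_block_le.
  have h4 := le_trans (dotv_le (r - b) (b - avg th))
    (ler_pM (enorm_ge0 _) (enorm_ge0 _) h2 h3).
  have h5 : dotv (r - b) (z - b) + dotv (r - b) (b - avg th) <=
    g * enorm (block Y i) * (deviation th + g * enorm Y) by lra.
  rewrite (le_trans (ler_wpM2l gN h5))//.
  rewrite le_eqVlt; apply/orP; left; apply/eqP.
  move: (enorm (block Y i)) (_ + _) => u v; field.
  by rewrite (gt_eqF g0) pnatr_eq0 -lt0n N_gt0.
rewrite (le_trans (ler_sum _ (fun i _ => bound i)))// -mulr_suml -mulr_sumr.
have dg : 0 <= deviation th + g * enorm Y.
  rewrite addr_ge0 ?mulr_ge0 ?enorm_ge0 ?(ltW g0)//.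
  by rewrite sumr_ge0// => j _; exact: enorm_ge0.
rewrite (le_trans (ler_wpM2r dg (enorm_block_mean Y)))//.
by rewrite le_eqVlt; apply/orP; left; apply/eqP; ring.
Qed.

(* A vector [v] which almost belongs to the normal cone at [x] is close to the
   normal vector [x + v - z] at the nearby point [z], the projection of [x + v]. *)
Lemma proj_normal x v z : G x -> is_proj G (x + v) z ->
  [/\ G z, normal_cone G z (x + v - z), enorm (x + v - z) <= enorm v &
      enorm (x - z) ^+ 2 <= dotv v (z - x)].
Proof.
move=> Gx zP; have [Gz zn] := zP; split => //.
- by move=> x' Gx'; rewrite -(opprB x' z) dotvNr oppr_ge0; exact: zn.
- by apply: le_trans (is_proj_min zP Gx) _; rewrite addrAC subrr add0r.
- have := zn _ Gx; rewrite addrAC dotvDl -(opprB x z) dotvNr sqr_enorm; lra.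
Qed.

End projection_step.

(** * Conditional expectations of vectors *)

Section vector_conditioning.
Context {disp : measure_display} {Omega : measurableType disp} {R : realType}.
Variable P : probability Omega R.
Variable d : nat.
Variable G : set (set Omega).
Hypothesis sG : <<s G >> `<=` measurable.
Implicit Types (D Z phi : Omega -> 'cV[R]_d) (beta V : Omega -> R).

Local Notation intg X := (P.-integrable setT (EFin \o X)).

(** Equality of conditional expectations in integrated form, so that no version has to be chosen;
    [condexp_le_cst] treats an upper bound in the same way. *)
Definition condexp_eq (X Y : Omega -> R) := forall A, <<s G >> A ->
  mean P (fun w => \1_A w * X w) = mean P (fun w => \1_A w * Y w).

Definition condexp_le_cst V (m : R) := forall A, <<s G >> A ->
  mean P (fun w => \1_A w * V w) <= m * mean P (\1_A).

Lemma gmeas_dotv D Z : (forall k, gmeas G (fun w => D w k 0)) ->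
  (forall k, gmeas G (fun w => Z w k 0)) -> gmeas G (fun w => dotv (D w) (Z w)).
Proof.
move=> mD mZ; rewrite /gmeas (_ : (fun w => _) = fun w => \sum_k D w k 0 * Z w k 0).
  by apply: measurable_sum => k; apply: measurable_funM; [exact: mD|exact: mZ].
by apply/funext => w; rewrite dotvE.
Qed.

Lemma gmeas_enorm D : (forall k, gmeas G (fun w => D w k 0)) ->
  gmeas G (fun w => enorm (D w)).
Proof.
move=> mD; rewrite /gmeas /enorm; apply: measurableT_comp; last exact: gmeas_dotv.
by apply: continuous_measurable_fun; exact: sqrt_continuous.
Qed.

(** Conditions a pointwise inequality whose coefficients [phi] and [beta] are known from the past:
    these factors come out of the conditional expectation, and [D], [V], [V2] are replaced by [Z],
    [m1], [m2]. *)
Lemma ae_dotv_condexp D Z phi beta V V2 (kap m1 m2 c c' : R) :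
  (forall k, intg (fun w => D w k 0)) -> (forall k, intg (fun w => Z w k 0)) ->
  (forall k, gmeas G (fun w => Z w k 0)) ->
  (forall k, condexp_eq (fun w => D w k 0) (fun w => Z w k 0)) ->
  (forall k, gmeas G (fun w => phi w k 0)) -> (forall k w, `|phi w k 0| <= c) ->
  gmeas G beta -> (forall w, 0 <= beta w <= c') -> 0 <= kap ->
  intg V -> intg V2 -> condexp_le_cst V m1 -> condexp_le_cst V2 m2 ->
  (forall w, dotv (D w) (phi w) <= beta w * V w + kap * V2 w) ->
  {ae P, forall w, dotv (Z w) (phi w) <= beta w * m1 + kap * m2}.
Proof.
move=> iD iZ mZ DZ mphi phic mb bc kap0 iV iV2 Vm V2m H.
pose rhs w := beta w * m1 + kap * m2.
pose eta w := dotv (Z w) (phi w) - rhs w.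
have mrhs : gmeas G rhs by apply: measurable_funD => //; exact: measurable_funM.
have meta : gmeas G eta by apply: measurable_funB => //; exact: gmeas_dotv.
(* The test event is the one where the conclusion fails: [eta] is positive there but has
   non-positive integral over it, so the event is negligible. *)
pose A := [set w | 0 < eta w].
have GA : <<s G >> A.
  rewrite (_ : A = eta @^-1` `]0, +oo[); first exact: gmeas_preimage.
  by apply/seteqP; split => w /=; rewrite in_itv/= andbT.
have mA := sG GA.
have b0 w : 0 <= beta w by case/andP: (bc w).
have bc' w : `|beta w| <= c' by rewrite ger0_norm//; case/andP: (bc w).
have mb' := gmeas_measurable sG mb.
have iphi (X : Omega -> 'cV[R]_d) k : intg (fun w => X w k 0) -> intg (fun w => phi w k 0 * X w k 0).
  by apply: (@intg_mulb _ _ _ P c) => //; exact: gmeas_measurable (mphi k).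
have idot (X : Omega -> 'cV[R]_d) : (forall k, intg (fun w => X w k 0)) -> intg (fun w => dotv (X w) (phi w)).
  move=> iX; rewrite (_ : (fun w => _) = fun w => \sum_k phi w k 0 * X w k 0).
    by apply: intg_sum => k; exact: iphi.
  by apply/funext => w; rewrite dotvE; apply: eq_bigr => k _; rewrite mulrC.
have irhs : intg rhs.
  apply: intgD; last exact: intg_cst.
  by apply: (@intg_mulb _ _ _ P c') => //; exact: intg_cst.
have ieta : intg eta by apply: intgB => //; exact: idot.
have mA1 : gmeas G (\1_A : Omega -> R) by exact: measurable_indic.
have A01 w := @indic01 _ Omega R A w.
have mdot (X : Omega -> 'cV[R]_d) : (forall k, intg (fun w => X w k 0)) ->
    mean P (fun w => \1_A w * dotv (X w) (phi w)) =
    \sum_k mean P (fun w => (\1_A w * phi w k 0) * X w k 0).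
  move=> iX; rewrite -mean_sum => [|k]; last first.
    have := intg_indic mA (iphi _ _ (iX k)); congr (P.-integrable _ _).
    by apply/funext => w /=; rewrite mulrA.
  congr mean; apply/funext => w; rewrite dotvE mulr_sumr; apply: eq_bigr => k _.
  by rewrite -mulrA [phi w k 0 * _]mulrC.
have key : mean P (fun w => \1_A w * eta w) <= 0.
  under eq_fun do rewrite mulrBr.
  rewrite meanB; [|by apply: intg_indic => //; exact: idot|exact: intg_indic].
  rewrite subr_le0 mdot//.
  have -> : \sum_k mean P (fun w => (\1_A w * phi w k 0) * Z w k 0) =
            \sum_k mean P (fun w => (\1_A w * phi w k 0) * D w k 0).
    apply: eq_bigr => k _; apply/esym; apply: (@mean_test_eq _ _ _ P G _ _ _ c) => //.
    - exact: DZ.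
    - by apply: measurable_funM => //; exact: mphi.
    - move=> w; have /andP[h0 h1] := A01 w.
      rewrite normrM (ger0_norm h0) (le_trans _ (phic k w))//.
      by rewrite ler_piMl.
  rewrite -mdot//.
  have iR : intg (fun w => beta w * V w + kap * V2 w).
    by apply: intgD; [exact: intg_mulb bc' _|exact: intgZ].
  apply: (@le_trans _ _ (mean P (fun w => \1_A w * (beta w * V w + kap * V2 w)))).
    apply: mean_le; [by apply: intg_indic => //; exact: idot|exact: intg_indic|].
    by move=> w; have /andP[h0 h1] := A01 w; rewrite ler_wpM2l.
  have E (f g : Omega -> R) : intg f -> intg g ->
      mean P (fun w => \1_A w * (beta w * f w + kap * g w)) =
      mean P (fun w => (\1_A w * beta w) * f w) + kap * mean P (fun w => \1_A w * g w).
    move=> jf jg; rewrite -meanZ; last exact: intg_indic.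
    rewrite -meanD.
    - by congr mean; apply/funext => w; ring.
    - have : intg (fun w => \1_A w * (beta w * f w)).
        by apply: intg_indic => //; exact: intg_mulb bc' _.
      by under eq_fun do rewrite mulrA.
    - by apply: intgZ; exact: intg_indic.
  rewrite E//.
  rewrite [leRHS](E (fun=> m1) (fun=> m2) (intg_cst P m1) (intg_cst P m2)).
  apply: lerD.
    apply: (@mean_test_le _ _ _ P G _ _ _ c') => //; first exact: intg_cst.
    - by move=> B GB; rewrite (le_trans (Vm B GB))// meanZr 1?mulrC//; apply: integrable_indic; exact: sG.
    - exact: measurable_funM.
    - move=> w; have /andP[h0 h1] := A01 w; rewrite mulr_ge0//=.
      by case/andP: (bc w) => b0' bc1; apply: le_trans bc1; rewrite ler_piMl.
  rewrite ler_wpM2l// (le_trans (V2m A GA))// meanZr 1?mulrC//; exact: integrable_indic.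
have X0 w : 0 <= \1_A w * eta w.
  rewrite indicE; have [|_] := boolP (w \in A); last by rewrite mul0r.
  by rewrite inE mul1r => /ltW.
have mX : measurable_fun setT (fun w => \1_A w * eta w).
  by apply: (gmeas_measurable sG); exact: measurable_funM.
have := mean_le0_ae mX X0 (intg_indic mA ieta) key; apply: filterS => w.
rewrite indicE; have [|nA] := boolP (w \in A).
  by rewrite inE mul1r => + e0; rewrite /A/= e0 ltxx.
move=> _; rewrite -subr_le0 leNgt; apply/negP => e0; move: nA; rewrite notin_setE; exact.
Qed.

(** Pairing [D] with its own conditional expectation gives |Z|^2 <= m |Z|. The version is finally
    set to zero on the null set where the bound fails, so that it holds surely. *)
Lemma condexp_bounded D V (m : R) : (forall k, intg (fun w => D w k 0)) ->
  intg V -> 0 <= m -> condexp_le_cst V m -> (forall w, enorm (D w) <= V w) ->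
  exists Z : Omega -> 'cV[R]_d, [/\ (forall k, gmeas G (fun w => Z w k 0)),
    (forall w, enorm (Z w) <= m) &
    (forall k, condexp_eq (fun w => D w k 0) (fun w => Z w k 0))].
Proof.
move=> iD iV m0 Vm DV.
have [z Hz] := choice (fun k => condexp_exists sG (iD k)).
pose Z0 w : 'cV[R]_d := \col_k z k w.
have Z0E k : (fun w => Z0 w k 0) = z k by apply/funext => w; rewrite mxE.
have mZ0 k : gmeas G (fun w => Z0 w k 0) by rewrite Z0E; have [] := Hz k.
have iZ0 k : intg (fun w => Z0 w k 0) by rewrite Z0E; have [] := Hz k.
have cZ0 k : condexp_eq (fun w => D w k 0) (fun w => Z0 w k 0).
  by rewrite Z0E; have [] := Hz k.
have mN : gmeas G (fun w => enorm (Z0 w)) by exact: gmeas_enorm.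
have mB (l : R) : <<s G >> [set w | enorm (Z0 w) <= l].
  rewrite (_ : [set w | _] = (fun w => enorm (Z0 w)) @^-1` `]-oo, l]).
    exact: gmeas_preimage.
  by apply/seteqP; split => w /=; rewrite in_itv.
have mI l : gmeas G (\1_[set w | enorm (Z0 w) <= l] : Omega -> R).
  by apply: measurable_indic; exact: mB.
have step (l : nat) : {ae P, forall w, enorm (Z0 w) <= l%:R -> enorm (Z0 w) <= m}.
  (* Tests must be bounded, so [Z0] is truncated at level [l]; each sample point is covered by some
     [l] afterwards. *)
  pose phi w : 'cV[R]_d := \1_[set u | enorm (Z0 u) <= l%:R] w *: Z0 w.
  have phil w : enorm (phi w) <= l%:R.
    rewrite /phi indicE; case: (boolP (w \in _)) => [|_].
      by rewrite inE /= scale1r.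
    by rewrite scale0r enorm0 ler0n.
  have mphi k : gmeas G (fun w => phi w k 0).
    rewrite (_ : (fun w => _) = fun w => \1_[set u | enorm (Z0 u) <= l%:R] w * Z0 w k 0).
      by apply: measurable_funM; [exact: mI|exact: mZ0].
    by apply/funext => w; rewrite mxE.
  have := @ae_dotv_condexp D Z0 phi (fun w => enorm (phi w)) V V 0 m m l%:R l%:R.
  have phik k w : `|phi w k 0| <= l%:R by exact: le_trans (coord_le_enorm _ _) (phil w).
  move=> /(_ iD iZ0 mZ0 cZ0 mphi phik (gmeas_enorm mphi)).
  move=> /(_ (fun w => _) (lexx 0) iV iV Vm Vm).
  have e0l w : 0 <= enorm (phi w) <= l%:R by rewrite enorm_ge0 phil.
  move=> /(_ e0l) [|B].
    move=> w; rewrite mul0r addr0 (le_trans (dotv_le _ _))// mulrC.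
    by rewrite ler_wpM2l ?enorm_ge0.
  move=> HB; exists B; move: HB => [mB' B0 sub]; split => // w /= nH; apply: sub => /= H.
  apply: nH => Hl; move: H; rewrite mul0r addr0 /phi indicE mem_set//= scale1r.
  rewrite -sqr_enorm expr2; have [->//|n0] := eqVneq (enorm (Z0 w)) 0.
  by rewrite ler_pM2l// lt_neqAle eq_sym n0 enorm_ge0.
have aeZ : {ae P, forall w, enorm (Z0 w) <= m}.
  have := ae_foralln step; apply: filterS => w H.
  by apply: (H (Num.truncn (enorm (Z0 w))).+1); rewrite ltW// truncnS_gt.
exists (fun w => \1_[set u | enorm (Z0 u) <= m] w *: Z0 w).
have mZ k : gmeas G (fun w => (\1_[set u | enorm (Z0 u) <= m] w *: Z0 w) k 0).
  rewrite (_ : (fun w => _) = fun w => \1_[set u | enorm (Z0 u) <= m] w * Z0 w k 0).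
    by apply: measurable_funM; [exact: mI|exact: mZ0].
  by apply/funext => w; rewrite mxE.
split => // [w|k A GA].
  rewrite indicE; case: (boolP (w \in _)) => [|_]; first by rewrite inE /= scale1r.
  by rewrite scale0r enorm0.
rewrite cZ0//; have mA := sG GA; apply: mean_ae.
- apply: measurable_funM; first exact: measurable_indic.
  exact: gmeas_measurable (mZ0 k).
- apply: measurable_funM; first exact: measurable_indic.
  exact: gmeas_measurable (mZ k).
- apply: filterS aeZ => w Zm; congr (_ * _).
  by rewrite indicE mem_set//= scale1r.
Qed.

End vector_conditioning.

Section spectral.
Context {R : realType} {N : nat}.
Implicit Types (A : 'M[R]_N) (x : 'cV[R]_N).

(** Crude, but it shows that the set defining [spectral_norm] is bounded, so that its supremum is an
    upper bound. *)
Lemma enorm_mulmx_le A x :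
  enorm (A *m x) <= (\sum_i \sum_j `|A i j|) * enorm x.
Proof.
rewrite (le_trans (enorm_le_sum _))// mulr_suml ler_sum// => i _.
rewrite mxE (le_trans (ler_norm_sum _ _ _))// mulr_suml ler_sum// => j _.
by rewrite normrM ler_wpM2l// coord_le_enorm.
Qed.

Lemma spectral_norm_ub A x : enorm x <= 1 -> enorm (A *m x) <= spectral_norm A.
Proof.
move=> x1; apply: sup_upper_bound; last by exists x.
split; first by exists (enorm (A *m x)), x.
exists (\sum_i \sum_j `|A i j|) => _ [z /= z1 <-].
rewrite (le_trans (enorm_mulmx_le _ _))// ler_piMr//.
by rewrite sumr_ge0// => i _; rewrite sumr_ge0.
Qed.

Lemma spectral_norm_ge0 A : 0 <= spectral_norm A.
Proof.
apply: le_trans (@spectral_norm_ub A 0 _); first exact: enorm_ge0.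
by rewrite enorm0.
Qed.

Lemma spectral_norm_le A x : enorm (A *m x) <= spectral_norm A * enorm x.
Proof.
have [x0|x0] := eqVneq (enorm x) 0.
  by rewrite (enorm_eq0 x0) mulmx0 enorm0 mulr0.
have xp : 0 < enorm x by rewrite lt_neqAle eq_sym x0 enorm_ge0.
have := @spectral_norm_ub A ((enorm x)^-1 *: x).
rewrite -scalemxAr !enormZ gtr0_norm ?invr_gt0// mulVf// => /(_ (lexx _)).
by rewrite mulrC ler_pdivrMr.
Qed.

End spectral.

Section columns.
Context {R : realType} {N d : nat}.
Hypothesis N_gt0 : (0 < N)%N.
Implicit Types (x y : 'cV[R]_(N * d)).

(** One coordinate followed across all agents: on such vectors [W *t 1%:M] acts as [W]
    ([column_tens]), so the estimates on N by N matrices apply coordinatewise. *)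
Definition column x (k : 'I_d) : 'cV[R]_N := \col_i block x i k 0.

Definition disagreement x : R := \sum_k enorm (centering *m column x k) ^+ 2.

Lemma disagreement_ge0 x : 0 <= disagreement x.
Proof. by rewrite sumr_ge0// => k _; exact: sqr_ge0. Qed.

Lemma disagreementE x : disagreement x = \sum_i enorm (block x i - avg x) ^+ 2.
Proof.
rewrite /disagreement; under eq_bigr do rewrite sqr_enormE.
under [RHS]eq_bigr do rewrite sqr_enormE.
rewrite exchange_big; apply: eq_bigr => i _; apply: eq_bigr => k _; congr (_ ^+ 2).
rewrite centeringE mxE [RHS]mxE [X in _ = _ + X]mxE avgE; congr (_ - _ * _).
by apply: eq_bigr => j _; rewrite mxE.
Qed.

Lemma sum_sqr_le (a : 'I_N -> R) : (\sum_i a i) ^+ 2 <= N%:R * \sum_i a i ^+ 2.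
Proof.
pose v : 'cV[R]_N := \col_i a i.
have -> : \sum_i a i = dotv ones v.
  by rewrite dotvE; apply: eq_bigr => i _; rewrite !mxE mul1r.
have -> : \sum_i a i ^+ 2 = enorm v ^+ 2.
  by rewrite sqr_enormE; apply: eq_bigr => i _; rewrite mxE.
have -> : N%:R = enorm (ones : 'cV[R]_N) ^+ 2.
  rewrite sqr_enormE (eq_bigr (fun=> 1)) ?sumr_const ?card_ord//.
  by move=> i _; rewrite mxE expr1n.
by rewrite -exprMn -(real_normK (num_real (dotv _ _))) lerXn2r ?nnegrE ?mulr_ge0 ?enorm_ge0// normr_dotv_le.
Qed.

Lemma sqr_deviation_le x : deviation x ^+ 2 <= N%:R * disagreement x.
Proof. by rewrite disagreementE sum_sqr_le. Qed.

Lemma sum_sqr_column x : \sum_k enorm (column x k) ^+ 2 = enorm x ^+ 2.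
Proof.
rewrite sqr_enorm_block; under eq_bigr do rewrite sqr_enormE.
under [RHS]eq_bigr do rewrite sqr_enormE.
by rewrite exchange_big; apply: eq_bigr => i _; apply: eq_bigr => k _; rewrite mxE.
Qed.

Lemma column_tens (W : 'M[R]_N) x k :
  column ((W *t 1%:M) *m x) k = W *m column x k.
Proof.
apply/matrixP => i j; rewrite ord1 mxE block_tens summxE mxE.
by apply: eq_bigr => l _; rewrite !mxE.
Qed.

Lemma columnD x y k : column (x + y) k = column x k + column y k.
Proof. by apply/matrixP => i j; rewrite !mxE. Qed.

(** Young's inequality. The weight [e] stays free because it is later taken proportional to the
    contraction gap 1 - rho. *)
Lemma disagreementD_le x y (e : R) : 0 < e ->
  disagreement (x + y) <= (1 + e) * disagreement x + (1 + e^-1) * enorm y ^+ 2.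
Proof.
move=> e0; rewrite -sum_sqr_column !mulr_sumr -big_split/= ler_sum// => k _.
rewrite columnD mulmxDr sqr_enormD.
have h1 := dotv_le (centering *m column x k) (centering *m column y k).
have h2 := enorm_centering_le N_gt0 (column y k).
have h3 := enorm_ge0 (centering *m column x k).
have h4 := enorm_ge0 (centering *m column y k).
set u := enorm (_ *m column x k) in h1 h3 *; set v := enorm (_ *m column y k) in h1 h2 h4 *.
set t := dotv _ _ in h1 *; set s := enorm (column y k) in h2 *.
clearbody u v t s.
have h5 : 2 * (u * v) <= e * u ^+ 2 + e^-1 * v ^+ 2.
  have := sqr_ge0 (e * u - v) => H.
  rewrite -(ler_pM2l e0) mulrDr !mulrA divff ?gt_eqF// mul1r.
  by move: H; rewrite sqrrB exprMn; lra.
have ei : 0 <= 1 + e^-1 by rewrite addr_ge0// invr_ge0 ltW.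
have h6 : (1 + e^-1) * v ^+ 2 <= (1 + e^-1) * s ^+ 2.
  by rewrite ler_wpM2l// lerXn2r// ?nnegrE// (le_trans h4).
lra.
Qed.

End columns.

Section vector_measurability.
Context {R : realType}.

Lemma measurable_continuous_coord d (T : measurableType d) (n : nat)
    (X : T -> 'cV[R]_n) (g : 'cV[R]_n -> R) :
  (forall k, measurable_fun setT (fun t => X t k 0)) -> continuous g ->
  measurable_fun setT (fun t => g (X t)).
Proof.
move=> mX cg; apply: (measurableT_comp (continuous_mx_measurable cg)).
by apply: measurable_mx => i j; rewrite ord1; exact: mX.
Qed.

Lemma eproj_coord_continuous (n : nat) (G : set 'cV[R]_n) k :
  cvx G -> G !=set0 -> compact G -> continuous (fun x => eproj G x k 0).
Proof.
move=> cG G0 kG; apply: enorm_lip_continuous => u v.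
have := coord_le_enorm (eproj G u - eproj G v) k; rewrite !mxE => /le_trans; apply.
by apply: is_proj_lip (eproj_is_proj _ cG G0 kG) (eproj_is_proj _ cG G0 kG).
Qed.

Lemma measurable_eproj d (T : measurableType d) (n : nat) (G : set 'cV[R]_n)
    (X : T -> 'cV[R]_n) k : cvx G -> G !=set0 -> compact G ->
  (forall k, measurable_fun setT (fun t => X t k 0)) ->
  measurable_fun setT (fun t => eproj G (X t) k 0).
Proof.
by move=> cG G0 kG mX; exact: (measurable_continuous_coord mX (@eproj_coord_continuous n G k cG G0 kG)).
Qed.

Lemma measurable_proj_step d' (T : measurableType d') (N d : nat) (G : set 'cV[R]_d)
    (X Y : T -> 'cV[R]_(N * d)) (g : R) i k : cvx G -> G !=set0 -> compact G ->
  (forall l, measurable_fun setT (fun t => X t l 0)) ->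
  (forall l, measurable_fun setT (fun t => Y t l 0)) ->
  measurable_fun setT (fun t => block (proj_step G (X t) (Y t) g) i k 0).
Proof.
move=> cG G0 kG mX mY; under eq_fun do rewrite block_proj_step//.
apply: measurable_eproj => // k'.
under eq_fun do rewrite !mxE.
by apply: measurable_funD => //; apply: measurable_funM.
Qed.

End vector_measurability.

(** * Mean contraction and noise of a single step *)

Section one_step.
Context {disp : measure_display} {Omega : measurableType disp} {R : realType}.
Variable P : probability Omega R.
Variables (N d : nat).
Hypothesis N_gt0 : (0 < N)%N.
Variables (f : 'I_N -> 'cV[R]_d -> R) (C : set 'cV[R]_d) (K Kg m1 m2 g : R).
Variables (H : set (set Omega)) (th th' Y : Omega -> 'cV[R]_(N * d)) (W : Omega -> 'M[R]_N).
Hypotheses (cC : cvx C) (C0 : C !=set0) (kC : compact C).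
Hypotheses (K0 : 0 <= K) (CK : forall x, C x -> enorm x <= K).
Hypotheses (Kg0 : 0 <= Kg) (fKg : forall i x, C x -> enorm (grad (f i) x) <= Kg).
Hypothesis fC1 : forall i, C1_on setT (f i).
Hypotheses (m1_ge0 : 0 <= m1) (m2_ge0 : 0 <= m2) (g_gt0 : 0 < g).
Hypothesis sH : <<s H >> `<=` measurable.
Hypothesis mth : gmeas H th.
Hypothesis thC : forall w, blockpow C (th w).
Hypotheses (mY : measurable_fun setT Y) (mW : measurable_fun setT W).
Hypothesis W0 : forall w i j, 0 <= W w i j.
Hypothesis W1 : forall w, W w *m ones = ones.
Hypothesis Wmean : ones^T *m Emx P W = ones^T.
Hypothesis Windep : forall A E, measurable A -> <<s joint_gen H Y >> E ->
  mean P (fun w => \1_(W @^-1` A) w * \1_E w) =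
  mean P (\1_(W @^-1` A)) * mean P (\1_E).
Hypothesis th'E : forall w, th' w = (W w *t 1%:M) *m proj_step C (th w) (Y w) g.

Local Notation intg X := (P.-integrable setT (EFin \o X)).

Hypothesis iY2 : intg (fun w => enorm (Y w) ^+ 2).
Hypothesis Ym1 : condexp_le_cst P H (fun w => enorm (Y w)) m1.
Hypothesis Ym2 : condexp_le_cst P H (fun w => enorm (Y w) ^+ 2) m2.
Hypothesis Ymean : forall l, condexp_eq P H (fun w => Y w l 0)
  (fun w => (- stack (fun i => grad (f i) (block (th w) i))) l 0).

Local Notation J := (joint_gen H Y).
(** The projected point before mixing. It depends on the past and [Y] only, hence is independent of
    [W]. *)
Let b w := proj_step C (th w) (Y w) g.

Let sJ : <<s J >> `<=` measurable.
Proof. exact: joint_gen_measurable. Qed.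

Let HJ : <<s H >> `<=` <<s J >>.
Proof. by move=> A HA; apply: sub_sigma_algebra; left. Qed.

Let mthl l : gmeas H (fun w => th w l 0).
Proof. exact: (measurable_fun_coord (T := g_sigma_algebraType H)). Qed.

Let mthJ l : gmeas J (fun w => th w l 0).
Proof. exact: gmeas_sub HJ (mthl l). Qed.

Let mYJ l : gmeas J (fun w => Y w l 0).
Proof.
apply: (measurable_fun_coord (T := g_sigma_algebraType J)).
by move=> _ B mB; apply: sub_sigma_algebra; right; exists B.
Qed.

Let mYl l : measurable_fun setT (fun w => Y w l 0).
Proof. exact: measurable_fun_coord. Qed.

Let mb i k : gmeas J (fun w => block (b w) i k 0).
Proof. exact: (measurable_proj_step (T := g_sigma_algebraType J)). Qed.

Let bC w : blockpow C (b w).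
Proof. exact: proj_step_in. Qed.

Let bK w i k : `|block (b w) i k 0| <= K.
Proof. by rewrite (le_trans (coord_le_enorm _ _))// CK//; exact: bC. Qed.

Let mblock i k : gmeas H (fun w => block (th w) i k 0).
Proof. by rewrite /gmeas; under eq_fun do rewrite blockE; exact: mthl. Qed.

Let mavg k : gmeas H (fun w => avg (th w) k 0).
Proof.
rewrite /gmeas; under eq_fun do rewrite avgE.
by apply: measurable_funM => //; apply: measurable_sum => i; exact: mblock.
Qed.

Let thK w i k : `|block (th w) i k 0| <= K.
Proof. by rewrite (le_trans (coord_le_enorm _ _))// CK//; exact: thC. Qed.

Let W01 w i j : 0 <= W w i j <= 1.
Proof.
rewrite W0/=; have /matrixP/(_ i 0) := W1 w; rewrite !mxE => <-.
rewrite (bigD1 j)//= mxE mulr1 lerDl sumr_ge0// => l _.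
by rewrite mxE mulr1.
Qed.

Let mWij i j : measurable_fun setT (fun w => W w i j).
Proof. exact: measurable_fun_coord. Qed.

Let iWij i j : intg (fun w => W w i j).
Proof. by apply: (@intg_bdd _ _ _ P 1) => // w; have /andP[h0 h1] := W01 w i j; rewrite ger0_norm. Qed.

Lemma EmxE m n (M : Omega -> 'M[R]_(m, n)) i j : Emx P M i j = mean P (fun w => M w i j).
Proof. by rewrite mxE unlock. Qed.

Lemma block_step w i : block (th' w) i = \sum_j W w i j *: block (b w) j.
Proof. by rewrite th'E block_tens. Qed.

Lemma step_in w : blockpow C (th' w).
Proof.
move=> i; rewrite block_step; apply: cvx_sum => // [|j]; last exact: bC.
have /matrixP/(_ i 0) := W1 w; rewrite !mxE => <-.
by apply: eq_bigr => j _; rewrite mxE mulr1.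
Qed.

Let disp_bdd (x : 'cV[R]_(N * d)) : blockpow C x -> 0 <= disagreement x <= d%:R * ((N%:R * K) ^+ 2).
Proof.
move=> Cx; rewrite disagreement_ge0/= /disagreement.
have : forall k, enorm (centering *m column x k) ^+ 2 <= (N%:R * K) ^+ 2.
  move=> k; rewrite lerXn2r ?nnegrE ?mulr_ge0 ?enorm_ge0//.
  rewrite (le_trans (enorm_centering_le _ _))//; apply: enorm_le_coord => i.
  by rewrite mxE (le_trans (coord_le_enorm _ _))// CK//; exact: Cx.
move=> h; rewrite (le_trans (ler_sum _ (fun k _ => h k)))//.
by rewrite sumr_const card_ord [leRHS]mulr_natl.
Qed.

Let mdisp d0 (T : measurableType d0) (X : T -> 'cV[R]_(N * d)) :
  (forall i k, measurable_fun setT (fun t => block (X t) i k 0)) ->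
  measurable_fun setT (fun t => disagreement (X t)).
Proof.
move=> mX; apply: measurable_sum => k; apply: measurable_funX.
apply: (measurable_continuous_coord (X := fun t => centering *m column (X t) k) (g := @enorm R N)).
  move=> i; under eq_fun do rewrite centeringE mxE.
  apply: measurable_funB; first exact: mX.
  apply: measurable_funM => //; apply: measurable_sum => j.
  by under eq_fun do rewrite mxE; exact: mX.
exact: enorm_continuous.
Qed.

Let mblock' i k : measurable_fun setT (fun w => block (th w) i k 0).
Proof. exact: gmeas_measurable (mblock i k). Qed.

Let mb' i k : measurable_fun setT (fun w => block (b w) i k 0).
Proof. exact: gmeas_measurable (mb i k). Qed.

Lemma step_measurable i k : measurable_fun setT (fun w => block (th' w) i k 0).
Proof.
under eq_fun do rewrite block_step summxE.
apply: measurable_sum => j; under eq_fun do rewrite mxE.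
by apply: measurable_funM.
Qed.

Let idisp (X : Omega -> 'cV[R]_(N * d)) :
  (forall i k, measurable_fun setT (fun t => block (X t) i k 0)) ->
  (forall w, blockpow C (X w)) -> intg (fun w => disagreement (X w)).
Proof.
move=> mX CX; apply: (intg_bdd P (c := d%:R * ((N%:R * K) ^+ 2))) => [|w]; first exact: mdisp.
by have /andP[h0 h1] := disp_bdd (CX w); rewrite ger0_norm.
Qed.

(** Independence is applied entry by entry: the coordinates of [c] are known before [W] is drawn, so
    the random matrix may be replaced by its mean, whose spectral norm bounds the form. The entries
    of [W] lie in [0, 1], which keeps all factors bounded. *)
Let mean_Wquad (c : Omega -> 'cV[R]_N) (B : R) :
  (forall i, gmeas J (fun w => c w i 0)) -> (forall i w, `|c w i 0| <= B) ->
  mean P (fun w => dotv (c w) (((W w)^T *m centering *m W w) *m c w)) <=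
  spectral_norm (Emx P (fun w => (W w)^T *m centering *m W w)) *
  mean P (fun w => enorm (c w) ^+ 2).
Proof.
move=> mc cB; pose M (A : 'M[R]_N) := A^T *m centering *m A.
have ME A i j : M A i j = \sum_l (\sum_l' A l' i * centering l' l) * A l j.
  rewrite /M mxE; apply: eq_bigr => l _; rewrite mxE; congr (_ * _).
  by apply: eq_bigr => l' _; rewrite mxE.
have mM i j : measurable_fun setT (fun A => M A i j).
  under eq_fun do rewrite ME; apply: measurable_sum => l.
  apply: measurable_funM; last exact: measurable_coord.
  by apply: measurable_sum => l'; apply: measurable_funM => //; exact: measurable_coord.
pose BM : R := \sum_(l < N) \sum_(l' < N) `|(centering : 'M[R]_N) l' l|.
have MB i j w : `|M (W w) i j| <= BM.
  rewrite ME (le_trans (ler_norm_sum _ _ _))// ler_sum// => l _.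
  have /andP[h0 h1] := W01 w l j.
  rewrite normrM (ger0_norm h0) (le_trans (ler_piMr _ h1))//.
  rewrite (le_trans (ler_norm_sum _ _ _))// ler_sum// => l' _.
  have /andP[h2 h3] := W01 w l' i.
  by rewrite normrM (ger0_norm h2) ler_piMl.
have mMW i j : measurable_fun setT (fun w => M (W w) i j) by exact: measurableT_comp (mM i j) mW.
have mc' i : measurable_fun setT (fun w => c w i 0) by exact: gmeas_measurable (mc i).
have mcc i j : gmeas J (fun w => c w i 0 * c w j 0) by apply: measurable_funM; exact: mc.
have ccB i j w : `|c w i 0 * c w j 0| <= B * B by rewrite normrM ler_pM.
have icc i j : intg (fun w => c w i 0 * c w j 0).
  by apply: (intg_bdd P (c := B * B)) => //; exact: measurable_funM.
have iMc i j : intg (fun w => M (W w) i j * (c w i 0 * c w j 0)).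
  by apply: (intg_mulb (c := BM)).
have quadE (A : 'M[R]_N) (u : 'cV[R]_N) :
    dotv u (A *m u) = \sum_i \sum_j A i j * (u i 0 * u j 0).
  rewrite dotvE; apply: eq_bigr => i _; rewrite mxE mulr_sumr; apply: eq_bigr => j _.
  by rewrite mulrCA.
have ic2 : intg (fun w => enorm (c w) ^+ 2).
  under eq_fun do rewrite sqr_enormE; apply: intg_sum => i.
  by have := icc i i; congr (P.-integrable _ _).
pose E := Emx P (fun w => M (W w)).
have -> : mean P (fun w => dotv (c w) (M (W w) *m c w)) = mean P (fun w => dotv (c w) (E *m c w)).
  under eq_fun do rewrite quadE.
  under [in RHS]eq_fun do rewrite quadE.
  rewrite !mean_sum; last first.
  - by move=> i; apply: intg_sum => j; exact: iMc.
  - by move=> i; apply: intg_sum => j; exact: intgZ.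
  apply: eq_bigr => i _; rewrite !mean_sum; last first.
  - by move=> j; exact: iMc.
  - by move=> j; exact: intgZ.
  apply: eq_bigr => j _; rewrite meanZ// /E EmxE.
  exact: (@mean_indep _ _ _ P J _ _ W (fun A => M A i j) (fun w => c w i 0 * c w j 0)
    BM (B * B) sJ mW Windep (mM i j) (MB i j) (mcc i j) (ccB i j)).
rewrite -meanZ//; apply: mean_le.
- by under eq_fun do rewrite quadE; apply: intg_sum => i; apply: intg_sum => j; exact: intgZ.
- exact: intgZ.
move=> w; rewrite (le_trans (dotv_le _ _))//.
have := spectral_norm_le E (c w) => /(ler_wpM2l (enorm_ge0 (c w))) /le_trans; apply.
by rewrite mulrCA -expr2.
Qed.

(** Mixing contracts the disagreement of the projected point, and that point differs from [th] by at
    most g |Y_i| in block i, since [th] is already in the set and projections are non-expansive. *)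
Lemma mean_disagreement_step e : 0 < e ->
  mean P (fun w => disagreement (th' w)) <=
  spectral_norm (Emx P (fun w => (W w)^T *m centering *m W w)) *
   ((1 + e) * mean P (fun w => disagreement (th w)) + (1 + e^-1) * (g ^+ 2 * m2)).
Proof.
move=> e0; set r := spectral_norm _.
have ib : intg (fun w => disagreement (b w)) by apply: idisp.
have ith : intg (fun w => disagreement (th w)) by apply: idisp.
have mcent i k : gmeas J (fun w => (centering *m column (b w) k) i 0).
  rewrite /gmeas; under eq_fun do rewrite centeringE mxE.
  apply: measurable_funB; first exact: mb.
  apply: measurable_funM => //; apply: measurable_sum => j.
  by under eq_fun do rewrite mxE; exact: mb.
have bcent i k w : `|(centering *m column (b w) k) i 0| <= N%:R * K.
  rewrite (le_trans (coord_le_enorm _ _))// (le_trans (enorm_centering_le N_gt0 _))//.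
  by apply: enorm_le_coord => j; rewrite mxE; exact: bK.
have mcent' i k : measurable_fun setT (fun w => (centering *m column (b w) k) i 0).
  exact: gmeas_measurable (mcent i k).
have icent k : intg (fun w => enorm (centering *m column (b w) k) ^+ 2).
  under eq_fun do rewrite sqr_enormE; apply: intg_sum => i.
  apply: (intg_bdd P (c := (N%:R * K) ^+ 2)); first exact: measurable_funX.
  by move=> w; rewrite normrX lerXn2r ?nnegrE ?mulr_ge0.
apply: (@le_trans _ _ (r * mean P (fun w => disagreement (b w)))).
  rewrite /disagreement mean_sum => [|k]; last first.
    apply: (intg_bdd P (c := (N%:R * K) ^+ 2)).
      apply: measurable_funX.
      apply: (measurable_continuous_coord (X := fun t => centering *m column (th' t) k) (g := @enorm R N)).
        move=> i; under eq_fun do rewrite centeringE mxE.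
        apply: measurable_funB; first exact: step_measurable.
        apply: measurable_funM => //; apply: measurable_sum => j.
        by under eq_fun do rewrite mxE; exact: step_measurable.
      exact: enorm_continuous.
    move=> w; rewrite normrX lerXn2r ?nnegrE ?mulr_ge0// ger0_norm ?enorm_ge0//.
    rewrite (le_trans (enorm_centering_le N_gt0 _))//; apply: enorm_le_coord => i.
    by rewrite mxE (le_trans (coord_le_enorm _ _))// CK//; exact: step_in.
  rewrite mean_sum// mulr_sumr ler_sum// => k _.
  under eq_fun do rewrite th'E column_tens sqr_enorm_centering_mul//.
  exact: (@mean_Wquad (fun w => centering *m column (b w) k) (N%:R * K) (fun i => mcent i k) (fun i => bcent i k)).
rewrite ler_wpM2l ?spectral_norm_ge0// -meanZ//.
have igY : intg (fun w => (1 + e^-1) * (g ^+ 2 * enorm (Y w) ^+ 2)) by do 2 apply: intgZ.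
apply: (@le_trans _ _ (mean P (fun w => (1 + e) * disagreement (th w) +
     (1 + e^-1) * (g ^+ 2 * enorm (Y w) ^+ 2)))).
  apply: mean_le => // [|w]; first by apply: intgD => //; exact: intgZ.
  have -> : b w = th w + (b w - th w) by rewrite addrC subrK.
  rewrite (le_trans (disagreementD_le N_gt0 _ _ e0))// lerD2l.
  rewrite ler_wpM2l ?addr_ge0 ?invr_ge0 ?(ltW e0)//.
  rewrite -exprMn !exprMn !sqr_enorm_block mulr_sumr ler_sum// => i _.
  rewrite -exprMn lerXn2r ?nnegrE ?enorm_ge0 ?mulr_ge0 ?enorm_ge0 ?(ltW g_gt0)//.
  by rewrite blockD blockN; apply: proj_step_dist => //; exact: ltW.
rewrite meanD//; last exact: intgZ.
rewrite lerD2l 2?meanZ//; [|exact: intgZ].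
rewrite ler_wpM2l ?addr_ge0 ?invr_ge0 ?(ltW e0)//.
rewrite ler_wpM2l ?sqr_ge0//.
have HT : <<s H >> setT by exact: (@measurableT _ (g_sigma_algebraType H)).
have := Ym2 HT; rewrite indicT mean_cst mulr1.
by under eq_fun do rewrite mul1r.
Qed.

Let iY : intg (fun w => enorm (Y w)).
Proof.
apply: (@le_intg _ _ _ P _ (fun w => 1 + enorm (Y w) ^+ 2)).
- apply: (measurable_continuous_coord (X := Y) (g := @enorm R (N * d))) => //.
  exact: enorm_continuous.
- by apply: intgD => //; exact: intg_cst.
- move=> w; rewrite ger0_norm ?enorm_ge0//.
  have := sqr_ge0 (enorm (Y w) - 1); have := enorm_ge0 (Y w).
  by move: (enorm (Y w)) => y y0; rewrite sqrrB1; lra.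
Qed.

Let iYl l : intg (fun w => Y w l 0).
Proof. by apply: le_intg iY _ => // w; exact: coord_le_enorm. Qed.

Let mgrad i k : gmeas H (fun w => grad (f i) (block (th w) i) k 0).
Proof.
apply: (measurable_continuous_coord (T := g_sigma_algebraType H)
  (X := fun w => block (th w) i) (g := fun x => grad (f i) x k 0)) => [k'|x].
  exact: mblock.
have [_ cg] := @fC1 i x I.
by apply: (@continuous_comp _ _ _ (grad (f i)) (fun z : 'cV[R]_d => z k 0)) => //; exact: coord_continuous.
Qed.

Definition mean_grad w : 'cV[R]_d := N%:R^-1 *: \sum_i grad (f i) (block (th w) i).

Let mean_grad_le w : enorm (mean_grad w) <= Kg.
Proof.
rewrite enormZ ger0_norm ?invr_ge0// mulrC ler_pdivrMr ?ltr0n//.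
rewrite (le_trans (enorm_sum _ _))//.
rewrite (le_trans (ler_sum _ (fun i _ => fKg i (thC w i))))//.
by rewrite sumr_const card_ord -(mulr_natr Kg).
Qed.

(** Rows of [W] sum to one surely, columns only in mean; this excess governs how mixing moves the
    average. *)
Definition col_excess j (A : 'M[R]_N) : R := \sum_i A i j - 1.

Let mexcess j : measurable_fun setT (col_excess j).
Proof.
by apply: measurable_funB => //; apply: measurable_sum => i; exact: measurable_coord.
Qed.

Let excess_le j w : `|col_excess j (W w)| <= N%:R.
Proof.
have h0 : 0 <= \sum_i W w i j by rewrite sumr_ge0// => i _; exact: W0.
have h1 : \sum_i W w i j <= N%:R.
  rewrite (le_trans (ler_sum _ (fun i _ => proj2 (andP (W01 w i j)))))//.
  by rewrite sumr_const card_ord.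
have h2 : 1 <= N%:R :> R by rewrite ler1n.
by rewrite /col_excess ler_norml; apply/andP; split; lra.
Qed.

(** A common vector may therefore be subtracted from all blocks in the shift of the average, which
    brings its size down to that of the disagreement instead of the diameter of the set. *)
Let sum_excess w : \sum_j col_excess j (W w) = 0.
Proof.
rewrite sumrB exchange_big/=.
rewrite (eq_bigr (fun=> 1)) ?subrr// => i _.
have /matrixP/(_ i 0) := W1 w; rewrite !mxE => <-.
by apply: eq_bigr => j _; rewrite mxE mulr1.
Qed.

Let mean_excess j : mean P (col_excess j \o W) = 0.
Proof.
have /matrixP/(_ 0 j) := Wmean; rewrite !mxE => E.
rewrite (_ : _ \o _ = fun w => \sum_i W w i j - 1)//.
rewrite meanB; [|exact: intg_sum|exact: intg_cst].
rewrite mean_cst mean_sum// -[X in _ - X]E; apply/eqP; rewrite subr_eq0; apply/eqP.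
by apply: eq_bigr => i _; rewrite mxE mxE mul1r EmxE.
Qed.

Let avg_step w : avg (th' w) =
  N%:R^-1 *: \sum_j col_excess j (W w) *: block (b w) j + avg (b w).
Proof.
rewrite /avg -scalerDr; congr (_ *: _).
under eq_bigr do rewrite block_step.
rewrite exchange_big -big_split/=; apply: eq_bigr => j _.
by rewrite -scaler_suml /col_excess scalerBl scale1r subrK.
Qed.

Let dev_ge0 (x : 'cV[R]_(N * d)) : 0 <= deviation x.
Proof. by rewrite sumr_ge0// => i _; exact: enorm_ge0. Qed.

Let avgK w : enorm (avg (th w)) <= K.
Proof. by apply: CK; apply: avg_in. Qed.

Let mdev : gmeas H (fun w => deviation (th w)).
Proof.
apply: measurable_sum => i.
apply: (gmeas_enorm (D := fun w => block (th w) i - avg (th w))) => k.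
rewrite /gmeas; under eq_fun do rewrite coordB.
by apply: measurable_funB; [exact: mblock|exact: mavg].
Qed.

(* [z] is a version of the conditional expectation of the projection defect. *)
Lemma step_noise : exists z : Omega -> 'cV[R]_d,
  let noise w := avg (th' w) - avg (th w) - g *: (- mean_grad w - z w) in
  [/\ forall w, enorm (z w) <= m1,
      forall k H', <<s H >> `<=` <<s H' >> ->
        (forall i l, gmeas H' (fun w => block (th' w) i l 0)) ->
        gmeas H' (fun w => noise w k 0),
      forall k A, <<s H >> A -> mean P (fun w => \1_A w * noise w k 0) = 0,
      forall k, mean P (fun w => noise w k 0 ^+ 2) <=
        3 * (N%:R * mean P (fun w => disagreement (th w)) +
             ((N%:R + 1) ^+ 2 * m2 + (Kg + m1) ^+ 2) * g ^+ 2)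
    & {ae P, forall w, enorm (avg (th w) - eproj C (avg (th w) + z w)) ^+ 2 <=
         deviation (th w) * m1 + g * m2} ].
Proof.
pose D w := proj_defect C (th w) (Y w) g.
have iavg (X : Omega -> 'cV[R]_(N * d)) k : (forall i, intg (fun w => block (X w) i k 0)) ->
    intg (fun w => avg (X w) k 0).
  by move=> iX; under eq_fun do rewrite avgE; apply: intgZ; exact: intg_sum.
have ib i k : intg (fun w => block (b w) i k 0) by exact: (intg_bdd P (c := K)).
have ith i k : intg (fun w => block (th w) i k 0) by exact: (intg_bdd P (c := K)).
have iYb i k : intg (fun w => block (Y w) i k 0).
  by under eq_fun do rewrite blockE; exact: iYl.
have DE w k : D w k 0 = avg (Y w) k 0 - g^-1 * (avg (b w) k 0 - avg (th w) k 0).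
  by rewrite /D /proj_defect; move: (avg _) (avg _) (avg _) => u v t; rewrite !coordE.
have iD k : intg (fun w => D w k 0).
  under eq_fun do rewrite DE; apply: intgB; first exact: iavg.
  by apply: intgZ; apply: intgB; exact: iavg.
have [z [mz zm1 Dz]] := condexp_bounded sH iD iY m1_ge0 Ym1
  (fun w => enorm_proj_defect N_gt0 cC C0 kC (Y w) g_gt0 (thC w)).
exists z => noise.
have mnoise' k H' : <<s H >> `<=` <<s H' >> ->
    (forall i l, gmeas H' (fun w => block (th' w) i l 0)) -> gmeas H' (fun w => noise w k 0).
  move=> HH' mth'.
  rewrite /gmeas (_ : (fun w => _) = fun w => avg (th' w) k 0 - avg (th w) k 0 -
      g * (- (N%:R^-1 * \sum_i grad (f i) (block (th w) i) k 0) - z w k 0)).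
    apply: measurable_funB; first apply: measurable_funB.
    - under eq_fun do rewrite avgE; apply: measurable_funM => //.
      by apply: measurable_sum => i; exact: mth'.
    - exact: (gmeas_sub HH' (mavg k)).
    - apply: measurable_funM => //; apply: measurable_funB.
        apply: measurableT_comp => //; apply: measurable_funM => //.
        by apply: measurable_sum => i; exact: (gmeas_sub HH' (mgrad i k)).
      exact: (gmeas_sub HH' (mz k)).
  by apply/funext => w; rewrite /noise /mean_grad; move: (avg _) (avg _) => u v; rewrite !coordE summxE.
split => //.
- move=> k A HA; have mA := sH HA.
  (* Three centered pieces: mixing, by independence and [mean_excess]; sampling, by [Ymean]; the
     projection defect minus its conditional expectation, by [Dz]. *)
  have noiseE w : \1_A w * noise w k 0 =
      N%:R^-1 * (\sum_j col_excess j (W w) * (\1_A w * block (b w) j k 0)) +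
      g * (N%:R^-1 * (\sum_i (\1_A w * Y w (mxtens_index (i, k)) 0 -
          \1_A w * (- stack (fun i => grad (f i) (block (th w) i))) (mxtens_index (i, k)) 0)) -
       (\1_A w * D w k 0 - \1_A w * z w k 0)).
    have e1 : avg (th' w) k 0 = N%:R^-1 * (\sum_j col_excess j (W w) * block (b w) j k 0) +
        avg (b w) k 0.
      rewrite avg_step coordD coordZ summxE; congr (_ * _ + _).
      by apply: eq_bigr => j _; rewrite coordE.
    have e2 : mean_grad w k 0 = N%:R^-1 * \sum_i grad (f i) (block (th w) i) k 0.
      by rewrite mxE summxE.
    have e3 : avg (Y w) k 0 = N%:R^-1 * \sum_i Y w (mxtens_index (i, k)) 0.
      by rewrite avgE; congr (_ * _); apply: eq_bigr => i _; rewrite blockE.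
    have -> : \sum_j col_excess j (W w) * (\1_A w * block (b w) j k 0) =
        \1_A w * \sum_j col_excess j (W w) * block (b w) j k 0.
      by rewrite mulr_sumr; apply: eq_bigr => j _; rewrite mulrCA.
    rewrite sumrB -!mulr_sumr.
    have -> : \sum_i (- stack (fun i => grad (f i) (block (th w) i))) (mxtens_index (i, k)) 0 =
        - \sum_i grad (f i) (block (th w) i) k 0.
      by rewrite -sumrN; apply: eq_bigr => i _; rewrite coordN stackE.
    have -> : noise w k 0 = avg (th' w) k 0 - avg (th w) k 0 -
        g * (- mean_grad w k 0 - z w k 0).
      by rewrite /noise; move: (avg _) (avg _) (mean_grad _) => u v t; rewrite !coordE.
    rewrite DE e1 e2 e3.
    move: (\sum_i _) (\sum_i _) (\sum_i _) (\1_A w) => s1 s2 s3 a.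
    by field; rewrite (gt_eqF g_gt0) pnatr_eq0 -lt0n N_gt0.
  have mb_A j : gmeas J (fun w => \1_A w * block (b w) j k 0).
    apply: measurable_funM; last exact: mb.
    by apply: measurable_indic; exact: HJ.
  have bA j w : `|\1_A w * block (b w) j k 0| <= K.
    have /andP[h0 h1] := @indic01 _ Omega R A w.
    by rewrite normrM (ger0_norm h0) (le_trans (ler_piMl _ h1)).
  have iex j : intg (fun w => col_excess j (W w) * (\1_A w * block (b w) j k 0)).
    apply: (intg_mulb (c := N%:R)) => //.
      exact: (measurableT_comp (mexcess j) mW).
    by apply: intg_indic.
  have iST i : intg (fun w => (- stack (fun i => grad (f i) (block (th w) i))) (mxtens_index (i, k)) 0).
    apply: (intg_bdd P (c := Kg)).
      under eq_fun do rewrite coordN stackE.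
      by apply: measurableT_comp => //; exact: (gmeas_measurable sH (mgrad i k)).
    move=> w; rewrite coordN stackE normrN.
    by rewrite (le_trans (coord_le_enorm _ _))// fKg//; exact: thC.
  have iz : intg (fun w => z w k 0).
    apply: (intg_bdd P (c := m1)); first exact: (gmeas_measurable sH (mz k)).
    by move=> w; exact: le_trans (coord_le_enorm _ _) (zm1 w).
  under eq_fun do rewrite noiseE.
  have i1 : intg (fun w => N%:R^-1 * \sum_j col_excess j (W w) * (\1_A w * block (b w) j k 0)).
    by apply: intgZ; exact: intg_sum.
  have i2 : intg (fun w => N%:R^-1 * (\sum_i (\1_A w * Y w (mxtens_index (i, k)) 0 -
          \1_A w * (- stack (fun i => grad (f i) (block (th w) i))) (mxtens_index (i, k)) 0))).
    by apply: intgZ; apply: intg_sum => i; apply: intgB; exact: intg_indic.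
  have i3 : intg (fun w => \1_A w * D w k 0 - \1_A w * z w k 0).
    by apply: intgB; exact: intg_indic.
  have i1a : intg (fun w => \sum_j col_excess j (W w) * (\1_A w * block (b w) j k 0)).
    exact: intg_sum.
  have i23 := intgB i2 i3.
  rewrite (meanD i1 (intgZ g i23)) (meanZ _ i1a) (meanZ g i23).
  rewrite mean_sum// big1 ?mulr0 ?add0r => [|j _]; last first.
    rewrite (@mean_indep _ _ _ P J _ _ W (col_excess j) _ N%:R K sJ mW Windep _ _ (mb_A j) (bA j))//.
    by rewrite mean_excess mul0r.
  rewrite meanB// meanZ; last by apply: intg_sum => i; apply: intgB; exact: intg_indic.
  rewrite mean_sum => [|i]; last by apply: intgB; exact: intg_indic.
  rewrite big1 => [|i _]; last first.
    rewrite meanB; [|exact: intg_indic..].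
    by rewrite Ymean// subrr.
  rewrite mulr0 sub0r meanB; [|exact: intg_indic..].
  by rewrite Dz// subrr oppr0 mulr0.
- move=> k.
  have bound w : `|noise w k 0| <= deviation (th w) + (N%:R + 1) * g * enorm (Y w) + (Kg + m1) * g.
    rewrite (le_trans (coord_le_enorm _ _))// /noise.
    (* Recentering the blocks at [avg (th w)] is allowed by [sum_excess]; the mixing part is then
       controlled by the deviation plus a term of order g |Y|. *)
    have -> : avg (th' w) - avg (th w) - g *: (- mean_grad w - z w) =
        (N%:R^-1 *: \sum_j col_excess j (W w) *: (block (b w) j - avg (th w)) +
         (avg (b w) - avg (th w))) - g *: (- mean_grad w - z w).
      congr (_ - _); rewrite avg_step -addrA; congr (_ *: _ + _).
      under [RHS]eq_bigr do rewrite scalerBr.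
      by rewrite sumrB -scaler_suml sum_excess scale0r subr0.
    have g0 := ltW g_gt0.
    have step_le i := proj_step_dist cC C0 kC (Y w) i g0 (thC w).
    have h1 : enorm (N%:R^-1 *: \sum_j col_excess j (W w) *: (block (b w) j - avg (th w))) <=
        deviation (th w) + N%:R * g * enorm (Y w).
      rewrite enormZ ger0_norm ?invr_ge0// mulrC ler_pdivrMr ?ltr0n//.
      rewrite (le_trans (enorm_sum _ _))// mulrDl /deviation mulr_suml.
      have -> : N%:R * g * enorm (Y w) * N%:R = \sum_(i < N) (g * enorm (Y w)) * N%:R.
        by rewrite sumr_const card_ord -(mulr_natl (_ * N%:R)) !mulrA.
      rewrite -big_split/= ler_sum// => i _; rewrite enormZ mulrC -mulrDl.
      apply: ler_pM => //; first exact: enorm_ge0.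
      rewrite (le_trans (enorm_triangle (block (th w) i) _ _))// addrC lerD2l.
      by rewrite (le_trans (step_le i))// ler_wpM2l// enorm_block_le.
    have h2 : enorm (avg (b w) - avg (th w)) <= g * enorm (Y w).
      rewrite -avgN -avgD /avg enormZ ger0_norm ?invr_ge0// mulrC ler_pdivrMr ?ltr0n//.
      rewrite (le_trans (enorm_sum _ _))//.
      have -> : g * enorm (Y w) * N%:R = \sum_(i < N) (g * enorm (Y w)).
        by rewrite sumr_const card_ord -(mulr_natr (_ * _)).
      rewrite ler_sum// => i _; rewrite blockD blockN (le_trans (step_le i))//.
      by rewrite ler_wpM2l// enorm_block_le.
    have h3 : enorm (g *: (- mean_grad w - z w)) <= (Kg + m1) * g.
      rewrite enormZ gtr0_norm// mulrC ler_wpM2r// (le_trans (enormD _ _))// !enormN.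
      by rewrite lerD.
    rewrite (le_trans (enormD _ _))// enormN lerD// (le_trans (enormD _ _))//.
    by rewrite mulrDl mulrDl mul1r addrA lerD.
  have i0 : intg (fun w => disagreement (th w)) by apply: idisp.
  (* The factor 3 comes from (p + u + v)^2 <= 3 (p^2 + u^2 + v^2). *)
  have sqr_le w : noise w k 0 ^+ 2 <= 3 * (N%:R * disagreement (th w) +
      ((N%:R + 1) ^+ 2 * enorm (Y w) ^+ 2 + (Kg + m1) ^+ 2) * g ^+ 2).
    rewrite -(real_normK (num_real (noise w k 0))).
    have b0 : 0 <= `|noise w k 0| by [].
    have := lerXn2r 2 b0 (le_trans b0 (bound w)) (bound w) => /le_trans; apply.
    have := sqr_deviation_le (th w).
    move: (deviation _) (disagreement _) (enorm (Y w)) => p q y pq.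
    move: (N%:R : R) pq => n pq.
    set u := (n + 1) * g * y; set v := (Kg + m1) * g.
    have -> : ((n + 1) ^+ 2 * y ^+ 2 + (Kg + m1) ^+ 2) * g ^+ 2 = u ^+ 2 + v ^+ 2.
      by rewrite /u /v; ring.
    clearbody u v.
    have := sqr_ge0 (p - u); have := sqr_ge0 (p - v); have := sqr_ge0 (u - v).
    by move: pq; rewrite !expr2; lra.
  have iq : intg (fun w => ((N%:R + 1) ^+ 2 * enorm (Y w) ^+ 2 + (Kg + m1) ^+ 2) * g ^+ 2).
    under eq_fun do rewrite mulrC; apply: intgZ; apply: intgD; [exact: intgZ|exact: intg_cst].
  have ir : intg (fun w => 3 * (N%:R * disagreement (th w) +
      ((N%:R + 1) ^+ 2 * enorm (Y w) ^+ 2 + (Kg + m1) ^+ 2) * g ^+ 2)).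
    by apply: intgZ; apply: intgD => //; exact: intgZ.
  have mnoise : measurable_fun setT (fun w => noise w k 0).
    (* Plain measurability is the case where [H'] consists of all measurable sets. *)
    have sm : <<s @measurable _ Omega >> `<=` measurable.
      by rewrite sigma_algebra_id//; exact: sigma_algebra_measurable.
    apply: (gmeas_measurable sm); apply: mnoise' => [A /sH mA|i l _ B mB].
      exact: sub_sigma_algebra.
    by apply: sub_sigma_algebra; exact: step_measurable.
  apply: (@le_trans _ _ (mean P (fun w => 3 * (N%:R * disagreement (th w) +
      ((N%:R + 1) ^+ 2 * enorm (Y w) ^+ 2 + (Kg + m1) ^+ 2) * g ^+ 2)))).
    apply: mean_le => //; apply: le_intg ir _; first exact: measurable_funX.
    by move=> w; rewrite ger0_norm ?sqr_ge0.
  rewrite meanZ; last by apply: intgD => //; exact: intgZ.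
  rewrite ler_wpM2l// meanD//; last exact: intgZ.
  rewrite meanZ// lerD2l meanZr; last by apply: intgD; [exact: intgZ|exact: intg_cst].
  rewrite ler_wpM2r ?sqr_ge0// meanD ?mean_cst; [|exact: intgZ|exact: intg_cst].
  rewrite lerD2r meanZ// ler_wpM2l ?sqr_ge0//.
  have HT : <<s H >> setT by exact: (@measurableT _ (g_sigma_algebraType H)).
  have := Ym2 HT; rewrite indicT mean_cst mulr1.
  by under eq_fun do rewrite mul1r.
(* The test vector points from the average to the projected point. It is measurable with respect to
   the past, so one conditional inequality at this random vector suffices. *)
- pose phi w := eproj C (avg (th w) + z w) - avg (th w).
  have mphi k : gmeas H (fun w => phi w k 0).
    rewrite /gmeas /phi; under eq_fun do rewrite coordB.
    apply: measurable_funB; last exact: mavg.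
    apply: (measurable_eproj (T := g_sigma_algebraType H)) => // k'.
    by under eq_fun do rewrite coordD; apply: measurable_funD; [exact: mavg|exact: mz].
  have phic k w : `|phi w k 0| <= K + K.
    rewrite (le_trans (coord_le_enorm _ _))// (le_trans (enormD _ _))// enormN lerD//.
    by apply: CK; have [] := eprojG cC C0 kC (avg (th w) + z w).
  have dev_le w : 0 <= deviation (th w) <= \sum_(i < N) (K + K).
    rewrite dev_ge0 ler_sum// => i _; rewrite (le_trans (enormD _ _))// enormN lerD//.
    by apply: CK; exact: thC.
  have iz k : intg (fun w => z w k 0).
    apply: (intg_bdd P (c := m1)); first exact: (gmeas_measurable sH (mz k)).
    by move=> w; exact: le_trans (coord_le_enorm _ _) (zm1 w).
  have := @ae_dotv_condexp _ _ _ P d H sH D z phi (fun w => deviation (th w)) _ _ g m1 m2 _ _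
    iD iz mz Dz mphi phic mdev dev_le (ltW g_gt0) iY iY2 Ym1 Ym2.
  move=> /(_ (fun w => _)) [w|B HB].
    apply: dotv_proj_defect => //.
    by have [] := eprojG cC C0 kC (avg (th w) + z w).
  exists B; move: HB => [mB B0 sub]; split => // w /= nH; apply: sub => /= hw; apply: nH.
  apply: le_trans hw.
  have avgC : C (avg (th w)) by exact: avg_in.
  have [_ _ _ h] := @proj_normal _ _ _ _ (z w) _ avgC (eprojG cC C0 kC (avg (th w) + z w)).
  exact: h.
Qed.

End one_step.

(** * Consensus and decomposition of the averaged iterates *)

Lemma sum_shift_le {R : realType} (u : nat -> R) (M : R) : (forall n, 0 <= u n) ->
  (forall n, \sum_(i < n) u i <= M) -> forall n, \sum_(i < n) u i.+1 <= M.
Proof.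
by move=> u0 uM n; apply: le_trans (uM n.+1); rewrite big_ord_recl lerDr.
Qed.

Lemma sqr_squeeze_cvg0 {R : realType} (a c : nat -> R) : (forall n, 0 <= a n) ->
  (forall n, a n ^+ 2 <= c n) -> c n @[n --> \oo] --> (0 : R) ->
  a n @[n --> \oo] --> (0 : R).
Proof.
move=> a0 ac c0; apply/cvgrPdist_lt => e e0.
have e2 : 0 < e ^+ 2 by rewrite exprn_gt0.
move/cvgrPdist_lt : c0 => /(_ _ e2); apply: filterS => n.
rewrite !sub0r !normrN => cn; rewrite ger0_norm// -ltr_sqr ?nnegrE ?(ltW e0)//.
by apply: le_lt_trans (ac n) (le_lt_trans (ler_norm _) cn).
Qed.

Lemma step_size_cvg0 {R : realType} (g : nat -> R) (al : R) : 0 <= al ->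
  n%:R `^ al * g n @[n --> \oo] --> (0 : R) -> g n @[n --> \oo] --> (0 : R).
Proof.
move=> al0 /cvgrPdist_lt ng; apply/cvgrPdist_lt => e e0.
have := ng e e0; near_simpl => H.
near=> n; have n0 : (0 < n)%N by near: n; exists 1%N.
have : `|0 - n%:R `^ al * g n| < e by near: n.
rewrite !sub0r !normrN; apply: le_lt_trans; rewrite normrM ler_peMl//.
have n1 : 1 <= n%:R :> R by rewrite ler1n.
by have := ler_powR n1 al0; rewrite powRr0 => h; rewrite (le_trans h)// ler_norm.
Unshelve. all: by end_near. Qed.

Section core.
Context {disp : measure_display} {Omega : measurableType disp} {R : realType}.
Variable P : probability Omega R.
Variables (N d : nat).
Hypothesis N_gt0 : (0 < N)%N.
Variables (f : 'I_N -> 'cV[R]_d -> R) (C : set 'cV[R]_d) (m1 m2 : R) (gamma : nat -> R).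
Variables (Gs : nat -> set (set Omega)) (theta Y : nat -> Omega -> 'cV[R]_(N * d)).
Variable W : nat -> Omega -> 'M[R]_N.
Hypotheses (cC : cvx C) (C0 : C !=set0) (kC : compact C).
Hypothesis fC1 : forall i, C1_on setT (f i).
Hypotheses (m1_ge0 : 0 <= m1) (m2_ge0 : 0 <= m2).
Hypothesis gamma_gt0 : forall n, (1 <= n)%N -> 0 < gamma n.
Hypothesis sG : forall n, <<s Gs n >> `<=` measurable.
Hypothesis GS : forall n, <<s Gs n >> `<=` <<s Gs n.+1 >>.
Hypothesis mtheta : forall n, gmeas (Gs n) (theta n).
Hypothesis mY : forall n, measurable_fun setT (Y n.+1).
Hypothesis mW : forall n, measurable_fun setT (W n.+1).
Hypothesis W0 : forall n w i j, 0 <= W n.+1 w i j.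
Hypothesis W1 : forall n w, W n.+1 w *m ones = ones.
Hypothesis alg : forall n w, theta n.+1 w =
  (W n.+1 w *t 1%:M) *m proj_step C (theta n w) (Y n.+1 w) (gamma n.+1).
Hypothesis Wmean : forall n, ones^T *m Emx P (W n.+1) = ones^T.
Hypothesis Windep : forall n A E, measurable A -> <<s joint_gen (Gs n.+1) (Y n.+2) >> E ->
  mean P (fun w => \1_(W n.+2 @^-1` A) w * \1_E w) =
  mean P (\1_(W n.+2 @^-1` A)) * mean P (\1_E).
Hypothesis iY2 : forall n, P.-integrable setT (EFin \o (fun w => enorm (Y n.+2 w) ^+ 2)).
Hypothesis Ym1 : forall n, condexp_le_cst P (Gs n.+1) (fun w => enorm (Y n.+2 w)) m1.
Hypothesis Ym2 : forall n, condexp_le_cst P (Gs n.+1) (fun w => enorm (Y n.+2 w) ^+ 2) m2.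
Hypothesis Ymean : forall n l, condexp_eq P (Gs n.+1) (fun w => Y n.+2 w l 0)
  (fun w => (- stack (fun i => grad (f i) (block (theta n.+1 w) i))) l 0).
Variable al : R.
Hypothesis al_gt : 2^-1 < al.
Hypothesis rho_div : n%:R * (1 - rho P W n) @[n --> \oo] --> +oo.
Hypothesis gamma_al : n%:R `^ al * gamma n @[n --> \oo] --> (0 : R).
Hypothesis rho_gamma : (0 < limn_einf (fun n =>
  ((1 - rho P W n) / (n%:R `^ al * gamma n))%:E))%E.

Let gamma_cvg0 : gamma n @[n --> \oo] --> (0 : R).
Proof. by apply: step_size_cvg0 gamma_al; rewrite (le_trans _ (ltW al_gt))// invr_ge0. Qed.

Lemma theta_in n w : blockpow C (theta n.+1 w).
Proof. exact: (step_in cC C0 kC (@W0 n) (@W1 n) (@alg n)). Qed.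

Let U n := mean P (fun w => disagreement (theta n w)).

(** The recursion of [mean_disagreement_step] fits [contraction_summable] with b = 1 - rho and C =
    m2. *)
Lemma disagreement_summable : exists M, forall n, \sum_(i < n) U i <= M.
Proof.
have [K K0 CK] := compact_enorm_bounded kC C0.
apply: (contraction_summable al_gt m2_ge0 _ gamma_gt0 _ rho_div gamma_al rho_gamma).
- by move=> n; apply: mean_ge0 => w; exact: disagreement_ge0.
- by move=> n _; rewrite gerBl spectral_norm_ge0.
- move=> [//|n] e _ e0; rewrite subKr.
have X0 := (mean_disagreement_step N_gt0 cC C0 kC K0 CK (gamma_gt0 (isT : (0 < n.+2)%N))
   (@sG n.+1) (@mtheta n.+1) (theta_in n) (@mY n.+1) (@mW n.+1) (@W0 n.+1) (@W1 n.+1)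
   (@Windep n) (@alg n.+1) (@iY2 n) (@Ym2 n) e0). exact: X0.
Qed.

(** The squared deviation is at most N times the disagreement, whose means are summable. The shift
    by one keeps the iterates in the compact set, where the disagreement is bounded. *)
Lemma ae_deviation_cvg0 : {ae P, forall w, deviation (theta n.+1 w) @[n --> \oo] --> (0 : R)}.
Proof.
have [K K0 CK] := compact_enorm_bounded kC C0; have [M HM] := disagreement_summable.
have : {ae P, forall w, disagreement (theta n.+1 w) @[n --> \oo] --> (0 : R)}.
  apply: (@ae_cvg0_summable _ _ _ P (fun n w => disagreement (theta n.+1 w))
    (fun=> N%:R * (K + K) ^+ 2) M).
  - move=> n; apply: measurable_sum => k; apply: measurable_funX.
    apply: (measurable_continuous_coord
      (X := fun t => centering *m column (theta n.+1 t) k) (g := @enorm R N)).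
      have mth i : measurable_fun setT (fun w => block (theta n.+1 w) i k 0).
        under eq_fun do rewrite blockE.
        apply: measurable_fun_coord; exact: (gmeas_measurable (@sG n.+1) (@mtheta n.+1)).
      move=> i; under eq_fun do rewrite centeringE mxE.
      apply: measurable_funB; first exact: mth. apply: measurable_funM => //; apply: measurable_sum => j.
      by under eq_fun do rewrite mxE; exact: mth.
    exact: enorm_continuous.
  - move=> n w; rewrite disagreement_ge0 disagreementE/=.
    have h i : enorm (block (theta n.+1 w) i - avg (theta n.+1 w)) ^+ 2 <= (K + K) ^+ 2.
      rewrite lerXn2r ?nnegrE ?enorm_ge0 ?addr_ge0// (le_trans (enormD _ _))// enormN.
      by rewrite lerD//; apply: CK; [exact: theta_in|exact: (avg_in N_gt0 cC (theta_in n w))].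
    rewrite (le_trans (ler_sum _ (fun i _ => h i)))//.
    by rewrite sumr_const card_ord [leRHS]mulr_natl.
  - apply: (sum_shift_le (u := U)) => // n.
    by apply: mean_ge0 => w; exact: disagreement_ge0.
apply: filterS => w H; apply: (sqr_squeeze_cvg0 (c := fun n => N%:R * disagreement (theta n.+1 w))).
- by move=> n; rewrite sumr_ge0// => i _; exact: enorm_ge0.
- by move=> n; exact: sqr_deviation_le.
- by rewrite -[X in _ --> X](mulr0 N%:R); apply: cvgMr.
Qed.

Let noise (z : nat -> Omega -> 'cV[R]_d) n w :=
  avg (theta n.+2 w) - avg (theta n.+1 w) -
  gamma n.+2 *: (- mean_grad f (theta n.+1) w - z n w).

(** [step_noise] provides a vector [z n] for each step. One gradient bound serves all agents, so
    each noise term is bounded, and the variances are summable by [disagreement_summable] and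
    [step_sq_summable]. *)
Lemma ae_decomposition : exists z : nat -> Omega -> 'cV[R]_d,
  (forall n w, enorm (z n w) <= m1) /\
  {ae P, forall w,
    [/\ deviation (theta n.+1 w) @[n --> \oo] --> (0 : R),
        enorm (avg (theta n.+1 w) - eproj C (avg (theta n.+1 w) + z n w))
          @[n --> \oo] --> (0 : R)
      & forall k, cvgn (fun n => \sum_(i < n) noise z i w k 0)]}.
Proof.
have [K K0 CK] := compact_enorm_bounded kC C0; have [M HM] := disagreement_summable.
have [M' HM'] := step_sq_summable al_gt gamma_al.
have Kf i : exists Ki, 0 <= Ki /\ forall x, C x -> enorm (grad (f i) x) <= Ki.
  have [|Ki Ki0 HKi] := @continuous_enorm_bounded _ _ (grad (f i)) C kC C0.
    by move=> x; have [] := fC1 i (x := x) I.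
  by exists Ki.
have [Ki HKi] := choice Kf.
pose Kg := \sum_i Ki i.
have fKg i x : C x -> enorm (grad (f i) x) <= Kg.
  move=> Cx; rewrite (le_trans (proj2 (HKi i) x Cx))// /Kg (bigD1 i)//= lerDl.
  by rewrite sumr_ge0// => j _; have [] := HKi j.
have step n := step_noise N_gt0 cC C0 kC K0 CK fKg fC1 m1_ge0 (gamma_gt0 (isT : (0 < n.+2)%N))
   (@sG n.+1) (@mtheta n.+1) (theta_in n) (@mY n.+1) (@mW n.+1) (@W0 n.+1) (@W1 n.+1) (@Wmean n.+1)
   (@Windep n) (@alg n.+1) (@iY2 n) (@Ym1 n) (@Ym2 n) (@Ymean n).
have [z Hz] := choice step; exists z.
split=> [n w|]; first by have [] := Hz n.
have aez : {ae P, forall w n, enorm (avg (theta n.+1 w) - eproj C (avg (theta n.+1 w) + z n w)) ^+ 2 <=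
    deviation (theta n.+1 w) * m1 + gamma n.+2 * m2}.
  by apply: ae_foralln => n; have [] := Hz n.
have Kg0 : 0 <= Kg by rewrite sumr_ge0// => j _; have [] := HKi j.
have noise_le k n w : `|noise z n w k 0| <= K + K + gamma n.+2 * (Kg + m1).
  rewrite (le_trans (coord_le_enorm _ _))// (le_trans (enormD _ _))// enormN lerD//.
    rewrite (le_trans (enormD _ _))// enormN.
    by rewrite lerD//; apply: CK; apply: (avg_in N_gt0 cC); exact: theta_in.
  rewrite enormZ gtr0_norm ?gamma_gt0// ler_wpM2l ?(ltW (gamma_gt0 _))//.
  rewrite (le_trans (enormD _ _))// !enormN lerD//; last by have [] := Hz n.
  rewrite enormZ ger0_norm ?invr_ge0// mulrC ler_pdivrMr ?ltr0n//.
  rewrite (le_trans (enorm_sum _ _))//.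
  rewrite (le_trans (ler_sum _ (fun i _ => fKg i _ (theta_in n w i))))//.
  by rewrite sumr_const card_ord -(mulr_natr Kg).
have aen k : {ae P, forall w, cvgn (fun n => \sum_(i < n) noise z i w k 0)}.
  pose B := (N%:R + 1) ^+ 2 * m2 + (Kg + m1) ^+ 2.
  have B0 : 0 <= B by rewrite addr_ge0 ?sqr_ge0// mulr_ge0// sqr_ge0.
  (* Two bounds with different uses: one per increment, which keeps the stopped sums bounded, and 3
     (N M + B M') on the summed variances, with M for the disagreement and M' for the squared step
     sizes. *)
  apply: (@ae_cvg_martingale _ _ _ P (fun n => Gs n.+1) (fun n w => noise z n w k 0)
    (fun n => K + K + gamma n.+2 * (Kg + m1)) (3 * (N%:R * M + B * M'))).
  - by move=> n; exact: sG.
  - by move=> n; exact: GS.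
  - move=> n; have [_ H _ _ _] := Hz n; apply: H; first exact: GS.
    move=> i l; rewrite /gmeas; under eq_fun do rewrite blockE.
    by apply: (measurable_fun_coord (T := g_sigma_algebraType (Gs n.+2))); exact: mtheta.
  - by move=> n w; exact: noise_le.
  - by move=> n A GA; have [_ _ H _ _] := Hz n; exact: H.
  - move=> n.
    have h i : mean P (fun w => noise z i w k 0 ^+ 2) <= 3 * (N%:R * U i.+1 + B * gamma i.+2 ^+ 2).
      by have [_ _ _ H _] := Hz i; exact: H.
    apply: (@le_trans _ _ (\sum_(i < n) 3 * (N%:R * U i.+1 + B * gamma i.+2 ^+ 2))).
      by apply: ler_sum => i _; exact: h.
    rewrite -mulr_sumr ler_wpM2l// big_split/= -!mulr_sumr lerD// ler_wpM2l//.
      apply: (sum_shift_le (u := U)) => // j.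
      by apply: mean_ge0 => w; exact: disagreement_ge0.
    have g2 j : 0 <= gamma j ^+ 2 by exact: sqr_ge0.
    apply: (sum_shift_le (u := fun j => gamma j.+1 ^+ 2)) => //.
    exact: (sum_shift_le (u := fun j => gamma j ^+ 2)).
have aen' : {ae P, forall w k, cvgn (fun n => \sum_(i < n) noise z i w k 0)}.
  exact: filter_forall.
have aed := ae_deviation_cvg0.
apply: filterS3 aed aez aen' => w dev0 zle cvn; split => //.
apply: (sqr_squeeze_cvg0 (c := fun n => deviation (theta n.+1 w) * m1 + gamma n.+2 * m2)) => //.
  by move=> n; exact: enorm_ge0.
rewrite [X in _ --> X](_ : _ = 0 * m1 + 0 * m2); last by rewrite !mul0r addr0.
apply: cvgD; apply: cvgMl => //.
have g1 : gamma n.+1 @[n --> \oo] --> (0 : R) by rewrite (cvg_shiftS gamma).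
pose g' n := gamma n.+1.
have g2 : g' n.+1 @[n --> \oo] --> (0 : R) by rewrite (cvg_shiftS g').
exact: g2.
Qed.

End core.

(** * Reduction to surely stochastic matrices *)

Section conditional_law.
Import HBNNSimple.
Context {disp : measure_display} {Omega : measurableType disp} {R : realType}.
Variable P : probability Omega R.
Context {d : measure_display} {T : measurableType d}.
Variables (H : set (set Omega)) (Y : Omega -> T) (Q : Omega -> probability T R).
Hypothesis sH : <<s H >> `<=` measurable.
Hypothesis mY : measurable_fun setT Y.
Hypothesis law : forall A, measurable A ->
  is_cond_prob P <<s H >> (Y @^-1` A) (fun w => fine (Q w A)).

Local Notation intg X := (P.-integrable setT (EFin \o X)).

(** A simple function takes finitely many values, so its conditional expectation is a finite
    combination of the conditional probabilities given by [law], and almost surely equals its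
    integral under [Q w]. *)
Lemma simple_moment_le (s : {nnsfun T >-> R}) (M : R) E : <<s H >> E ->
  {ae P, forall w, (\int[Q w]_y (s y)%:E <= M%:E)%E} ->
  (\int[P]_(w in E) (s (Y w))%:E <= M%:E * P E)%E.
Proof.
move=> HE sM; have mE := sH HE.
have finF : finite_set (range s) by exact: fimfunP.
pose r : seq R := finmap.enum_fset (fset_set (range s)).
have sE y : s y = \sum_(a <- r) a * \1_(s @^-1` [set a]) y.
  by rewrite {1}fimfunE fsbig_finite.
have ms a : measurable (s @^-1` [set a]).
  by rewrite -[X in measurable X]setTI; exact: measurable_funPT.
have ZE a : exists Z : Omega -> R, [/\ intg Z,
    mean P (fun w => \1_E w * \1_(s @^-1` [set a]) (Y w)) = mean P (fun w => \1_E w * Z w)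
    & {ae P, forall w, Z w = fine (Q w (s @^-1` [set a]))}].
  have [i1 [Z [_ iZ ZE aeZ]]] := law (ms a).
  exists Z; split => //.
  have := ZE E HE; rewrite !setint_mean// => -[<-]//.
have [Z HZ] := choice ZE.
have i1 a : intg (fun w => \1_(s @^-1` [set a]) (Y w)) by have [] := law (ms a).
have bs : exists B, forall y, `|s y| <= B.
  exists (\sum_(a <- r) `|a|) => y; rewrite sE (le_trans (ler_norm_sum _ _ _))//.
  apply: ler_sum => a _; rewrite normrM ler_piMr//.
  by have /andP[h0 h1] := @indic01 _ T R (s @^-1` [set a]) y; rewrite ger0_norm.
have [B HB] := bs.
have msY : measurable_fun setT (fun w => s (Y w)) by apply: measurableT_comp.
have isY : intg (fun w => s (Y w)) by apply: (@intg_bdd _ _ _ _ B).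
have iZ a : intg (Z a) by have [] := HZ a.
have i1Z a : intg (fun w => \1_E w * Z a w) by apply: intg_indic.
have iS : intg (fun w => \sum_(a <- r) a * Z a w).
  by apply: intg_sum => a; exact: intgZ.
rewrite setint_mean//.
have -> : mean P (fun w => \1_E w * s (Y w)) = mean P (fun w => \1_E w * \sum_(a <- r) a * Z a w).
  transitivity (\sum_(a <- r) a * mean P (fun w => \1_E w * \1_(s @^-1` [set a]) (Y w))).
    under eq_fun do rewrite sE mulr_sumr.
    rewrite mean_sum => [|a]; last first.
      by under eq_fun do rewrite mulrCA; apply: intgZ; exact: intg_indic.
    apply: eq_bigr => a _; under eq_fun do rewrite mulrCA.
    by rewrite meanZ//; exact: intg_indic.
  under [in RHS]eq_fun do rewrite mulr_sumr.
  rewrite mean_sum => [|a]; last first.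
    by under eq_fun do rewrite mulrCA; apply: intgZ.
  apply: eq_bigr => a _; under [in RHS]eq_fun do rewrite mulrCA.
  by rewrite meanZ//; have [_ -> _] := HZ a.
have PE : (P E = (mean P (\1_E))%:E)%E.
  by rewrite mean_indic// fineK// fin_num_measure.
rewrite PE -EFinM lee_fin -[leRHS]mulrC -meanZr; last exact: integrable_indic.
(* Indexing the values by natural numbers merges the exceptional sets into one by countable
   union. *)
have aeZ : {ae P, forall w n, Z (nth 0 r n) w = fine (Q w (s @^-1` [set nth 0 r n]))}.
  by apply: ae_foralln => n; have [] := HZ (nth 0 r n).
pose X w := \sum_(a <- r) a * Z a w.
have aeX : {ae P, forall w, X w <= M}.
  apply: filterS2 aeZ sM => w ZQ; rewrite mean_EFin; last first.
    by apply: (@intg_bdd _ _ _ _ B) => //; exact: measurable_funPT.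
  rewrite lee_fin; apply: le_trans.
  have -> : mean (Q w) s = mean (Q w) (fun y => \sum_(a <- r) a * \1_(s @^-1` [set a]) y).
    by congr mean; apply/funext => y; exact: sE.
  rewrite (mean_sum (P := Q w)) => [|a]; last by apply: intgZ; exact: integrable_indic.
  rewrite /X !big_seq le_eqVlt; apply/orP; left; apply/eqP; apply: eq_bigr => a ra.
  rewrite meanZ ?mean_indic//; last exact: integrable_indic.
  by rewrite -(nth_index 0 ra) ZQ.
have mX : measurable_fun setT X by exact: intg_measurable iS.
have mE1 : measurable_fun setT (\1_E : Omega -> R) by exact: measurable_indic.
(* [X] is below [M] only almost surely, while [mean_le] compares pointwise; the minimum is a
   substitute bounded at every point. *)
have -> : mean P (fun w => \1_E w * X w) = mean P (fun w => \1_E w * Num.min (X w) M).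
  apply: mean_ae.
  - exact: measurable_funM.
  - by apply: measurable_funM => //; exact: measurable_minr.
  - by apply: filterS aeX => w XM; rewrite min_l.
apply: mean_le.
- apply: intg_indic => //; have iB : intg (fun w => `|X w| + `|M|).
    by apply: intgD; [exact: (integrable_norm iS)|exact: intg_cst].
  apply: (le_integrable measurableT _ _ iB).
    exact/measurable_EFinP/measurable_minr.
  by move=> w _; rewrite /= lee_fin [leRHS]ger0_norm ?addr_ge0// minEle; case: ifP => _; rewrite ?lerDl ?lerDr.
- by under eq_fun do rewrite mulrC; apply: intgZ; exact: integrable_indic.
- move=> w; rewrite ler_wpM2l ?ge_min ?lexx ?orbT//.
Qed.

(** Monotone convergence from simple functions. Extended-real integrals are used because
    integrability of [g \o Y] is not known yet; [intg_moment] deduces it by taking [E] to be the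
    whole space. *)
Lemma moment_le (g : T -> R) (M : R) E : measurable_fun setT g ->
  (forall y, 0 <= g y) -> <<s H >> E ->
  {ae P, forall w, (\int[Q w]_y (g y)%:E <= M%:E)%E} ->
  (\int[P]_(w in E) (g (Y w))%:E <= M%:E * P E)%E.
Proof.
move=> mg g0 HE gM; have mE := sH HE.
have mf : measurable_fun setT (EFin \o g) by exact/measurable_EFinP.
have f0 : forall y, setT y -> (0 <= (EFin \o g) y)%E by move=> y _; rewrite lee_fin.
pose s n : {nnsfun T >-> R} := nnsfun_approx measurableT mf n.
have sg n y : s n y <= g y by rewrite /s -lee_fin nnsfun_approxE; exact: le_approx.
have sM n : (\int[P]_(w in E) (s n (Y w))%:E <= M%:E * P E)%E.
  apply: simple_moment_le => //; apply: filterS gM => w; apply: le_trans.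
  apply: ge0_le_integral => //.
  - by move=> ? _; rewrite lee_fin.
  - by apply/measurable_EFinP; exact: measurable_funPT.
  - by move=> y _; rewrite lee_fin.
have cvs : (\int[P]_(w in E) (s n (Y w))%:E)%E @[n --> \oo] -->
    (\int[P]_(w in E) (g (Y w))%:E)%E.
  have -> : (\int[P]_(w in E) (g (Y w))%:E = \int[P]_(w in E) limn (fun n => (s n (Y w))%:E))%E.
    apply: eq_integral => w _; apply/esym/cvg_lim => //.
    exact: (@cvg_nnsfun_approx _ _ _ _ measurableT _ mf f0 (Y w) I).
  apply: (@cvg_monotone_convergence _ _ _ P E mE (fun n w => (s n (Y w))%:E)).
  - move=> n; apply/measurable_EFinP; apply: measurable_funTS.
    by apply: measurableT_comp => //; exact: measurable_funPT.
  - by move=> n w _; rewrite lee_fin.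
  - by move=> w _ a b ab; rewrite lee_fin; exact/lefP/nd_nnsfun_approx.
rewrite -(cvg_lim (@ereal_hausdorff R) cvs); apply: lime_le.
  by apply/cvg_ex; eexists; exact: cvs.
exact: nearW.
Qed.

Lemma intg_moment (g : T -> R) (M : R) : measurable_fun setT g ->
  (forall y, 0 <= g y) ->
  {ae P, forall w, (\int[Q w]_y (g y)%:E <= M%:E)%E} -> intg (g \o Y).
Proof.
move=> mg g0 gM; apply/integrableP; split.
  by apply/measurable_EFinP; exact: measurableT_comp.
have HT : <<s H >> setT by exact: (@measurableT _ (g_sigma_algebraType H)).
have := moment_le mg g0 HT gM; under eq_integral do rewrite -(ger0_norm (g0 _)).
by move/le_lt_trans; apply; rewrite [X in (_ * X)%E]probability_setT mule1 ltry.
Qed.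

Lemma condexp_le_moment (g : T -> R) (M : R) : measurable_fun setT g ->
  (forall y, 0 <= g y) ->
  {ae P, forall w, (\int[Q w]_y (g y)%:E <= M%:E)%E} ->
  condexp_le_cst P H (g \o Y) M.
Proof.
move=> mg g0 gM A HA; have := moment_le mg g0 HA gM; have mA := sH HA.
rewrite setint_mean//; last exact: intg_moment gM.
have iA := intg_indic mA (intg_moment mg g0 gM).
have PA : P A \is a fin_num by exact: fin_num_measure.
by rewrite -lee_fin EFinM mean_indic// (fineK PA) -mean_EFin.
Qed.

End conditional_law.

Section history.
Context {disp : measure_display} {Omega : measurableType disp} {R : realType}.
Context {N d : nat}.
Variables (theta0 : Omega -> 'cV[R]_(N * d)).
Variables (Y : nat -> Omega -> 'cV[R]_(N * d)) (W : nat -> Omega -> 'M[R]_N).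

(** The generating class inside [history]: the sigma-algebra it generates is [history] by unfolding,
    in the form the conditioning lemmas expect. *)
Definition history_gen (n : nat) : set (set Omega) :=
  preimage_set_system setT theta0 measurable `|`
    \bigcup_(k in [set k | (1 <= k <= n)%N])
      (preimage_set_system setT (Y k) measurable `|`
       preimage_set_system setT (W k) measurable).

Lemma history_measurable n : measurable_fun setT theta0 ->
  (forall k, (1 <= k)%N -> measurable_fun setT (Y k)) ->
  (forall k, (1 <= k)%N -> measurable_fun setT (W k)) ->
  <<s history_gen n >> `<=` measurable.
Proof.
move=> m0 mY mW; apply: smallest_sub; first exact: sigma_algebra_measurable.
move=> _ [[B mB <-]|[k /andP[k1 _] [] [B mB <-]]].
- exact: m0.
- exact: mY.
- exact: mW.
Qed.

Lemma history_gmeas0 n : gmeas (history_gen n) theta0.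
Proof. by move=> _ B mB; apply: sub_sigma_algebra; left; exists B. Qed.

Lemma history_gmeasY n k : (1 <= k <= n)%N -> gmeas (history_gen n) (Y k).
Proof.
by move=> kn _ B mB; apply: sub_sigma_algebra; right; exists k => //; left; exists B.
Qed.

Lemma history_gmeasW n k : (1 <= k <= n)%N -> gmeas (history_gen n) (W k).
Proof.
by move=> kn _ B mB; apply: sub_sigma_algebra; right; exists k => //; right; exists B.
Qed.

Lemma history_sub n : <<s history_gen n >> `<=` <<s history_gen n.+1 >>.
Proof.
apply: smallest_sub; first exact: smallest_sigma_algebra.
move=> A [h|[k /andP[k1 kn] h]]; first by apply: sub_sigma_algebra; left.
by apply: sub_sigma_algebra; right; exists k => //=; rewrite k1 leqW.
Qed.

End history.

Section regularize.
Context {R : realType} {N : nat}.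

Definition stochastic (M : 'M[R]_N) := (forall i j, 0 <= M i j) /\ M *m ones = ones.

(* Stochasticity is only assumed almost surely; changing [W n] on a null set keeps
   every iterate in [blockpow G] surely, which avoids a.e. bookkeeping. *)
Definition regularize (M : 'M[R]_N) : 'M[R]_N :=
  if `[< stochastic M >] then M else 1%:M.

Lemma stochastic_regularize M : stochastic (regularize M).
Proof.
rewrite /regularize; case: asboolP => // _; split => [i j|]; last exact: mul1mx.
by rewrite mxE ler0n.
Qed.

Lemma regularize_id M : stochastic M -> regularize M = M.
Proof. by move=> sM; rewrite /regularize asboolT. Qed.

Lemma measurable_stochastic : measurable [set M | stochastic M].
Proof.
have -> : [set M | stochastic M] =
    (\bigcap_(i in [set: 'I_N]) \bigcap_(j in [set: 'I_N])
      ((fun M : 'M[R]_N => M i j) @^-1` `[0, +oo[%classic))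
    `&` (\bigcap_(i in [set: 'I_N]) ((fun M : 'M[R]_N => \sum_j M i j) @^-1` [set 1])).
  have onesE (M : 'M[R]_N) i : (M *m ones) i 0 = \sum_j M i j.
    by rewrite mxE; apply: eq_bigr => j _; rewrite mxE mulr1.
  apply/seteqP; split => [M [M0 M1]|M [M0 M1]]; split.
  - by move=> i _ j _ /=; rewrite in_itv/= andbT.
  - by move=> i _ /=; rewrite -onesE M1 mxE.
  - by move=> i j; have := M0 i I j I; rewrite /= in_itv/= andbT.
  - by apply/matrixP => i j; rewrite ord1 onesE mxE; exact: M1.
have mc i j : measurable_fun setT (fun M : 'M[R]_N => M i j).
  by apply: measurable_fun_coord; exact: measurable_id.
apply: measurableI.
  apply: fin_bigcap_measurable => // i _; apply: fin_bigcap_measurable => // j _.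
  by rewrite -[X in measurable X]setTI; exact: mc.
apply: fin_bigcap_measurable => // i _.
by rewrite -[X in measurable X]setTI; exact: measurable_sum.
Qed.

Lemma measurable_regularize : measurable_fun setT regularize.
Proof.
apply: measurable_mx => i j.
have -> : (fun M => regularize M i j) = (fun M : 'M[R]_N => M i j * \1_[set M | stochastic M] M +
    (1%:M : 'M[R]_N) i j * (1 - \1_[set M | stochastic M] M)).
  apply/funext => M; rewrite /regularize indicE; case: asboolP => h.
    by rewrite mem_set// mulr1 subrr mulr0 addr0.
  by rewrite memNset// mulr0 subr0 mulr1 add0r.
have mS := measurable_stochastic.
apply: measurable_funD; apply: measurable_funM => //.
- by apply: measurable_fun_coord; exact: measurable_id.
- by apply: measurable_funB => //; exact: measurable_indic.
Qed.

End regularize.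

(** * Joint independence of the mixing matrix from the past and the new sample *)

Section independence.
Context {disp : measure_display} {Omega : measurableType disp} {R : realType}.
Variable P : probability Omega R.
Context {d1 d2 : measure_display} {T1 : measurableType d1} {T2 : measurableType d2}.
Variables (H : set (set Omega)) (W : Omega -> T1) (Y : Omega -> T2).
Hypothesis sH : <<s H >> `<=` measurable.
Hypotheses (mW : measurable_fun setT W) (mY : measurable_fun setT Y).

Local Notation intg X := (P.-integrable setT (EFin \o X)).

(** The events where [X] is non-negative and where it is non-positive are both admissible tests, and
    [X] has constant sign on each. *)
Lemma gmeas_mean0_ae (X : Omega -> R) : gmeas H X -> intg X ->
  (forall A, <<s H >> A -> mean P (fun w => \1_A w * X w) = 0) ->
  {ae P, forall w, X w = 0}.
Proof.
move=> mX iX X0; have mX' := gmeas_measurable sH mX.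
have half (B : set R) s : measurable B -> (forall x, B x -> 0 <= s * x) ->
    {ae P, forall w, \1_(X @^-1` B) w * (s * X w) = 0}.
  move=> mB B0; have HB : <<s H >> (X @^-1` B) by exact: gmeas_preimage.
  have mB' := sH HB.
  have i1 : intg (fun w => \1_(X @^-1` B) w * (s * X w)).
    by apply: intg_indic => //; exact: intgZ.
  apply: mean_le0_ae => //.
  - exact: intg_measurable i1.
  - move=> w; rewrite indicE; case: (boolP (w \in _)) => [|_]; last by rewrite mul0r.
    by rewrite inE => /B0; rewrite mul1r.
  - under eq_fun do rewrite mulrCA.
    by rewrite meanZ ?X0 ?mulr0//; exact: intg_indic.
have hp : {ae P, forall w, \1_(X @^-1` `[0, +oo[%classic) w * (1 * X w) = 0}.
  by apply: half => // x; rewrite /= in_itv/= andbT mul1r.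
have hn : {ae P, forall w, \1_(X @^-1` `]-oo, 0]%classic) w * (-1 * X w) = 0}.
  by apply: half => // x; rewrite /= in_itv/= mulN1r oppr_ge0.
apply: filterS2 hp hn => w; rewrite !indicE mul1r mulN1r => h1 h2.
  have [Xw|Xw] := leP 0 (X w).
    by move: h1; rewrite mem_set ?mul1r//= in_itv/= Xw.
  by move: h2; rewrite mem_set ?mul1r; [lra|rewrite /= in_itv/= (ltW Xw)].
Qed.

(** Independence from the past makes the conditional probability of W in A almost surely constant.
    Conditional independence then pulls this constant out of the conditional probability of W in A
    and Y in B, and [mean_joint] extends the result to all joint events. *)
Lemma indep_joint : cond_indep P <<s H >> W Y -> indep_of_sigma P W <<s H >> ->
  forall A E, measurable A -> <<s joint_gen H Y >> E ->
    mean P (fun w => \1_(W @^-1` A) w * \1_E w) =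
    mean P (\1_(W @^-1` A)) * mean P (\1_E).
Proof.
move=> WY Wi A E mA JE; set c := mean P (\1_(W @^-1` A)).
have mWA : measurable (W @^-1` A) by rewrite -[X in measurable X]setTI; exact: mW.
have mE := joint_gen_measurable sH mY JE.
have i1 : intg (\1_(W @^-1` A)) by exact: integrable_indic.
have iE : intg (\1_E) by exact: integrable_indic.
have ixi : intg (fun w => \1_(W @^-1` A) w - c) by apply: intgB => //; exact: intg_cst.
suff : mean P (fun w => \1_E w * (\1_(W @^-1` A) w - c)) = 0.
  under eq_fun do rewrite mulrBr.
  rewrite meanB; [|exact: intg_indic|]; last first.
    by under eq_fun do rewrite mulrC; exact: intgZ.
  rewrite meanZr// => /eqP; rewrite subr_eq0 => /eqP h.
  by rewrite mulrC -h; congr mean; apply/funext => w; rewrite mulrC.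
apply: (mean_joint (G := H) (Y := Y)) => // {}E {JE mE iE} B HE mB.
have mE := sH HE.
have mYB : measurable (Y @^-1` B) by rewrite -[X in measurable X]setTI; exact: mY.
have [p1 [p2 [[_ [Z1 [mZ1 iZ1 ZE1 aeZ1]]] [iY [Z2 [_ iZ2 ZE2 aeZ2]]]
  [iWY [Z [_ iZ ZE aeZ]]]]]] := WY A B mA mB.
have Z1c : {ae P, forall w, Z1 w - c = 0}.
  apply: gmeas_mean0_ae.
  - have gZ1 : gmeas H Z1 by move=> _ C mC; apply: mZ1; exists C.
    by apply: (@measurable_funB _ (g_sigma_algebraType H)).
  - by apply: intgB => //; exact: intg_cst.
  - move=> F HF; have mF := sH HF.
    have iF : intg (\1_F) by exact: integrable_indic.
    under eq_fun do rewrite mulrBr.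
    rewrite meanB; [|exact: intg_indic|]; last first.
      by under eq_fun do rewrite mulrC; exact: intgZ.
    rewrite meanZr//; apply/eqP; rewrite subr_eq0; apply/eqP.
    have := ZE1 F HF; rewrite !setint_mean// => -[<-].
    transitivity (mean P (\1_(W @^-1` A `&` F))).
      by congr mean; apply/funext => w; rewrite indicI mulrC.
    by rewrite mean_indic ?Wi// ?fineM ?fin_num_measure -?mean_indic 1?mulrC//; exact: measurableI.
transitivity (mean P (fun w => \1_E w * (\1_(W @^-1` A `&` Y @^-1` B) w)) -
  c * mean P (fun w => \1_E w * \1_(Y @^-1` B) w)).
  rewrite -meanZ; last exact: intg_indic.
  rewrite -meanB; [|exact: intg_indic|by apply: intgZ; exact: intg_indic].
  congr mean; apply/funext => w; rewrite !indicI /= ; ring.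
have := ZE E HE; rewrite !setint_mean// => -[->].
have := ZE2 E HE; rewrite !setint_mean// => -[->].
rewrite -meanZ; last exact: intg_indic.
apply/eqP; rewrite subr_eq0; apply/eqP; apply: mean_ae.
- exact: intg_measurable (intg_indic mE iZ).
- exact: intg_measurable (intgZ c (intg_indic mE iZ2)).
- have p1c : {ae P, forall w, p1 w = c}.
    by apply: filterS2 Z1c aeZ1 => w /eqP; rewrite subr_eq0 => /eqP -> <-.
  by apply: filterS3 p1c aeZ2 aeZ => w p1c -> ->; rewrite p1c mulrCA.
Qed.

End independence.

(** * From almost sure limits to a perturbed solution, path by path *)

Section path.
Context {R : realType} {N d : nat}.
Hypothesis N_gt0 : (0 < N)%N.
Variables (f : 'I_N -> 'cV[R]_d -> R) (C : set 'cV[R]_d) (m : R) (r : \bar R).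
Variables (gamma : nat -> R) (th : nat -> 'cV[R]_(N * d)) (z : nat -> 'cV[R]_d).
Variable y : R -> 'cV[R]_d.
Hypotheses (cC : cvx C) (C0 : C !=set0) (kC : compact C).
Hypothesis fC1 : forall i, C1_on setT (f i).
Hypothesis gamma_gt0 : forall n, 0 < gamma n.+1.
Hypothesis gamma0 : gamma n @[n --> \oo] --> (0 : R).
Hypothesis tau_div : tau gamma n @[n --> \oo] --> +oo.
Hypothesis yE : forall n t, 0 <= t < gamma n.+1 -> y (tau gamma n + t) =
  avg (th n) + t *: ((tau gamma n.+1 - tau gamma n)^-1 *: (avg (th n.+1) - avg (th n))).
Hypothesis thC : forall n, blockpow C (th n.+1).
Hypotheses (zm : forall n, enorm (z n) <= m) (mr : (m%:E <= r)%E).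
Hypothesis dev0 : deviation (th n.+1) @[n --> \oo] --> (0 : R).
Hypothesis proj0 : enorm (avg (th n.+1) - eproj C (avg (th n.+1) + z n))
  @[n --> \oo] --> (0 : R).

Let G n := N%:R^-1 *: \sum_i grad (f i) (block (th n) i).
Let noise n := avg (th n.+2) - avg (th n.+1) - gamma n.+2 *: (- G n.+1 - z n).
Hypothesis noise_cvg : forall k, cvgn (fun n => \sum_(i < n) noise i k 0).

Let fbar x := N%:R^-1 * \sum_(i < N) f i x.
Let x n := avg (th n).
(* [th 0] need not lie in [blockpow C], whence the special values at [0]. *)
Let pt n := if n is k.+1 then eproj C (x n + z k) else x n.
Let v n := if n is k.+1 then - grad fbar (pt n) - (x n + z k - pt n)
  else - grad fbar (x 0%N) - 0.
Let h n := if n is k.+1 then - G n - z k else - grad fbar (x 0%N).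

Let xC n : C (x n.+1).
Proof. exact: (avg_in N_gt0 cC (thC n)). Qed.

Let gC i : continuous (grad (f i)).
Proof. by move=> u; have [] := fC1 i (x := u) I. Qed.

Let m_ge0 : 0 <= m.
Proof. exact: le_trans (enorm_ge0 _) (zm 0). Qed.

Let ptP n : [/\ C (pt n.+1), normal_cone C (pt n.+1) (x n.+1 + z n - pt n.+1),
  enorm (x n.+1 + z n - pt n.+1) <= enorm (z n)
  & enorm (x n.+1 - pt n.+1) ^+ 2 <= dotv (z n) (pt n.+1 - x n.+1)].
Proof. by apply: proj_normal; [exact: xC|exact: eproj_is_proj]. Qed.

(** Since [z] cancels, h - v consists of x - pt and of gradient differences between the blocks and
    [pt], which are small by uniform continuity on the compact set. *)
Let drift_h_v : enorm (h n - v n) @[n --> \oo] --> (0 : R).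
Proof.
rewrite -(cvg_shiftS (fun n => enorm (h n - v n))).
have bnd n : enorm (h n.+1 - v n.+1) <=
    \sum_i enorm (grad (f i) (pt n.+1) - grad (f i) (block (th n.+1) i)) +
    enorm (x n.+1 - pt n.+1).
  have -> : h n.+1 - v n.+1 = N%:R^-1 *: (\sum_i (grad (f i) (pt n.+1) -
      grad (f i) (block (th n.+1) i))) + (x n.+1 - pt n.+1).
    rewrite /h /v /G /fbar grad_mean// sumrB scalerBr.
    move: (N%:R^-1 *: \sum_i grad (f i) (pt n.+1))
      (N%:R^-1 *: \sum_i grad (f i) (block (th n.+1) i)) (x n.+1) (pt n.+1) (z n) => a b c e g.
    by apply/matrixP => i j; rewrite !mxE; ring.
  rewrite (le_trans (enormD _ _))// lerD2r enormZ ger0_norm ?invr_ge0//.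
  rewrite (le_trans _ (enorm_sum _ _))// ler_piMl ?enorm_ge0//.
  by rewrite invf_le1 ?ltr0n// ler1n.
apply/cvgrPdist_le => e e0; near_simpl.
have e2 : 0 < e / 2 / N%:R by rewrite !divr_gt0// ltr0n.
have uc i : exists dl : R, 0 < dl /\ forall a b, C a -> C b -> enorm (a - b) < dl ->
    enorm (grad (f i) a - grad (f i) b) <= e / 2 / N%:R.
  by have [dl dl0 H] := compact_unif_continuous kC (@gC i) e2; exists dl.
have [dl Hdl] := choice uc.
have near_dl i : \forall n \near \oo, enorm (x n.+1 - pt n.+1) + deviation (th n.+1) < dl i.
  have s0 : (fun n => enorm (x n.+1 - pt n.+1) + deviation (th n.+1)) @ \oo --> (0 : R).
    by rewrite -[X in _ --> X](addr0 0); apply: cvgD.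
  move/cvgrPdist_lt : s0 => /(_ (dl i) (proj1 (Hdl i))); apply: filterS => n.
  by rewrite sub0r normrN; apply: le_lt_trans; exact: ler_norm.
have near_all : \forall n \near \oo, forall i, enorm (x n.+1 - pt n.+1) + deviation (th n.+1) < dl i.
  exact: filter_forall.
near=> n; rewrite sub0r normrN ger0_norm ?enorm_ge0// (le_trans (bnd n))//.
rewrite [e in leRHS](splitr e) lerD//.
  rewrite (_ : e / 2 = \sum_(i < N) (e / 2 / N%:R)); last first.
    by rewrite sumr_const card_ord -(mulr_natr (_ / _)) divfK// pnatr_eq0 -lt0n.
  apply: ler_sum => i _; have [_ H] := Hdl i; apply: H.
  - by have [] := ptP n.
  - exact: thC.
  have Hn : enorm (x n.+1 - pt n.+1) + deviation (th n.+1) < dl i by move: i; near: n.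
  apply: le_lt_trans Hn; rewrite (le_trans (enorm_triangle (x n.+1) _ _))//.
  rewrite enormB lerD2l enormB /deviation (bigD1 i)//= lerDl.
  by rewrite sumr_ge0// => j _; exact: enorm_ge0.
have : `|0 - enorm (x n.+1 - pt n.+1)| <= e / 2.
  by near: n; move/cvgrPdist_le : proj0; apply; rewrite divr_gt0.
by rewrite sub0r normrN; apply: le_trans; exact: ler_norm.
Unshelve. all: by end_near. Qed.

(** An increment is a term of a convergent series plus [gamma] times a bounded drift. *)
Let step0 : enorm (x n.+1 - x n) @[n --> \oo] --> (0 : R).
Proof.
rewrite -(cvg_shiftS (fun n => enorm (x n.+1 - x n))).
have Gb : exists Kg, forall n, enorm (G n.+1) <= Kg.
  have Kf i : exists Ki, forall a, C a -> enorm (grad (f i) a) <= Ki.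
    by have [Ki _ HKi] := continuous_enorm_bounded kC C0 (@gC i); exists Ki.
  have [K HK] := choice Kf; exists (\sum_i K i) => n.
  rewrite enormZ ger0_norm ?invr_ge0//.
  have h0 : \sum_i enorm (grad (f i) (block (th n.+1) i)) <= \sum_i K i.
    by apply: ler_sum => i _; exact: HK (thC n i).
  apply: le_trans h0; rewrite (le_trans _ (enorm_sum _ _))// ler_piMl ?enorm_ge0//.
  by rewrite invf_le1 ?ltr0n// ler1n.
have [Kg HKg] := Gb.
have bnd n : enorm (x n.+2 - x n.+1) <= \sum_k `|noise n k 0| + gamma n.+2 * (Kg + m).
  have -> : x n.+2 - x n.+1 = noise n + gamma n.+2 *: (- G n.+1 - z n).
    by rewrite /noise -/(x _) -/(x _) subrK.
  rewrite (le_trans (enormD _ _))// lerD ?enorm_le_sum//.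
  rewrite enormZ gtr0_norm// ler_wpM2l ?(ltW (gamma_gt0 _))//.
  by rewrite (le_trans (enormD _ _))// !enormN lerD.
have g2 : gamma n.+2 @[n --> \oo] --> (0 : R).
  pose g' n := gamma n.+1.
  have g1 : g' n @[n --> \oo] --> (0 : R) by rewrite (cvg_shiftS gamma).
  have {}g1 : g' n.+1 @[n --> \oo] --> (0 : R) by rewrite (cvg_shiftS g').
  exact: g1.
have nz k : `|noise n k 0| @[n --> \oo] --> (0 : R).
  rewrite -(normr0 R); apply: cvg_norm; apply: cvg_series_cvg_0.
  by move: (@noise_cvg k); rewrite /series/=; under eq_fun do rewrite -(big_mkord xpredT (fun i => noise i k 0)).
apply: (@squeeze_cvgr _ _ _ _ (cst 0) (fun n => \sum_k `|noise n k 0| + gamma n.+2 * (Kg + m))).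
- by near=> n; rewrite /= enorm_ge0 bnd.
- exact: cvg_cst.
- rewrite [X in _ --> X](_ : _ = 0 + 0 * (Kg + m)); last by rewrite mul0r addr0.
  apply: cvgD; last exact: cvgMl.
  elim: (index_enum _) => [|k s IH]; first by under eq_fun do rewrite big_nil; exact: cvg_cst.
  under eq_fun do rewrite big_cons.
  have := cvgD (nz k) IH; rewrite addr0; exact.
Unshelve. all: by end_near. Qed.

Lemma path_perturbed_solution : perturbed_solution (projected_drift fbar C r) y.
Proof.
apply: (@interp_perturbed _ _ gamma x y gamma_gt0 tau_div yE _ h v pt) => //.
- case=> [|n].
    exists 0 => //; split=> [u Cu|]; first by rewrite dotv0l.
    by rewrite enorm0 (le_trans _ mr)// lee_fin.
  have [Cp nc le1 _] := ptP n.
  exists (x n.+1 + z n - pt n.+1) => //; split => //.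
  (* The normal vector is no longer than [z n] by minimality of the projection, hence it is bounded
     by [m]. *)
  by apply: le_trans mr; rewrite lee_fin (le_trans le1).
- by rewrite -(cvg_shiftS (fun n => enorm (x n - pt n))); exact: proj0.
- move=> k; move/cvg_ex : (@noise_cvg k) => [l Hl].
  (* The noise series starts with the second increment, so the first term is split off as a
     constant. *)
  pose s n := \sum_(i < n) (x i.+1 - x i - gamma i.+1 *: h i) k 0.
  apply/cvg_ex; exists (s 1%N + l); rewrite -(cvg_shiftS s).
  have -> : (fun n => s n.+1) = (fun n => s 1%N + \sum_(i < n) noise i k 0).
    by apply/funext => n; rewrite /s big_ord1 big_ord_recl.
  by apply: cvgD; [exact: cvg_cst|exact: Hl].
Qed.

End path.

Lemma measurable_step {R : realType} {disp : measure_display} {T : measurableType disp}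
  {N d : nat} (G : set 'cV[R]_d) (X Y : T -> 'cV[R]_(N * d)) (W : T -> 'M[R]_N) (g : R) :
  cvx G -> G !=set0 -> compact G ->
  measurable_fun setT X -> measurable_fun setT Y -> measurable_fun setT W ->
  measurable_fun setT (fun t => (W t *t 1%:M) *m proj_step G (X t) (Y t) g).
Proof.
move=> cG G0 kG mX mY mW; apply: measurable_mx => l j; rewrite {j}ord1.
rewrite -(mxtens_unindexK l); case: (mxtens_unindex l) => i k.
under eq_fun do rewrite -blockE block_tens summxE.
apply: measurable_sum => j; under eq_fun do rewrite coordZ.
apply: measurable_funM; first exact: measurable_fun_coord.
by apply: measurable_proj_step => // q; exact: measurable_fun_coord.
Qed.

Lemma measurable_stack_grad {R : realType} {disp : measure_display} {T : measurableType disp}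
  {N d : nat} (f : 'I_N -> 'cV[R]_d -> R) (X : T -> 'cV[R]_(N * d)) l :
  (forall i, C1_on setT (f i)) -> measurable_fun setT X ->
  measurable_fun setT (fun t => (- stack (fun i => grad (f i) (block (X t) i))) l 0).
Proof.
move=> fC1 mX; rewrite -(mxtens_unindexK l); case: (mxtens_unindex l) => i k.
under eq_fun do rewrite coordN stackE.
apply: measurableT_comp => //.
apply: (measurable_continuous_coord (X := fun t => block (X t) i)
  (g := fun x => grad (f i) x k 0)).
  by move=> j; under eq_fun do rewrite blockE; exact: measurable_fun_coord.
move=> x; apply: (@continuous_comp _ _ _ (grad (f i)) (fun M : 'cV[R]_d => M k 0)).
  by have [] := fC1 i x I.
exact: coord_continuous.
Qed.

Section ae_expectation.
Context {disp : measure_display} {Omega : measurableType disp} {R : realType}.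
Variable P : probability Omega R.

Lemma Emx_ae m n (A B : Omega -> 'M[R]_(m, n)) :
  measurable_fun setT A -> measurable_fun setT B ->
  {ae P, forall w, A w = B w} -> Emx P A = Emx P B.
Proof.
move=> mA mB AB; apply/matrixP => i j; rewrite !EmxE; apply: mean_ae.
- exact: measurable_fun_coord.
- exact: measurable_fun_coord.
- by apply: filterS AB => w ->.
Qed.

End ae_expectation.

Lemma ereal_sup_moment {R : realType} (I : Type) (A : set I) (phi : I -> \bar R) :
  A !=set0 -> (forall i, A i -> (0 <= phi i)%E) ->
  (ereal_sup [set phi i | i in A] < +oo)%E ->
  exists m : R, [/\ 0 <= m, ereal_sup [set phi i | i in A] = m%:E
    & forall i, A i -> (phi i <= m%:E)%E].
Proof.
move=> [i0 Ai0] phi0 supoo.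
have le i : A i -> (phi i <= ereal_sup [set phi i | i in A])%E.
  by move=> Ai; apply: ereal_sup_ubound; exists i.
have s0 : (0 <= ereal_sup [set phi i | i in A])%E := le_trans (phi0 _ Ai0) (le _ Ai0).
have sE : (ereal_sup [set phi i | i in A])%E = (fine (ereal_sup [set phi i | i in A]))%:E.
  by rewrite fineK// ge0_fin_numE.
exists (fine (ereal_sup [set phi i | i in A])); split => //; first exact: fine_ge0.
by move=> i Ai; rewrite -sE; exact: le.
Qed.

(** The inequality t <= 1 + t^2 transfers the uniform second-moment bound to first moments; mu is
    finite for this reason. *)
Lemma first_moment_le {R : realType} n (mu : probability 'cV[R]_n R) (M : R) :
  (\int[mu]_y (enorm y ^+ 2)%:E <= M%:E)%E -> (\int[mu]_y (enorm y)%:E <= (1 + M)%:E)%E.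
Proof.
move=> H.
have me : measurable_fun setT (@enorm R n) by apply: continuous_mx_measurable; exact: enorm_continuous.
have me2 : measurable_fun setT (fun y : 'cV[R]_n => enorm y ^+ 2) by exact: measurable_funX.
apply: (@le_trans _ _ (\int[mu]_y ((cst 1%E) y + (enorm y ^+ 2)%:E))%E).
  apply: ge0_le_integral => //.
  - by move=> y _; rewrite lee_fin enorm_ge0.
  - exact/measurable_EFinP.
  - by apply: emeasurable_funD => //; exact/measurable_EFinP.
  - move=> y _; rewrite -EFinD lee_fin; move: (enorm y) => t; nra.
rewrite ge0_integralD//; last 2 first.
- by move=> y _; rewrite lee_fin sqr_ge0.
- exact/measurable_EFinP.
rewrite EFinD leeD// integral_cst// mul1e.
by rewrite [X in (X <= _)%E]probability_setT.
Qed.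

Lemma rho_ae {disp : measure_display} {Omega : measurableType disp} {R : realType}
  (P : probability Omega R) (N : nat) (W W' : nat -> Omega -> 'M[R]_N) n :
  measurable_fun setT (W n) -> measurable_fun setT (W' n) ->
  {ae P, forall w, W n w = W' n w} -> rho P W n = rho P W' n.
Proof.
have mq (A : Omega -> 'M[R]_N) (c : 'M[R]_N) : measurable_fun setT A ->
    measurable_fun setT (fun w => (A w)^T *m c *m A w).
  move=> mA; apply: measurable_mx => i j; under eq_fun do rewrite mxE.
  apply: measurable_sum => k; apply: measurable_funM; last exact: measurable_fun_coord.
  under eq_fun do rewrite mxE; apply: measurable_sum => l; apply: measurable_funM => //.
  by under eq_fun do rewrite mxE; exact: measurable_fun_coord.
move=> mW mW' WW'; rewrite /rho; congr spectral_norm; apply: Emx_ae.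
- exact: mq.
- exact: mq.
- by apply: filterS WW' => w ->.
Qed.

Theorem proposition3 (R : realType) (N d : nat) (N_ge1 : (1 <= N)%N)
  (d_ge1 : (1 <= d)%N)
  (disp : measure_display) (Omega : measurableType disp)
  (P : probability Omega R)
  (f : 'I_N -> 'cV[R]_d -> R)
  (gamma : nat -> R)
  (theta : nat -> Omega -> 'cV[R]_(N * d))
  (Y : nat -> Omega -> 'cV[R]_(N * d))
  (W : nat -> Omega -> 'M[R]_N)
  (mu : 'cV[R]_(N * d) -> probability 'cV[R]_(N * d) R)
  (p : nat) (q : 'I_p -> 'cV[R]_d -> R) (G : set 'cV[R]_d)
  (Theta : Omega -> R -> 'cV[R]_d)
  (theta0_meas : measurable_fun setT (theta 0%N))
  (Y_meas : forall n, (1 <= n)%N -> measurable_fun setT (Y n))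
  (W_meas : forall n, (1 <= n)%N -> measurable_fun setT (W n))
  (* the algorithm *)
  (algorithm : forall n w,
     theta n.+1 w = (W n.+1 w *t 1%:M) *m
       eproj (blockpow G) (theta n w + gamma n.+1 *: Y n.+1 w))
  (* Assumption 1 *)
  (A1a_stoch : forall n, (1 <= n)%N -> {ae P, forall w,
     (forall i j, 0 <= W n w i j) /\ W n w *m ones = ones})
  (A1a_mean : forall n, (1 <= n)%N -> ones^T *m Emx P (W n) = ones^T)
  (A1b : n%:R * (1 - rho P W n) @[n --> \oo] --> +oo)
  (A1c_cond_indep : forall n, (1 <= n)%N ->
     cond_indep P (history (theta 0%N) Y W n) (W n.+1) (Y n.+1))
  (A1c_indep : forall n, (1 <= n)%N ->
     indep_of_sigma P (W n.+1) (history (theta 0%N) Y W n))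
  (A1c_law : forall n, (1 <= n)%N -> forall A, measurable A ->
     is_cond_prob P (history (theta 0%N) Y W n) (Y n.+1 @^-1` A)
       (fun w => fine (mu (theta n w) A)))
  (A1d : forall i, C1_on setT (f i))
  (A1e : forall n, (1 <= n)%N ->
     is_cond_exp_vec P (history (theta 0%N) Y W n) (Y n.+1)
       (fun w => - stack (fun i => grad (f i) (block (theta n w) i))))
  (A1f : (ereal_sup [set \int[mu th]_y (enorm y ^+ 2)%:E
            | th in blockpow G] < +oo)%E)
  (* Assumption 2 *)
  (A2a_pos : forall n, (1 <= n)%N -> 0 < gamma n)
  (A2a_div : tau gamma n @[n --> \oo] --> +oo)
  (A2b : exists alpha : R, [/\ 2^-1 < alpha,
     n%:R `^ alpha * gamma n @[n --> \oo] --> (0 : R)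
   & (0 < limn_einf (fun n =>
        ((1 - rho P W n) / (n%:R `^ alpha * gamma n))%:E))%E])
  (* Assumption 3 *)
  (p_ge1 : (1 <= p)%N)
  (G_def : G = [set x | forall j, q j x <= 0])
  (A3a_nonempty : G !=set0)
  (A3a_compact : compact G)
  (A3b_convex : forall j, convex_function setT (q j))
  (A3b_C1 : forall j, exists V : set 'cV[R]_d,
     [/\ open V, boundary G `<=` V & C1_on V (q j)])
  (A3c : forall x, boundary G x ->
     free [seq grad (q j) x | j <- enum 'I_p & q j x == 0])
  (* the interpolated process *)
  (Theta_def : forall w n t, 0 <= t < gamma n.+1 ->
     Theta w (tau gamma n + t) = avg (theta n w) +
       t *: ((tau gamma n.+1 - tau gamma n)^-1 *:
         (avg (theta n.+1 w) - avg (theta n w)))) :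
  {ae P, forall w,
     perturbed_solution
       (projected_drift (fun x => N%:R^-1 * \sum_(i < N) f i x) G
          (3%:E * ereal_sup [set \int[mu th]_y (enorm y)%:E
                               | th in blockpow G])%E)
       (Theta w)}.

Proof.
have cG : cvx G by rewrite G_def; exact: sublevel_cvx.
pose C := blockpow (N := N) G.
have C0 : C !=set0.
  by have [x Gx] := A3a_nonempty; exists (stack (fun=> x)) => i; rewrite stackK.
have mnorm : measurable_fun setT (@enorm R (N * d)).
  by apply: continuous_mx_measurable; exact: enorm_continuous.
have [m2 [m2_ge0 _ mu2]] : exists m2 : R, [/\ 0 <= m2,
    (ereal_sup [set \int[mu th]_y (enorm y ^+ 2)%:E | th in C] = m2%:E)%E &
    forall th, C th -> (\int[mu th]_y (enorm y ^+ 2)%:E <= m2%:E)%E].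
  apply: ereal_sup_moment => // th _.
  by apply: integral_ge0 => y _; rewrite lee_fin sqr_ge0.
have [m1 [m1_ge0 m1E mu1]] : exists m1 : R, [/\ 0 <= m1,
    (ereal_sup [set \int[mu th]_y (enorm y)%:E | th in C] = m1%:E)%E &
    forall th, C th -> (\int[mu th]_y (enorm y)%:E <= m1%:E)%E].
  apply: ereal_sup_moment => //.
    by move=> th _; apply: integral_ge0 => y _; rewrite lee_fin enorm_ge0.
  apply: (@le_lt_trans _ _ (1 + m2)%:E); last exact: ltry.
  by apply: ge_ereal_sup => _ [th Cth <-]; apply: first_moment_le; exact: mu2.
have [al [al_gt gamma_al rho_gamma]] := A2b.
pose Gs := history_gen (theta 0%N) Y W.
have sG n : <<s Gs n >> `<=` measurable by exact: history_measurable.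
have GS n : <<s Gs n >> `<=` <<s Gs n.+1 >> by exact: history_sub.
(* Index 0 is left as it is, so that [rho] agrees for [W] and [W'] at every index, including 0. *)
pose W' n w := if n is k.+1 then regularize (W n w) else W 0%N w.
pose fix theta' n w {struct n} := if n is k.+1 then
  (W' n w *t 1%:M) *m proj_step G (theta' k w) (Y n w) (gamma n) else theta 0%N w.
have gW n : gmeas (Gs n.+1) (W' n.+1).
  rewrite /gmeas /W'; apply: (measurableT_comp measurable_regularize).
  by apply: history_gmeasW; rewrite /= leqnn.
have mW' n : measurable_fun setT (W' n.+1) := gmeas_measurable (sG n.+1) (gW n).
have gtheta n : gmeas (Gs n) (theta' n).
  elim: n => [|n IH]; first exact: history_gmeas0.
  apply: measurable_step => //.
  - exact: gmeas_sub (GS n) IH.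
  - by apply: history_gmeasY; rewrite /= leqnn.
  - exact: gW.
have mtheta n := gmeas_measurable (sG n) (gtheta n).
have aeWW : {ae P, forall w n, W' n w = W n w}.
  apply: ae_foralln => -[|n]; first exact: aeW.
  by apply: filterS (A1a_stoch n.+1 isT) => w sW; exact: regularize_id.
have aetheta : {ae P, forall w n, theta' n w = theta n w}.
  apply: filterS aeWW => w WW; elim=> [//|n IH].
  by rewrite algorithm -IH -(WW n.+1).
have W'0 n w i j : 0 <= W' n.+1 w i j by case: (stochastic_regularize (W n.+1 w)).
have W'1 n w : W' n.+1 w *m ones = ones by case: (stochastic_regularize (W n.+1 w)).
have theta'C n w : C (theta' n.+1 w).
  exact: (step_in cG A3a_nonempty A3a_compact (@W'0 n) (@W'1 n)
    (th := theta' n) (Y := Y n.+1) (g := gamma n.+1)).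
have W'mean n : ones^T *m Emx P (W' n.+1) = ones^T.
  rewrite -[RHS](A1a_mean n.+1 isT); congr (_ *m _); apply: Emx_ae => //; first exact: W_meas.
  by apply: filterS aeWW => w; exact.
have rhoE : rho P W = rho P W'.
  apply/funext => -[|n]; first by [].
  by apply: rho_ae => //; [exact: W_meas|apply: filterS aeWW => w ->].
(* The moment bounds concern laws indexed by points of [C]; [theta] is known to lie there almost
   surely, through its equality with [theta']. *)
have aelaw (g : 'cV[R]_(N * d) -> R) (m : R) n :
    (forall th, C th -> (\int[mu th]_y (g y)%:E <= m%:E)%E) ->
    {ae P, forall w, (\int[mu (theta n.+1 w)]_y (g y)%:E <= m%:E)%E}.
  by move=> H; apply: filterS aetheta => w tt; apply: H; rewrite -tt; exact: theta'C.
have mnorm2 : measurable_fun setT (fun y : 'cV[R]_(N * d) => enorm y ^+ 2).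
  exact: measurable_funX.
have gamma_pos n : 0 < gamma n.+1 by exact: A2a_pos.
have [z [zm aez]] : exists z : nat -> Omega -> 'cV[R]_d,
  (forall n w, enorm (z n w) <= m1) /\
  {ae P, forall w,
    [/\ deviation (theta' n.+1 w) @[n --> \oo] --> (0 : R),
        enorm (avg (theta' n.+1 w) - eproj G (avg (theta' n.+1 w) + z n w))
          @[n --> \oo] --> (0 : R)
      & forall k, cvgn (fun n => \sum_(i < n) (avg (theta' i.+2 w) - avg (theta' i.+1 w) -
          gamma i.+2 *: (- mean_grad f (theta' i.+1) w - z i w)) k 0)]}.
  apply: (@ae_decomposition _ _ _ P N d N_ge1 f G m1 m2 gamma Gs theta' Y W' cG
    A3a_nonempty A3a_compact A1d m1_ge0 m2_ge0 A2a_pos sG GS gtheta) => //.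
  - by move=> n; exact: Y_meas.
  (* Independence is assumed for [W]; it passes to [W'] because the corresponding events differ by a
     null set. *)
  - move=> n A E mA JE.
    have ae1 : {ae P, forall w, \1_(W' n.+2 @^-1` A) w = \1_(W n.+2 @^-1` A) w :> R}.
      by apply: filterS aeWW => w WW; rewrite -[LHS]/(\1_A (W' n.+2 w)) WW.
    have mWA : measurable (W n.+2 @^-1` A).
      by rewrite -[X in measurable X]setTI; exact: (W_meas n.+2).
    have mWA' : measurable (W' n.+2 @^-1` A).
      by rewrite -[X in measurable X]setTI; exact: mW'.
    have mE := joint_gen_measurable (@sG n.+1) (Y_meas n.+2 isT) JE.
    rewrite (mean_ae (Y := fun w => \1_(W n.+2 @^-1` A) w * \1_E w)).
    + rewrite (mean_ae (X := \1_(W' n.+2 @^-1` A)) (Y := \1_(W n.+2 @^-1` A))) => //.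
      exact: (indep_joint (@sG n.+1) (W_meas n.+2 isT) (Y_meas n.+2 isT)
        (A1c_cond_indep n.+1 isT) (A1c_indep n.+1 isT)).
    + by apply: measurable_funM.
    + by apply: measurable_funM.
    + by apply: filterS ae1 => w ->.
  - move=> n; apply: (@intg_moment _ _ _ P _ _ _ _ _ (@sG n.+1) (Y_meas n.+2 isT)
      (A1c_law n.+1 isT) (fun y => enorm y ^+ 2) m2) => //.
    + by move=> y; exact: sqr_ge0.
    + exact: aelaw.
  - move=> n; apply: (@condexp_le_moment _ _ _ P _ _ _ _ _ (@sG n.+1) (Y_meas n.+2 isT)
      (A1c_law n.+1 isT) (@enorm R (N * d)) m1) => //.
    + by move=> y; exact: enorm_ge0.
    + exact: aelaw.
  - move=> n; apply: (@condexp_le_moment _ _ _ P _ _ _ _ _ (@sG n.+1) (Y_meas n.+2 isT)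
      (A1c_law n.+1 isT) (fun y => enorm y ^+ 2) m2) => //.
    + by move=> y; exact: sqr_ge0.
    + exact: aelaw.
  - move=> n l A HA; have mA := sG n.+1 A HA.
    have [iY [Z [_ iZ ZE aeZ]]] := A1e n.+1 isT l.
    have := ZE A HA; rewrite !setint_mean// => -[->]; apply: mean_ae.
    + exact: intg_measurable (intg_indic mA iZ).
    + by apply: measurable_funM => //; exact: measurable_stack_grad.
    + by apply: filterS2 aeZ aetheta => w -> tt; rewrite tt.
  - exact: al_gt.
  - by rewrite -rhoE; exact: A1b.
  - exact: gamma_al.
  - by rewrite -rhoE.
apply: filterS2 aetheta aez => w tt [dev0 proj0 noise_cvg].
rewrite m1E.
apply: (@path_perturbed_solution _ _ _ N_ge1 f G m1 (3%:E * m1%:E)%E gamma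
  (theta' ^~ w) (z ^~ w)) => //.
- by apply: step_size_cvg0 gamma_al; rewrite (le_trans _ (ltW al_gt))// invr_ge0.
- by move=> n t tn; rewrite !tt; exact: Theta_def.
- by move=> n; exact: theta'C.
(* The radius 3 mu of the drift covers the bound mu obtained for the normal part. *)
- by rewrite -EFinM lee_fin; move: m1_ge0; clear; lra.
Qed.
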